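(* Let $\mathfrak{g}$ be a finite dimensional complex simple Lie algebra with root system $\Phi$ of rank $r\ge 2$, and let $q$ be a primitive complex $\ell$th root of unity, where $\ell>1$ is an odd integer that is not divisible by $3$ if $\Phi$ is of type $\mathrm{G}_2$. Then the small half-quantum group $u_q^{>0}(\mathfrak{g})$ is wild.
   Context: $u_q(\mathfrak{g})$ denotes Lusztig's small quantum group: the finite dimensional Hopf algebra obtained by specializing Lusztig's divided power integral form of the quantized enveloping algebra of $\mathfrak{g}$ at $q$, taking the subalgebra generated by the Chevalley-type generators $E_i,F_i,K_i^{\pm1}$ ($1\le i\le r$), and factoring out the relations $K_i^\ell=1$. $u_q^{>0}(\mathfrak{g})$ is the subalgebra of $u_q(\mathfrak{g})$ generated by $E_1,\dots,E_r$ (it corresponds to the largest nilpotent ideal of the standard Borel subalgebra and has dimension $\ell^{|\Phi^+|}$). A finite dimensional $\mathbb{C}$-algebra $B$ is wild if there is a finitely generated $B$-$\mathbb{C}\langle X,Y\rangle$-bimodule $F$, free as a right $\mathbb{C}\langle X,Y\rangle$-module, such that the functor $F\otimes_{\mathbb{C}\langle X,Y\rangle}-$ from finite dimensional $\mathbb{C}\langle X,Y\rangle$-modules to finite dimensional $B$-modules preserves indecomposability and reflects isomorphism. *)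

(* Defs.v *)
From HB Require Import structures.
From mathcomp Require Import all_boot all_order all_algebra.
From mathcomp Require Import generic_quotient ring_quotient.
From mathcomp Require Import boolp.
From mathcomp Require Import finmap monalg.

Set Implicit Arguments.
Unset Strict Implicit.
Unset Printing Implicit Defensive.

Import GRing.Theory.
Local Open Scope ring_scope.
Local Open Scope quotient_scope.

(* The library's [algType] requires 1 != 0, which is not available a priori for
   algebras given by generators and relations. *)
Record algebra (K : comPzRingType) := Algebra {
  alg_ring :> pzRingType;
  alg_in : {rmorphism K -> alg_ring};
  alg_inC : forall k x, alg_in k * x = x * alg_in k
}.

Section FreeAlgebra.
Variables (K : fieldType) (X : choiceType).

Fact malgC_central (k : K) (x : {malg K[{fmonom X}]}) :
  malgC k * x = x * malgC k.
Proof.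
rewrite [x in RHS]monalgE [x in LHS]monalgE big_distrl big_distrr /=.
apply: eq_bigr => i _; rewrite !malgM_def !fgmulUU.
by rewrite mul1m mulm1 mulrC.
Qed.

Definition free_algebra : algebra K := Algebra malgC_central.

Definition free_gen (x : X) : free_algebra := << fmu x >>.
End FreeAlgebra.

Section QuotientAlgebra.
Variables (K : comPzRingType) (A : algebra K) (S : A -> Prop).

Inductive in_ideal : A -> Prop :=
| in_ideal_gen x : S x -> in_ideal x
| in_ideal0 : in_ideal 0
| in_idealD x y : in_ideal x -> in_ideal y -> in_ideal (x + y)
| in_idealMl a x : in_ideal x -> in_ideal (a * x)
| in_idealMr x a : in_ideal x -> in_ideal (x * a).

Definition ideal : {pred A} := fun x => `[< in_ideal x >].

Fact ideal_zmod_closed : zmod_closed ideal.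
Proof.
split=> [|x y /asboolP Ix /asboolP Iy]; first exact/asboolP/in_ideal0.
apply/asboolP/in_idealD => //.
by rewrite -[y]mul1r -mulNr; apply: in_idealMl.
Qed.
HB.instance Definition _ := GRing.isZmodClosed.Build A ideal ideal_zmod_closed.

Definition quotient_car : Type := Quotient.quot ideal.
HB.instance Definition _ := GRing.Zmodule.on quotient_car.
HB.instance Definition _ := EqQuotient.on quotient_car.
Local Notation Q := quotient_car.

Definition quotient_pi (x : A) : Q := \pi_Q x.
Local Notation pi := quotient_pi.

Fact quotient_reprK (x : Q) : pi (repr x) = x.
Proof. exact: reprK. Qed.

Fact quotient_piP (x y : A) : pi x = pi y <-> in_ideal (x - y).
Proof.
have E : (x - y \in ideal) = (pi x == pi y) by exact: Quotient.idealrBE.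
by split=> [/eqP|Ixy]; [rewrite -E => /asboolP | apply/eqP; rewrite -E; apply/asboolP].
Qed.

Fact quotient_piD (x y : A) : pi (x + y) = pi x + pi y.
Proof. exact: Quotient.pi_add. Qed.

Definition quotient_mul (x y : Q) : Q := pi (repr x * repr y).

Fact quotient_piM (x y : A) : pi (x * y) = quotient_mul (pi x) (pi y).
Proof.
apply/quotient_piP.
have rI (z : A) : in_ideal (z - repr (pi z)).
  by apply/quotient_piP; rewrite quotient_reprK.
rewrite -(subrK (repr (pi x) * y) (x * y)) -mulrBl -addrA -mulrBr.
by apply: in_idealD; [apply: in_idealMr | apply: in_idealMl].
Qed.

Fact quotient_mulA : associative quotient_mul.
Proof.
move=> x y z; rewrite -[x]quotient_reprK -[y]quotient_reprK -[z]quotient_reprK.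
by rewrite -!quotient_piM mulrA.
Qed.
Fact quotient_mul1 : left_id (pi 1) quotient_mul.
Proof. by move=> x; rewrite -[x]quotient_reprK -quotient_piM mul1r. Qed.
Fact quotient_mulr1 : right_id (pi 1) quotient_mul.
Proof. by move=> x; rewrite -[x]quotient_reprK -quotient_piM mulr1. Qed.
Fact quotient_mulDl : left_distributive quotient_mul +%R.
Proof.
move=> x y z; rewrite -[x]quotient_reprK -[y]quotient_reprK -[z]quotient_reprK.
by rewrite -quotient_piD -!quotient_piM -quotient_piD mulrDl.
Qed.
Fact quotient_mulDr : right_distributive quotient_mul +%R.
Proof.
move=> x y z; rewrite -[x]quotient_reprK -[y]quotient_reprK -[z]quotient_reprK.
by rewrite -quotient_piD -!quotient_piM -quotient_piD mulrDr.
Qed.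
HB.instance Definition _ := GRing.Zmodule_isPzRing.Build Q
  quotient_mulA quotient_mul1 quotient_mulr1 quotient_mulDl quotient_mulDr.

Definition quotient_in (k : K) : Q := pi (alg_in A k).
Fact quotient_in_zmod : zmod_morphism quotient_in.
Proof.
move=> x y; rewrite /quotient_in rmorphB.
by apply: (addIr (pi (alg_in A y))); rewrite -quotient_piD !subrK.
Qed.
Fact quotient_in_monoid : monoid_morphism quotient_in.
Proof.
by split=> [|x y]; rewrite /quotient_in ?rmorph1 // rmorphM quotient_piM.
Qed.
HB.instance Definition _ :=
  GRing.isZmodMorphism.Build K Q quotient_in quotient_in_zmod.
HB.instance Definition _ :=
  GRing.isMonoidMorphism.Build K Q quotient_in quotient_in_monoid.

Fact quotient_inC k (x : Q) : quotient_in k * x = x * quotient_in k.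
Proof.
rewrite -[x]quotient_reprK; transitivity (pi (alg_in A k * repr x)).
  by rewrite quotient_piM.
by rewrite alg_inC quotient_piM.
Qed.

Definition quotient_algebra : algebra K := Algebra quotient_inC.

Definition quotient_proj (x : A) : quotient_algebra := quotient_pi x.
End QuotientAlgebra.

Section GeneratedSubalgebra.
Variables (K : comPzRingType) (A : algebra K) (S : A -> Prop).

Inductive in_subalgebra : A -> Prop :=
| in_subalgebra_gen x : S x -> in_subalgebra x
| in_subalgebra_in k : in_subalgebra (alg_in A k)
| in_subalgebraD x y :
    in_subalgebra x -> in_subalgebra y -> in_subalgebra (x + y)
| in_subalgebraM x y :
    in_subalgebra x -> in_subalgebra y -> in_subalgebra (x * y).

Definition subalgebra_pred : {pred A} := fun x => `[< in_subalgebra x >].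

Fact subalgebra_subring_closed : subring_closed subalgebra_pred.
Proof.
split=> [|x y /asboolP Ix /asboolP Iy|x y /asboolP Ix /asboolP Iy].
- by apply/asboolP; rewrite -(rmorph1 (alg_in A)); apply: in_subalgebra_in.
- apply/asboolP/in_subalgebraD => //; rewrite -[y]mul1r -mulNr.
  apply: in_subalgebraM => //; rewrite -(rmorphN1 (alg_in A)).
  exact: in_subalgebra_in.
- exact/asboolP/in_subalgebraM.
Qed.
HB.instance Definition _ :=
  GRing.isSubringClosed.Build A subalgebra_pred subalgebra_subring_closed.

Record subalgebra_car := SubalgebraElt {
  subalgebra_val : A; _ : subalgebra_val \in subalgebra_pred
}.
HB.instance Definition _ := [isSub for subalgebra_val].
HB.instance Definition _ := [Choice of subalgebra_car by <:].
HB.instance Definition _ := GRing.SubChoice_isSubPzRing.Build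
  A subalgebra_pred subalgebra_car subalgebra_subring_closed.

Fact subalgebra_in_subproof k : alg_in A k \in subalgebra_pred.
Proof. exact/asboolP/in_subalgebra_in. Qed.
Definition subalgebra_in k : subalgebra_car :=
  SubalgebraElt (subalgebra_in_subproof k).
Fact subalgebra_in_zmod : zmod_morphism subalgebra_in.
Proof. by move=> x y; apply: val_inj; rewrite rmorphB /= rmorphB. Qed.
Fact subalgebra_in_monoid : monoid_morphism subalgebra_in.
Proof.
by split=> [|x y]; apply: val_inj; rewrite ?rmorph1 ?rmorphM /= ?rmorph1 ?rmorphM.
Qed.
HB.instance Definition _ :=
  GRing.isZmodMorphism.Build K subalgebra_car subalgebra_in subalgebra_in_zmod.
HB.instance Definition _ := GRing.isMonoidMorphism.Build
  K subalgebra_car subalgebra_in subalgebra_in_monoid.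

Fact subalgebra_inC k (x : subalgebra_car) :
  subalgebra_in k * x = x * subalgebra_in k.
Proof. by apply: val_inj; rewrite !rmorphM /= alg_inC. Qed.

Definition subalgebra : algebra K := Algebra subalgebra_inC.

Definition subalgebra_incl (x : subalgebra) : A := subalgebra_val x.
End GeneratedSubalgebra.

Section Modules.
Variables (C : comPzRingType) (B : algebra C).

Definition finite_dim (V : lmodType B) : Prop :=
  exists (n : nat) (e : 'I_n -> V),
    forall v, exists c : 'I_n -> C, v = \sum_i alg_in B (c i) *: e i.

Definition is_submodule (V : lmodType B) (P : V -> Prop) : Prop :=
  [/\ P 0, forall u v, P u -> P v -> P (u + v)
    & forall (b : B) v, P v -> P (b *: v)].

Definition indecomposable (V : lmodType B) : Prop :=
  (exists v : V, v != 0) /\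
  forall P Q : V -> Prop, is_submodule P -> is_submodule Q ->
    (forall v, exists x y, [/\ P x, Q y & v = x + y]) ->
    (forall v, P v -> Q v -> v = 0) ->
    (forall v, P v -> v = 0) \/ (forall v, Q v -> v = 0).

Definition module_iso (V W : lmodType B) : Prop :=
  exists f : {linear V -> W}, bijective f.
End Modules.

Section Bimodules.
Variables (C : comPzRingType) (B A : algebra C).

(* B-A-bimodules; [bim_actC] says that the two actions of C agree. *)
Record bimodule := Bimodule {
  bim_left :> lmodType B;
  bim_act : bim_left -> A -> bim_left;
  bim_act1 : forall f, bim_act f 1 = f;
  bim_actM : forall f a a', bim_act f (a * a') = bim_act (bim_act f a) a';
  bim_actDr : forall f a a', bim_act f (a + a') = bim_act f a + bim_act f a';
  bim_actDl : forall f f' a, bim_act (f + f') a = bim_act f a + bim_act f' a;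
  bim_actZ : forall (b : B) f a, bim_act (b *: f) a = b *: bim_act f a;
  bim_actC : forall c f, bim_act f (alg_in A c) = alg_in B c *: f
}.

Definition bim_finitely_generated (F : bimodule) : Prop :=
  exists (n : nat) (g : 'I_n -> F), forall f : F,
    exists s : seq (B * 'I_n * A),
      f = \sum_(t <- s) bim_act (t.1.1 *: g t.1.2) t.2.

Definition bim_right_free (F : bimodule) : Prop :=
  exists (I : choiceType) (e : I -> F), forall f : F,
    exists! c : {malg A[I]}, f = \sum_(i <- msupp c) bim_act (e i) c@_i.

Definition balanced (F : bimodule) (M : lmodType A) (Z : zmodType)
    (u : F -> M -> Z) : Prop :=
  [/\ forall f f' m, u (f + f') m = u f m + u f' m,
      forall f m m', u f (m + m') = u f m + u f m'
    & forall f (a : A) m, u (bim_act f a) m = u f (a *: m)].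

(* T, with the pure tensors t f m, is the left B-module F \otimes_A M. *)
Definition is_tensor (F : bimodule) (M : lmodType A) (T : lmodType B)
    (t : F -> M -> T) : Prop :=
  [/\ balanced t,
      forall (b : B) f m, t (b *: f) m = b *: t f m
    & forall (Z : zmodType) (u : F -> M -> Z), balanced u ->
        (exists g : {additive T -> Z}, forall f m, g (t f m) = u f m) /\
        (forall g g' : {additive T -> Z},
            (forall f m, g (t f m) = g' (t f m)) -> g =1 g')].
End Bimodules.

(* F \otimes_{C<X,Y>} - is described through [is_tensor], hence for every model T
   of the tensor product; it is defined up to isomorphism. *)
Section Wild.
Variables (C : fieldType) (B : algebra C).

Definition free_algebra_XY : algebra C := free_algebra C bool.

Definition wild : Prop :=
  exists F : bimodule B free_algebra_XY,
  [/\ bim_finitely_generated F,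
      bim_right_free F,
      forall (M : lmodType free_algebra_XY) (T : lmodType B) (t : F -> M -> T),
        finite_dim M -> is_tensor t -> finite_dim T,
      forall (M : lmodType free_algebra_XY) (T : lmodType B) (t : F -> M -> T),
        finite_dim M -> is_tensor t -> indecomposable M -> indecomposable T
    & forall (M M' : lmodType free_algebra_XY) (T T' : lmodType B)
             (t : F -> M -> T) (t' : F -> M' -> T'),
        finite_dim M -> finite_dim M' -> is_tensor t -> is_tensor t' ->
        module_iso T T' -> module_iso M M'].
End Wild.

Section LieAlgebras.
Variables (C : fieldType) (g : vectType C) (br : g -> g -> g).

Definition lie_bracket : Prop :=
  [/\ forall k x y z, br (k *: x + y) z = k *: br x z + br y z,
      forall k x y z, br x (k *: y + z) = k *: br x y + br x z,
      forall x, br x x = 0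
    & forall x y z, br x (br y z) + br y (br z x) + br z (br x y) = 0].

Definition simple_lie : Prop :=
  (exists x y, br x y != 0) /\
  forall I : {vspace g}, (forall x y, y \in I -> br x y \in I) ->
    I = 0%VS \/ I = fullv.

Definition cartan_subalgebra (h : {vspace g}) : Prop :=
  [/\ forall x y, x \in h -> y \in h -> br x y \in h,
      exists n : nat, forall (s : n.-tuple g) y, all (mem h) s -> y \in h ->
        foldr br y s = 0
    & forall x, (forall y, y \in h -> br x y \in h) -> x \in h].

Section Roots.
Variable h : {vspace g}.
Local Notation hdual := ('Hom(subvs_of h, C^o)).

Definition in_root_space (a : hdual) (x : g) : Prop :=
  forall t : subvs_of h, br (vsval t) x = a t *: x.

Definition is_root (a : hdual) : Prop :=
  a != 0 /\ exists2 x, x != 0 & in_root_space a x.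

(* alpha is a base (set of simple roots) of the root system of (g, h);
   the rank is the number r of simple roots. *)
Definition is_base (r : nat) (alpha : 'I_r -> hdual) : Prop :=
  [/\ forall i, is_root (alpha i),
      free [seq alpha i | i <- enum 'I_r]
    & forall b, is_root b -> exists n : 'I_r -> nat,
        b = \sum_i alpha i *+ n i \/ b = - \sum_i alpha i *+ n i].

(* A i j = <alpha_j, alpha_i^vee> = alpha_j (h_i), where the coroot h_i is the
   element of [g_{alpha_i}, g_{-alpha_i}] with alpha_i (h_i) = 2. *)
Definition is_cartan_matrix (r : nat) (alpha : 'I_r -> hdual)
    (A : 'M[int]_r) : Prop :=
  forall i, exists (x y : g) (hi : subvs_of h),
    [/\ in_root_space (alpha i) x, in_root_space (- alpha i) y,
        vsval hi = br x y, alpha i hi = 2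
      & forall j, alpha j hi = (A i j)%:~R].
End Roots.
End LieAlgebras.

(* d i = (alpha_i, alpha_i) / 2, normalized so that short roots have d i = 1. *)
Definition is_symmetrizer (r : nat) (A : 'M[int]_r) (d : 'I_r -> nat) : Prop :=
  [/\ forall i, (0 < d i)%N,
      forall i j, (d i)%:Z * A i j = (d j)%:Z * A j i
    & \big[gcdn/0]_i d i = 1%N].

Definition type_G2 (r : nat) (A : 'M[int]_r) : Prop :=
  r = 2%N /\ exists i j, A i j = -1 /\ A j i = - 3%:Z.

Section QuantumNumbers.
Variables (L : fieldType) (w : L).
Definition qint (n : nat) : L := (w ^+ n - w ^- n) / (w - w^-1).
Definition qfact (n : nat) : L := \prod_(1 <= k < n.+1) qint k.
Definition qbinom (n k : nat) : L := qfact n / (qfact k * qfact (n - k)).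
End QuantumNumbers.

Inductive qgen (r : nat) :=
  | gE of 'I_r | gF of 'I_r | gK of 'I_r | gKinv of 'I_r.

Section QGenChoice.
Variable r : nat.
Definition qgen_code (x : qgen r) : 'I_4 * 'I_r :=
  match x with
  | gE i => (inord 0, i) | gF i => (inord 1, i)
  | gK i => (inord 2, i) | gKinv i => (inord 3, i)
  end.
Definition qgen_decode (c : 'I_4 * 'I_r) : qgen r :=
  match val c.1 with
  | 0 => gE c.2 | 1 => gF c.2 | 2 => gK c.2 | _ => gKinv c.2
  end.
Fact qgen_codeK : cancel qgen_code qgen_decode.
Proof. by case=> i; rewrite /qgen_decode /= inordK. Qed.
HB.instance Definition _ := Countable.copy (qgen r) (can_type qgen_codeK).
End QGenChoice.

Notation Qv := {fraction {poly rat}}.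
Definition vQ : Qv := tofrac 'X.

Section QuantumGroup.
Variables (r : nat) (A : 'M[int]_r) (d : 'I_r -> nat).

Local Notation Fr := (free_algebra Qv (qgen r)).
Local Notation E i := (free_gen Qv (gE i)).
Local Notation F i := (free_gen Qv (gF i)).
Local Notation K i := (free_gen Qv (gK i)).
Local Notation Ki i := (free_gen Qv (gKinv i)).
Local Notation sc := (alg_in Fr).

Definition v_ (i : 'I_r) : Qv := vQ ^+ d i.

(* The quantum Serre expression
   \sum_s (-1)^s [n choose s]_{v_i} x^(n-s) y x^s with n = 1 - A i j. *)
Definition serre (i j : 'I_r) (x y : Fr) : Fr :=
  let n := `|1 - A i j|%N in
  \sum_(s < n.+1) sc ((-1) ^+ s * qbinom (v_ i) n s) *
                  (x ^+ (n - s) * y * x ^+ s).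

Inductive qrel : Fr -> Prop :=
| rel_KKi i : qrel (K i * Ki i - 1)
| rel_KiK i : qrel (Ki i * K i - 1)
| rel_KK i j : qrel (K i * K j - K j * K i)
| rel_KE i j :
    qrel (K i * E j * Ki i - sc (vQ ^ ((d i)%:Z * A i j)) * E j)
| rel_KF i j :
    qrel (K i * F j * Ki i - sc (vQ ^ (- ((d i)%:Z * A i j))) * F j)
| rel_EF i j :
    qrel (E i * F j - F j * E i -
          (if i == j then sc (v_ i - (v_ i)^-1)^-1 * (K i - Ki i) else 0))
| rel_serreE i j : i != j -> qrel (serre i j (E i) (E j))
| rel_serreF i j : i != j -> qrel (serre i j (F i) (F j)).

Definition quantum_group : algebra Qv := quotient_algebra qrel.

Local Notation U := quantum_group.
Definition Uv (x : qgen r) : U := quotient_proj qrel (free_gen Qv x).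
Local Notation scU := (alg_in U).

(* The value at x of the Laurent polynomial p / X^n over the integers. *)
Definition laurent_at (L : fieldType) (x : L) (p : {poly int}) (n : nat) : L :=
  (map_poly intr p).[x] / x ^+ n.

(* The Z[v,v^-1]-subalgebra of U generated by the divided powers
   E_i^(n), F_i^(n) and by the K_i^{+-1}. *)
Inductive in_integral_form : U -> Prop :=
| int_form_E i n :
    in_integral_form (scU (qfact (v_ i) n)^-1 * Uv (gE i) ^+ n)
| int_form_F i n :
    in_integral_form (scU (qfact (v_ i) n)^-1 * Uv (gF i) ^+ n)
| int_form_K i : in_integral_form (Uv (gK i))
| int_form_Kinv i : in_integral_form (Uv (gKinv i))
| int_form_scalar p n : in_integral_form (scU (laurent_at vQ p n))
| int_form_add x y :
    in_integral_form x -> in_integral_form y -> in_integral_form (x + y)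
| int_form_mul x y :
    in_integral_form x -> in_integral_form y -> in_integral_form (x * y).

Definition integral_form : Type := {x : U | `[< in_integral_form x >]}.
HB.instance Definition _ := Choice.on integral_form.

Section Specialization.
Variables (C : fieldType) (q : C) (l : nat).

(* C \otimes_{Z[v,v^-1]} (integral form), where v acts on C as q: the C-algebra
   on symbols 1 \otimes x subject to the following relations. *)
Local Notation FU := (free_algebra C integral_form).
Local Notation tens x := (free_gen C x).

Inductive spec_rel : FU -> Prop :=
| spec_add (x y z : integral_form) :
    val z = val x + val y -> spec_rel (tens z - (tens x + tens y))
| spec_mul (x y z : integral_form) :
    val z = val x * val y -> spec_rel (tens z - tens x * tens y)
| spec_scalar (z : integral_form) p n :
    val z = scU (laurent_at vQ p n) ->
    spec_rel (tens z - alg_in FU (laurent_at q p n)).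

Definition specialization : algebra C := quotient_algebra spec_rel.

(* spec_elt x y: the element y is 1 \otimes x. *)
Definition spec_elt (x : U) (y : specialization) : Prop :=
  exists2 z : integral_form, val z = x & y = quotient_proj spec_rel (tens z).

Definition chevalley_generator (y : specialization) : Prop :=
  exists x : qgen r, spec_elt (Uv x) y.

Definition chevalley_subalgebra : algebra C := subalgebra chevalley_generator.

Definition small_rel (y : chevalley_subalgebra) : Prop :=
  exists i (k : chevalley_subalgebra),
    spec_elt (Uv (gK i)) (subalgebra_incl k) /\ y = k ^+ l - 1.

Definition small_quantum_group : algebra C := quotient_algebra small_rel.

Definition small_E (y : small_quantum_group) : Prop :=
  exists i (e : chevalley_subalgebra),
    spec_elt (Uv (gE i)) (subalgebra_incl e) /\ y = quotient_proj small_rel e.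

Definition small_half_quantum_group : algebra C := subalgebra small_E.
End Specialization.
End QuantumGroup.

(* Main.v *)
(** The generators of the small half-quantum group B act on A^4, A = C<X,Y>, with
   basis e0, .., e3, by
     E_i : e0 -> e1, e1 -> al e3, e2 -> s X e3,
     E_j : e0 -> e2, e1 -> t X e3, e2 -> be Y e3,
   and by 0 for the remaining ones, where al, be, t <> 0.  A B-linear map f from
   A^4 (x) M to A^4 (x) M' induces theta : M -> M' on the e0-components.  As E_i^2,
   E_j E_i and E_j^2 send e0 (x) m to e3 (x) m, e3 (x) X m and e3 (x) Y m up to nonzero
   scalars, f(e3 (x) m) = e3 (x) theta m, and theta commutes with X and Y.  Hence
   f |-> theta is functorial, and an idempotent f with theta = 0 is nilpotent: the
   bimodule A^4 reflects isomorphisms and preserves indecomposability.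

   That these matrices do define a representation of B means that the
   coefficients of suitable words of length at most 2 in the E's are well-defined
   linear forms on B.  They are the matrix coefficients F_w E_u of the lowest
   weight vector, of weight -2 rho, in a dual Verma module over Q(v).  Kostant's
   formula for F_i^(s) E_i^(n) shows that the divided powers preserve a
   Z[v,v^-1]-lattice, so that these coefficients can be evaluated at v = q; there
   the quantum integers [2] do not vanish because q has odd order.  The Lie algebra
   enters through a_ii = 2 and a_ij <= 0, which make the quantum Serre elements
   commute with the opposite generators. *)

Require Import Defs.
From HB Require Import structures.
From mathcomp Require Import all_boot all_order all_algebra.
From mathcomp Require Import complex reals.
From mathcomp Require Import generic_quotient ring_quotient finmap monalg.
From mathcomp Require Import boolp functions ring lra zify.

Set Implicit Arguments.
Unset Strict Implicit.
Unset Printing Implicit Defensive.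

Import Order.TTheory GRing.Theory Num.Theory VectorInternalTheory.
Local Open Scope ring_scope.

(** * Free algebras and their modules *)

(** The algebra B is reached from U through an integral form, a specialization, a subalgebra, a
    quotient by K_i^l = 1 and again a subalgebra. No layer comes with a basis, and a priori even 1 =
    0 is possible. Independence of short words is therefore certified from outside, by linear forms
    built over Q(v) and carried through every layer. For the specialization, its generators act by
    right translation on C-valued functions on the integral form; for K_i^l = 1, the element K_i^l
    is central and fixes the form, both because q^l = 1. The full dual of the free algebra on the
    F's is used because F_i is explicit there and the Serre relations of the E's come for free;
    those of the F's are enforced by restricting to a submodule. In degree 2 the words E_i^2, E_j^2
    and E_j E_i have coefficients that are products of two numbers [2]. The remaining word E_i E_j
    gets [2 - a_ij][2], which may vanish at q (in type A_2 with l = 3, for instance); this is why s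
    is allowed to be 0. *)

Section EndAlgebra.
Variables (K : fieldType) (V : lmodType K).

Definition is_linear : {pred V -> V} := fun f => `[< linear f >].

Fact is_linear_zmod_closed : zmod_closed is_linear.
Proof.
split=> [|f g /asboolP lf /asboolP lg]; apply/asboolP=> a u v.
  by change ((0 : V) = a *: (0 : V) + 0); rewrite scaler0 addr0.
by change (f (a *: u + v) - g (a *: u + v) = a *: (f u - g u) + (f v - g v));
  rewrite lf lg scalerBr opprD addrACA.
Qed.
HB.instance Definition _ := GRing.isZmodClosed.Build _ is_linear is_linear_zmod_closed.

(** The modules below are infinite dimensional function spaces, so endomorphisms are functions with
    a linearity predicate, not matrices. *)
Record end_car := EndElt { end_fun :> V -> V; _ : end_fun \in is_linear }.
HB.instance Definition _ := [isSub for end_fun].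
HB.instance Definition _ := [Choice of end_car by <:].
HB.instance Definition _ := [SubChoice_isSubZmodule of end_car by <:].

Lemma end_linear (f : end_car) : linear f.
Proof. by case: f => f lf; exact/asboolP. Qed.

Lemma endP (f g : end_car) : (forall x, f x = g x) -> f = g.
Proof. by move=> h; apply: val_inj; apply/funext. Qed.

Definition mk_end (f : V -> V) (lf : linear f) : end_car :=
  @EndElt f (asboolT lf).

Lemma end_add (f : end_car) u v : f (u + v) = f u + f v.
Proof. by have := end_linear f 1 u v; rewrite !scale1r. Qed.
Lemma end_0 (f : end_car) : f 0 = 0.
Proof. by apply: (addrI (f 0)); rewrite -end_add !addr0. Qed.
Lemma end_scale (f : end_car) a u : f (a *: u) = a *: f u.
Proof. by have := end_linear f a u 0; rewrite !addr0 end_0 addr0. Qed.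

Lemma end_sub (f : end_car) u v : f (u - v) = f u - f v.
Proof. by rewrite -scaleN1r end_add end_scale scaleN1r. Qed.

Lemma end_sum (I : Type) (r : seq I) (F : I -> V) (f : end_car) :
  f (\sum_(i <- r) F i) = \sum_(i <- r) f (F i).
Proof. by elim/big_rec2: _ => [|i y1 y2 _ <-]; rewrite ?end_0 ?end_add. Qed.

Fact end_comp_linear (f g : end_car) : linear (f \o g).
Proof. by move=> a u v /=; rewrite !end_add !end_scale. Qed.
Fact end_id_linear : linear (@idfun V).
Proof. by []. Qed.
Definition end_mul f g := mk_end (end_comp_linear f g).
Definition end_one := mk_end end_id_linear.

Fact end_mulA : associative end_mul. Proof. by move=> f g h; apply: endP. Qed.
Fact end_mul1 : left_id end_one end_mul. Proof. by move=> f; apply: endP. Qed.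
Fact end_mulr1 : right_id end_one end_mul. Proof. by move=> f; apply: endP. Qed.
Fact end_mulDl : left_distributive end_mul +%R.
Proof. by move=> f g h; apply: endP. Qed.
Fact end_mulDr : right_distributive end_mul +%R.
Proof. by move=> f g h; apply: endP => x; exact: end_add. Qed.
HB.instance Definition _ := GRing.Zmodule_isPzRing.Build end_car
  end_mulA end_mul1 end_mulr1 end_mulDl end_mulDr.

Fact end_in_linear (k : K) : linear (fun x : V => k *: x).
Proof. by move=> a u v; rewrite scalerDr !scalerA mulrC. Qed.
Definition end_in k := mk_end (end_in_linear k).
Fact end_in_zmod : zmod_morphism end_in.
Proof. by move=> k l; apply: endP => x; exact: scalerBl. Qed.
Fact end_in_monoid : monoid_morphism end_in.
Proof.
split=> [|k l]; apply: endP => x; first exact: scale1r.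
by symmetry; exact: scalerA.
Qed.
HB.instance Definition _ := GRing.isZmodMorphism.Build K end_car end_in end_in_zmod.
HB.instance Definition _ := GRing.isMonoidMorphism.Build K end_car end_in end_in_monoid.
Fact end_inC k (f : end_car) : end_in k * f = f * end_in k.
Proof. by apply: endP => x; symmetry; exact: end_scale. Qed.

Definition end_algebra : algebra K := Algebra end_inC.

Lemma end_mulE (f g : end_car) x : (f * g) x = f (g x). Proof. by []. Qed.
Lemma end_addE (f g : end_car) x : (f + g) x = f x + g x. Proof. by []. Qed.
Lemma end_oppE (f : end_car) x : (- f) x = - f x. Proof. by []. Qed.
Lemma end_0E x : (0 : end_car) x = 0. Proof. by []. Qed.
Lemma end_1E x : (1 : end_car) x = x. Proof. by []. Qed.
Lemma end_inE k x : (alg_in end_algebra k : end_car) x = k *: x.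
Proof. by []. Qed.
Lemma end_sumE (I : Type) (r : seq I) (F : I -> end_car) x :
  (\sum_(i <- r) F i) x = \sum_(i <- r) F i x.
Proof.
elim: r => [|i r IH]; first by rewrite !big_nil.
by rewrite !big_cons -IH.
Qed.
End EndAlgebra.

(** * The universal property of free algebras *)

Section FreeLift.
Variables (K : fieldType) (X : choiceType) (S : algebra K) (f : X -> S).

Definition free_lift (x : free_algebra K X) : S :=
  \sum_(m <- msupp x) alg_in S (mcoeff m x) * \prod_(t <- fmonom_val m) f t.

(** Allows two elements to be expanded over one common set of monomials. *)
Lemma free_liftEw (d : {fset {fmonom X}}) (x : free_algebra K X) :
  (msupp x `<=` d)%fset ->
  free_lift x = \sum_(m <- d) alg_in S (mcoeff m x) * \prod_(t <- fmonom_val m) f t.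
Proof.
move=> le; rewrite /free_lift (big_fset_incl _ le) //= => m _ /mcoeff_outdom ->.
by rewrite rmorph0 mul0r.
Qed.

Fact free_lift_zmod : zmod_morphism free_lift.
Proof.
move=> x y; pose d := (msupp x `|` msupp y)%fset.
rewrite !(@free_liftEw d) ?fsubsetUl ?fsubsetUr ?msuppB_le //.
by rewrite -sumrB; apply: eq_bigr => m _; rewrite mcoeffB rmorphB mulrBl.
Qed.
HB.instance Definition _ := GRing.isZmodMorphism.Build _ _ free_lift free_lift_zmod.

Lemma free_liftU c m :
  free_lift << c *g m >> = alg_in S c * \prod_(t <- fmonom_val m) f t.
Proof. by rewrite (free_liftEw msuppU_le) big_seq_fset1 mcoeffUU. Qed.

Lemma free_liftC c : free_lift (alg_in (free_algebra K X) c) = alg_in S c.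
Proof. by rewrite /= free_liftU fm1 big_nil mulr1. Qed.

Lemma free_lift_gen x : free_lift (free_gen K x) = f x.
Proof. by rewrite free_liftU fmuE big_seq1 rmorph1 mul1r. Qed.

Fact free_lift_monoid : monoid_morphism free_lift.
Proof.
split; first by rewrite -(rmorph1 (alg_in (free_algebra K X))) free_liftC rmorph1.
move=> x y; rewrite [x]monalgE [y]monalgE mulr_suml !raddf_sum /= mulr_suml.
apply: eq_bigr => m _; rewrite mulr_sumr !raddf_sum /= mulr_sumr.
apply: eq_bigr => m' _; rewrite malgM_def fgmulUU !free_liftU fmM big_cat /=.
rewrite rmorphM -!mulrA; congr (_ * _); rewrite !mulrA; congr (_ * _).
by rewrite alg_inC.
Qed.
HB.instance Definition _ := GRing.isMonoidMorphism.Build _ _ free_lift free_lift_monoid.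

Lemma free_liftD x y : free_lift (x + y) = free_lift x + free_lift y.
Proof. exact: raddfD. Qed.
Lemma free_liftB x y : free_lift (x - y) = free_lift x - free_lift y.
Proof. exact: raddfB. Qed.
Lemma free_liftM x y : free_lift (x * y) = free_lift x * free_lift y.
Proof. exact: rmorphM. Qed.
Lemma free_liftX x n : free_lift (x ^+ n) = free_lift x ^+ n.
Proof. exact: rmorphXn. Qed.
Lemma free_lift1 : free_lift 1 = 1.
Proof. exact: rmorph1. Qed.
Lemma free_lift_sum (I : Type) (r : seq I) (F : I -> free_algebra K X) :
  free_lift (\sum_(i <- r) F i) = \sum_(i <- r) free_lift (F i).
Proof. exact: raddf_sum. Qed.

Local Notation gen := (free_gen K).
Local Notation sub2 := (fun x y : S => x - y).

(* Rewriting with [free_lift_gen] would compare distinct generators up to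
   conversion inside the monoid algebra, hence the explicit congruences. *)
Lemma free_lift_gen2 a b : free_lift (gen a * gen b) = f a * f b.
Proof. exact: (etrans (free_liftM _ _) (congr2 *%R (free_lift_gen a) (free_lift_gen b))). Qed.
Lemma free_lift_gen3 a b c : free_lift (gen a * gen b * gen c) = f a * f b * f c.
Proof. exact: (etrans (free_liftM _ _) (congr2 *%R (free_lift_gen2 a b) (free_lift_gen c))). Qed.
Lemma free_lift_scaled a k :
  free_lift (alg_in (free_algebra K X) k * gen a) = alg_in S k * f a.
Proof. exact: (etrans (free_liftM _ _) (congr2 *%R (free_liftC k) (free_lift_gen a))). Qed.

Lemma free_lift_inverse_rel a b : free_lift (gen a * gen b - 1) = f a * f b - 1.
Proof. exact: (etrans (free_liftB _ _) (congr2 sub2 (free_lift_gen2 a b) free_lift1)). Qed.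
Lemma free_lift_commutator a b :
  free_lift (gen a * gen b - gen b * gen a) = f a * f b - f b * f a.
Proof.
exact: (etrans (free_liftB _ _) (congr2 sub2 (free_lift_gen2 a b) (free_lift_gen2 b a))).
Qed.
Lemma free_lift_commutator_rel a b z : free_lift (gen a * gen b - gen b * gen a - z) =
  f a * f b - f b * f a - free_lift z.
Proof. exact: (etrans (free_liftB _ _) (congr2 sub2 (free_lift_commutator a b) erefl)). Qed.
Lemma free_lift_conj_rel a b c k :
  free_lift (gen a * gen b * gen c - alg_in (free_algebra K X) k * gen b) =
  f a * f b * f c - alg_in S k * f b.
Proof.
exact: (etrans (free_liftB _ _) (congr2 sub2 (free_lift_gen3 a b c) (free_lift_scaled b k))).
Qed.
Lemma free_lift_sum_rel a b c : free_lift (gen a - (gen b + gen c)) = f a - (f b + f c).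
Proof.
exact: (etrans (free_liftB _ _) (congr2 sub2 (free_lift_gen a)
  (etrans (free_liftD _ _) (congr2 +%R (free_lift_gen b) (free_lift_gen c))))).
Qed.
Lemma free_lift_prod_rel a b c : free_lift (gen a - gen b * gen c) = f a - f b * f c.
Proof.
exact: (etrans (free_liftB _ _) (congr2 sub2 (free_lift_gen a) (free_lift_gen2 b c))).
Qed.
Lemma free_lift_const_rel a k :
  free_lift (gen a - alg_in (free_algebra K X) k) = f a - alg_in S k.
Proof. exact: (etrans (free_liftB _ _) (congr2 sub2 (free_lift_gen a) (free_liftC k))). Qed.
Lemma free_lift_scaled_diff a b k :
  free_lift (alg_in (free_algebra K X) k * (gen a - gen b)) = alg_in S k * (f a - f b).
Proof.
exact: (etrans (free_liftM _ _) (congr2 *%R (free_liftC k)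
  (etrans (free_liftB _ _) (congr2 sub2 (free_lift_gen a) (free_lift_gen b))))).
Qed.

End FreeLift.

Lemma free_algebra_ind (K : fieldType) (X : choiceType) (P : free_algebra K X -> Prop) :
  (forall c, P (alg_in _ c)) -> (forall x y, P x -> P y -> P (x + y)) ->
  (forall t x, P x -> P (free_gen K t * x)) ->
  (forall c x, P x -> P (alg_in _ c * x)) ->
  forall x, P x.
Proof.
move=> PC PD Pg PZ x; rewrite [x]monalgE.
elim/big_ind: _ => // [|m _]; first by rewrite -(rmorph0 (alg_in (free_algebra K X))).
have -> : << x@_m *g m >> = alg_in (free_algebra K X) x@_m * << 1 *g m >>.
  by rewrite /= malgM_def fgmulUU mulr1 mul1m.
apply: PZ; case: m => s; elim: s => [|t s IH].
  suff -> : FMonom [::] = (mone : {fmonom X}) by exact: (PC 1).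
  by apply: val_inj; rewrite /= fm1.
suff -> : << 1 *g FMonom (t :: s) >> = free_gen K t * << 1 *g FMonom s >> by exact: Pg.
rewrite malgM_def fgmulUU mulr1; congr (<< _ *g _ >>).
by apply: val_inj; rewrite /= fmM fmuE.
Qed.

(** * Matrix bimodules and wildness *)

Section MatrixBimodule.
Variables (C : fieldType) (B A : algebra C) (n : nat).
Variable rho : {rmorphism B -> 'M[A]_n}.
Hypothesis rhoC : forall c, rho (alg_in B c) = (alg_in A c)%:M.

(** The dummy argument keeps [rho] in the type: different representations put different B-module
    structures on the same columns. *)
Definition mx_bim_car (_ : {rmorphism B -> 'M[A]_n}) : Type := 'cV[A]_n.
HB.instance Definition _ := GRing.Zmodule.on (mx_bim_car rho).

Definition mx_bim_scale (b : B) (f : mx_bim_car rho) : mx_bim_car rho :=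
  rho b *m (f : 'cV[A]_n).
Fact mx_bim_scaleA a b f :
  mx_bim_scale a (mx_bim_scale b f) = mx_bim_scale (a * b) f.
Proof. by rewrite /mx_bim_scale rmorphM mulmxA. Qed.
Fact mx_bim_scale1 : left_id 1 mx_bim_scale.
Proof. by move=> f; rewrite /mx_bim_scale rmorph1 mul1mx. Qed.
Fact mx_bim_scaleDr : right_distributive mx_bim_scale +%R.
Proof. by move=> b f g; exact: mulmxDr. Qed.
Fact mx_bim_scaleDl f : {morph mx_bim_scale^~ f : a b / a + b}.
Proof. by move=> a b; rewrite /mx_bim_scale rmorphD mulmxDl. Qed.
HB.instance Definition _ := GRing.Zmodule_isLmodule.Build B (mx_bim_car rho)
  mx_bim_scaleA mx_bim_scale1 mx_bim_scaleDr mx_bim_scaleDl.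

(** Multiplication on the right by the 1 x 1 matrix [a]. Although A is not commutative, it commutes
    with the matrix action of B by associativity. *)
Definition mx_bim_act (f : mx_bim_car rho) (a : A) : mx_bim_car rho :=
  (f : 'cV[A]_n) *m a%:M.

Fact mx_bim_act1 f : mx_bim_act f 1 = f.
Proof. exact: mulmx1. Qed.
Fact mx_bim_actM f a a' : mx_bim_act f (a * a') = mx_bim_act (mx_bim_act f a) a'.
Proof. by rewrite /mx_bim_act -mulmxA -scalar_mxM. Qed.
Fact mx_bim_actDr f a a' : mx_bim_act f (a + a') = mx_bim_act f a + mx_bim_act f a'.
Proof. by rewrite /mx_bim_act raddfD mulmxDr. Qed.
Fact mx_bim_actDl f f' a : mx_bim_act (f + f') a = mx_bim_act f a + mx_bim_act f' a.
Proof. exact: mulmxDl. Qed.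
Fact mx_bim_actZ (b : B) f a : mx_bim_act (b *: f) a = b *: mx_bim_act f a.
Proof. by symmetry; exact: mulmxA. Qed.
Fact mx_bim_actC c f : mx_bim_act f (alg_in A c) = alg_in B c *: f.
Proof.
rewrite /mx_bim_act /GRing.scale /= /mx_bim_scale rhoC.
apply/matrixP=> i j; rewrite ord1 !mxE big_ord1 (bigD1 i) //= big1 ?addr0.
  by rewrite !mxE !eqxx alg_inC.
by move=> k /negPf ki; rewrite mxE eq_sym ki mul0r.
Qed.

Definition mx_bimodule : bimodule B A :=
  Bimodule mx_bim_act1 mx_bim_actM mx_bim_actDr mx_bim_actDl mx_bim_actZ mx_bim_actC.

Definition mx_bim_gen (i : 'I_n) : mx_bimodule := delta_mx i 0 : 'cV[A]_n.
Definition mx_bim_coef (f : mx_bimodule) (i : 'I_n) : A := (f : 'cV[A]_n) i 0.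

Lemma mx_bim_coefD f g i : mx_bim_coef (f + g) i = mx_bim_coef f i + mx_bim_coef g i.
Proof. exact: mxE. Qed.
Lemma mx_bim_coef_act f a i : mx_bim_coef (bim_act f a) i = mx_bim_coef f i * a.
Proof. by rewrite /mx_bim_coef /= /mx_bim_act mxE big_ord1 !mxE eqxx. Qed.
Lemma mx_bim_coef_gen k i : mx_bim_coef (mx_bim_gen k) i = (i == k)%:R.
Proof. by rewrite /mx_bim_coef mxE eqxx andbT. Qed.
Lemma mx_bim_coefZ b f i :
  mx_bim_coef (b *: f) i = \sum_k rho b i k * mx_bim_coef f k.
Proof. exact: mxE. Qed.
Lemma mx_bim_coef_sum (I : Type) (r : seq I) (F : I -> mx_bimodule) i :
  mx_bim_coef (\sum_(j <- r) F j) i = \sum_(j <- r) mx_bim_coef (F j) i.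
Proof.
elim: r => [|j r IH]; first by rewrite !big_nil; exact: mxE.
by rewrite !big_cons mx_bim_coefD IH.
Qed.
Lemma mx_bimP (f g : mx_bimodule) :
  (forall i, mx_bim_coef f i = mx_bim_coef g i) -> f = g.
Proof. by move=> h; apply/matrixP => i j; rewrite ord1; exact: h. Qed.

Lemma sum_delta (F : 'I_n -> A) i : \sum_k (i == k)%:R * F k = F i.
Proof.
rewrite (bigD1 i) //= eqxx mul1r big1 ?addr0 // => k /negPf ki.
by rewrite eq_sym ki mul0r.
Qed.

Lemma mx_bim_decomp (f : mx_bimodule) :
  f = \sum_i bim_act (mx_bim_gen i) (mx_bim_coef f i).
Proof.
apply: mx_bimP => i; rewrite mx_bim_coef_sum.
by under eq_bigr do rewrite mx_bim_coef_act mx_bim_coef_gen; rewrite sum_delta.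
Qed.

Lemma mx_bim_finitely_generated : bim_finitely_generated mx_bimodule.
Proof.
exists n, mx_bim_gen => f; exists [seq (1, i, mx_bim_coef f i) | i <- enum 'I_n].
rewrite {1}[f]mx_bim_decomp big_map big_enum /=.
by apply: eq_bigr => i _; rewrite scale1r.
Qed.

Lemma mx_bim_right_free : bim_right_free mx_bimodule.
Proof.
have key (c : {malg A['I_n]}) :
    \sum_(i <- msupp c) bim_act (mx_bim_gen i) (mcoeff i c) =
    \sum_i bim_act (mx_bim_gen i) (mcoeff i c).
  rewrite [LHS]big_uniq ?fset_uniq //= [RHS](bigID [in msupp c]) /=.
  rewrite [X in _ + X]big1 ?addr0 // => i /mcoeff_outdom ->.
  by apply: mx_bimP => k; rewrite mx_bim_coef_act mulr0 [RHS]mxE.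
have coefE (c : {malg A['I_n]}) i :
    mx_bim_coef (\sum_(i <- msupp c) bim_act (mx_bim_gen i) (mcoeff i c)) i = mcoeff i c.
  rewrite key mx_bim_coef_sum.
  under eq_bigr do rewrite mx_bim_coef_act mx_bim_coef_gen.
  exact: (sum_delta (fun k => mcoeff k c)).
exists 'I_n, mx_bim_gen => f.
have mkE (f' : mx_bimodule) i : mcoeff i (\sum_k << mx_bim_coef f' k *g k >>) = mx_bim_coef f' i.
  rewrite raddf_sum /= (bigD1 i) //= mcoeffUU big1 ?addr0 // => k /negPf ki.
  by rewrite mcoeffU ki.
exists (\sum_k << mx_bim_coef f k *g k >>); split.
  by apply: mx_bimP => i; rewrite coefE mkE.
by move=> c ->; apply/malgP => i; rewrite mkE coefE.
Qed.

(** * Coordinates on the tensor product with a matrix bimodule *)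

Section Tensor.
Variables (M : lmodType A) (T : lmodType B) (t : mx_bimodule -> M -> T).
Hypothesis tT : is_tensor t.

Definition tensor_in (k : 'I_n) (m : M) : T := t (mx_bim_gen k) m.
Local Notation j := tensor_in.

(** The uniqueness half of the universal property is stated relative to a balanced map; the
    restriction of [u] to pure tensors serves as that map. *)
Lemma tensor_ext (Z : zmodType) (u v : T -> Z) :
  zmod_morphism u -> zmod_morphism v ->
  (forall f m, u (t f m) = v (t f m)) -> u =1 v.
Proof.
move=> zu zv uv; case: tT => -[tDl tDr tb] _ tU.
pose u' : {additive T -> Z} := HB.pack_for {additive T -> Z} u
  (GRing.isZmodMorphism.Build T Z u zu).
pose v' : {additive T -> Z} := HB.pack_for {additive T -> Z} v
  (GRing.isZmodMorphism.Build T Z v zv).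
have bal : balanced (fun f m => u (t f m)).
  have uD x y : u (x + y) = u x + u y by exact: (raddfD u').
  by split=> [f f' m|f m m'|f a m]; rewrite ?tDl ?tDr ?tb ?uD.
by case: (tU Z _ bal) => _ /(_ u' v'); apply.
Qed.

Lemma tensor_out_subproof k :
  exists g : {additive T -> M}, forall f m, g (t f m) = mx_bim_coef f k *: m.
Proof.
case: tT => _ _ tU; apply: (tU _ (fun f m => mx_bim_coef f k *: m) _).1.
split=> [f f' m|f m m'|f a m].
- by rewrite mx_bim_coefD scalerDl.
- by rewrite scalerDr.
- by rewrite mx_bim_coef_act scalerA.
Qed.

(** The coordinates of the isomorphism between T and M^n. As T is known only by its universal
    property, they are induced from balanced maps. *)
Definition tensor_out (k : 'I_n) : {additive T -> M} :=
  projT1 (cid (tensor_out_subproof k)).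
Local Notation g := tensor_out.

Lemma tensor_outE k f m : g k (t f m) = mx_bim_coef f k *: m.
Proof. by rewrite /tensor_out; case: cid. Qed.

Fact tensor_in_zmod k : zmod_morphism (j k).
Proof.
case: tT => -[_ tDr _] _ _ x y; apply: (addIr (j k y)).
by rewrite -tDr !subrK.
Qed.
HB.instance Definition _ k := GRing.isZmodMorphism.Build M T (j k) (tensor_in_zmod k).

Lemma tensor_outK k l m : g k (j l m) = (k == l)%:R *: m.
Proof. by rewrite tensor_outE mx_bim_coef_gen. Qed.

Fact tensor_left0 m : t 0 m = 0.
Proof.
case: tT => -[tDl _ _] _ _.
by apply: (addrI (t 0 m)); rewrite -tDl !addr0.
Qed.

Fact tensor_left_sum (I : Type) (r : seq I) (F : I -> mx_bimodule) m :
  t (\sum_(i <- r) F i) m = \sum_(i <- r) t (F i) m.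
Proof.
case: tT => -[tDl _ _] _ _.
elim: r => [|i r IH]; first by rewrite !big_nil tensor_left0.
by rewrite !big_cons tDl IH.
Qed.

Lemma tensor_pure f m : t f m = \sum_k j k (mx_bim_coef f k *: m).
Proof.
case: tT => -[_ _ tb] _ _.
by rewrite {1}[f]mx_bim_decomp tensor_left_sum; apply: eq_bigr => k _; rewrite tb.
Qed.

Lemma tensor_decomp x : x = \sum_k j k (g k x).
Proof.
apply: (tensor_ext (u := id) (v := fun x => \sum_k j k (g k x))) => //.
  by move=> y z; rewrite -sumrB; apply: eq_bigr => k _; rewrite !raddfB.
move=> f m; rewrite tensor_pure; apply: eq_bigr => k _.
by rewrite -tensor_pure tensor_outE.
Qed.

Lemma tensor_outZ k (b : B) x : g k (b *: x) = \sum_l rho b k l *: g l x.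
Proof.
case: tT => _ tZ _; move: x.
apply: (tensor_ext (u := fun x => g k (b *: x)) (v := fun x => \sum_l rho b k l *: g l x)).
- by move=> y z; rewrite scalerBr raddfB.
- by move=> y z; rewrite -sumrB; apply: eq_bigr => l _; rewrite raddfB scalerBr.
- move=> f m; rewrite -tZ tensor_outE mx_bim_coefZ scaler_suml.
  by apply: eq_bigr => l _; rewrite tensor_outE scalerA.
Qed.

Lemma tensor_outP x y : (forall k, g k x = g k y) -> x = y.
Proof.
by move=> h; rewrite [x]tensor_decomp [y]tensor_decomp; apply: eq_bigr => k _; rewrite h.
Qed.

Lemma tensor_inC k c m : j k (alg_in A c *: m) = alg_in B c *: j k m.
Proof.
apply: tensor_outP => l; rewrite tensor_outK tensor_outZ (bigD1 l) //= big1 ?addr0.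
  rewrite rhoC mxE eqxx tensor_outK !scalerA.
  by case: eqP => _; rewrite ?mulr1 ?mul1r ?mulr0 ?mul0r.
by move=> i /negPf il; rewrite rhoC mxE eq_sym il scale0r.
Qed.

Lemma tensor_finite_dim : finite_dim M -> finite_dim T.
Proof.
case=> p [e he].
pose e' (i : 'I_#|{: 'I_n * 'I_p}|) := j (enum_val i).1 (e (enum_val i).2).
exists #|{: 'I_n * 'I_p}|, e' => x.
have /choice [c hc] k := he (g k x).
exists (fun i => c (enum_val i).1 (enum_val i).2).
rewrite {1}[x]tensor_decomp.
under eq_bigr do rewrite hc raddf_sum /=.
rewrite pair_big /= (reindex (fun i : 'I_#|{: 'I_n * 'I_p}| => enum_val i)) /=.
  by apply: eq_bigr => i _; rewrite tensor_inC.
by exists enum_rank => y _; rewrite ?enum_rankK ?enum_valK.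
Qed.

Lemma tensor_in0 k : j k 0 = 0.
Proof. exact: raddf0. Qed.
Lemma tensor_inD k m m' : j k (m + m') = j k m + j k m'.
Proof. exact: raddfD. Qed.

End Tensor.
End MatrixBimodule.
Arguments tensor_outP {C B A n rho rhoC M T t} tT x y.

Local Notation o0 := (@Ordinal 4 0 isT).
Local Notation o1 := (@Ordinal 4 1 isT).
Local Notation o2 := (@Ordinal 4 2 isT).
Local Notation o3 := (@Ordinal 4 3 isT).

Lemma big_ord4 (V : nmodType) (E : 'I_4 -> V) :
  \sum_k E k = E o0 + (E o1 + (E o2 + E o3)).
Proof.
rewrite !big_ord_recl big_ord0 addr0.
by do ?[congr (_ + _)]; congr (E _); apply: val_inj.
Qed.

(** * A family of 4 x 4 matrices closed under multiplication *)

Section FourByFour.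
Variable A : pzRingType.

(** The columns are indexed by the source: [x], [y] lead from e0 to e1, e2, then [p], [q] from e1,
    e2 to e3, and [z] from e0 to e3; the diagonal is constant. *)
Definition mx4 (a x y p q z : A) : 'M[A]_4 :=
  \matrix_(i, j) match val i, val j with
    | 0, 0 | 1, 1 | 2, 2 | 3, 3 => a
    | 1, 0 => x | 2, 0 => y | 3, 1 => p | 3, 2 => q | 3, 0 => z
    | _, _ => 0
    end.

Lemma mx4M a x y p q z a' x' y' p' q' z' :
  mx4 a x y p q z *m mx4 a' x' y' p' q' z' =
  mx4 (a * a') (x * a' + a * x') (y * a' + a * y') (p * a' + a * p')
      (q * a' + a * q') (z * a' + p * x' + q * y' + a * z').
Proof.
apply/matrixP => -[[|[|[|[|//]]]] hi] [[|[|[|[|//]]]] hj];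
by rewrite !mxE !big_ord_recl big_ord0 !mxE /= ?(mulr0, mul0r, add0r, addr0, addrA).
Qed.

Lemma mx4M_left x y p q p' q' :
  mx4 0 x y p q 0 * mx4 0 1 0 p' q' 0 = mx4 0 0 0 0 0 p.
Proof. by rewrite [LHS]mx4M !(mulr0, mul0r, add0r, addr0, mulr1). Qed.

Lemma mx4M_right x y p q p' q' :
  mx4 0 x y p q 0 * mx4 0 0 1 p' q' 0 = mx4 0 0 0 0 0 q.
Proof. by rewrite [LHS]mx4M !(mulr0, mul0r, add0r, addr0, mulr1). Qed.

Lemma mx4D a x y p q z a' x' y' p' q' z' :
  mx4 a x y p q z + mx4 a' x' y' p' q' z' =
  mx4 (a + a') (x + x') (y + y') (p + p') (q + q') (z + z').
Proof.
apply/matrixP => -[[|[|[|[|//]]]] hi] [[|[|[|[|//]]]] hj];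
by rewrite !mxE /= ?addr0.
Qed.

Lemma mx4_scalar a : a%:M = mx4 a 0 0 0 0 0.
Proof.
apply/matrixP => -[[|[|[|[|//]]]] hi] [[|[|[|[|//]]]] hj];
by rewrite !mxE /=.
Qed.
End FourByFour.

(** * Homomorphisms are controlled by their top component *)

Section WildCriterion.
Variables (C : fieldType) (B A : algebra C) (X Y : A).
Hypothesis A_generated : forall (M M' : lmodType A) (f : M -> M'),
  (forall u v, f (u + v) = f u + f v) ->
  (forall c u, f (alg_in A c *: u) = alg_in A c *: f u) ->
  (forall u, f (X *: u) = X *: f u) -> (forall u, f (Y *: u) = Y *: f u) ->
  forall a u, f (a *: u) = a *: f u.
Local Notation sc := (alg_in A).
Variable rho : {rmorphism B -> 'M[A]_4}.
Hypothesis rhoC : forall c, rho (alg_in B c) = (alg_in A c)%:M.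
Variables (b1 b2 : B) (al be s t : C).
Hypotheses (al0 : al != 0) (be0 : be != 0) (t0 : t != 0).
Hypothesis rho1 : rho b1 = mx4 0 1 0 (sc al) (sc s * X) 0.
Hypothesis rho2 : rho b2 = mx4 0 0 1 (sc t * X) (sc be * Y) 0.

Local Notation F := (mx_bimodule rhoC).

Section OneModule.
Variables (M : lmodType A) (T : lmodType B) (tt : F -> M -> T).
Hypothesis tT : is_tensor tt.
Local Notation j := (tensor_in tt).
Local Notation g := (tensor_out tT).

Lemma act_socle b z x : rho b = mx4 0 0 0 0 0 z -> b *: x = j o3 (z *: g o0 x).
Proof.
move=> hb; apply: (tensor_outP tT) => k; rewrite tensor_outZ tensor_outK hb.
rewrite big_ord4 !mxE /=.
case: k => [[|[|[|[|//]]]] hk] /=;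
by rewrite ?scale0r ?scale1r ?addr0 ?add0r // scale0r.
Qed.

Lemma act11 x : b1 *: (b1 *: x) = j o3 (sc al *: g o0 x).
Proof.
rewrite scalerA; apply: act_socle; rewrite rmorphM rho1.
exact: mx4M_left.
Qed.
Lemma act21 x : b2 *: (b1 *: x) = j o3 ((sc t * X) *: g o0 x).
Proof.
rewrite scalerA; apply: act_socle; rewrite rmorphM rho1 rho2.
exact: mx4M_left.
Qed.
Lemma act22 x : b2 *: (b2 *: x) = j o3 ((sc be * Y) *: g o0 x).
Proof.
rewrite scalerA; apply: act_socle; rewrite rmorphM rho2.
exact: mx4M_right.
Qed.

(** A vector without e0-component lies in the span of e1, e2, e3, and such matrices push this span
    into the socle e3. *)
Lemma act_rad b p q x : (exists u v, rho b = mx4 0 u v p q 0) -> g o0 x = 0 ->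
  exists m, b *: x = j o3 m.
Proof.
move=> [u [v hb]] x0; exists (p *: g o1 x + q *: g o2 x).
apply: (tensor_outP tT) => k; rewrite tensor_outZ tensor_outK hb.
rewrite big_ord4 !mxE x0 /=.
case: k => [[|[|[|[|//]]]] hk] /=;
by rewrite ?scaler0 ?scale0r ?scale1r ?addr0 ?add0r // scale0r.
Qed.

Lemma act1_top m : b1 *: j o0 m = j o1 m.
Proof.
apply: (tensor_outP tT) => k; rewrite tensor_outZ tensor_outK rho1.
rewrite big_ord4 !tensor_outK !mxE /=.
case: k => [[|[|[|[|//]]]] hk] /=;
by rewrite ?(scale0r, scaler0, scale1r, addr0).
Qed.
Lemma act2_top m : b2 *: j o0 m = j o2 m.
Proof.
apply: (tensor_outP tT) => k; rewrite tensor_outZ tensor_outK rho2.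
rewrite big_ord4 !tensor_outK !mxE /=.
case: k => [[|[|[|[|//]]]] hk] /=;
by rewrite ?(scale0r, scaler0, scale1r, addr0).
Qed.

Lemma tensor_in_inj k : injective (j k).
Proof.
by move=> m m' /(congr1 (g k)); rewrite !tensor_outK eqxx !scale1r.
Qed.

Lemma tensor_split x :
  x = j o0 (g o0 x) + (b1 *: j o0 (g o1 x) + (b2 *: j o0 (g o2 x) + j o3 (g o3 x))).
Proof.
by rewrite {1}[x](tensor_decomp tT) big_ord4 act1_top act2_top.
Qed.

End OneModule.

Section Hom.
Variables (M M' : lmodType A) (T T' : lmodType B).
Variables (tt : F -> M -> T) (tt' : F -> M' -> T').
Hypotheses (tT : is_tensor tt) (tT' : is_tensor tt').
Local Notation j := (tensor_in tt).
Local Notation j' := (tensor_in tt').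
Local Notation g := (tensor_out tT).
Local Notation g' := (tensor_out tT').
Variable f : T -> T'.
Hypotheses (fD : forall u v, f (u + v) = f u + f v).
Hypotheses (fZ : forall (b : B) u, f (b *: u) = b *: f u).

Definition top_map (m : M) : M' := g' o0 (f (j o0 m)).

Lemma top_mapD m m' : top_map (m + m') = top_map m + top_map m'.
Proof.
by rewrite /top_map tensor_inD // fD raddfD.
Qed.

Lemma top_mapC c m : top_map (sc c *: m) = sc c *: top_map m.
Proof.
rewrite /top_map tensor_inC // fZ tensor_outZ rhoC (bigD1 o0) //= big1 ?addr0.
  by rewrite mxE eqxx.
by move=> i /negPf i0; rewrite mxE eq_sym i0 scale0r.
Qed.

Lemma sc_cancel (N : lmodType A) c (m m' : N) : c != 0 -> sc c *: m = sc c *: m' -> m = m'.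
Proof.
move=> c0 /(congr1 (fun m => sc c^-1 *: m)).
by rewrite !scalerA -!rmorphM mulVf // rmorph1 !scale1r.
Qed.

Lemma sc_surj (N : lmodType A) c (m : N) : c != 0 -> m = sc c *: (sc c^-1 *: m).
Proof. by move=> c0; rewrite scalerA -rmorphM mulfV // rmorph1 scale1r. Qed.

Lemma top_map_socle m : f (j o3 m) = j' o3 (top_map m).
Proof.
(* Dividing by [al] writes e3 (x) m as E_i^2 applied to e0 (x) n. *)
rewrite (sc_surj m al0); set n := _ *: m.
have := act11 tT (j o0 n); rewrite tensor_outK eqxx scale1r => <-.
by rewrite !fZ (act11 tT') top_mapC.
Qed.

Lemma top_mapX m : top_map (X *: m) = X *: top_map m.
Proof.
apply: (sc_cancel t0); rewrite -top_mapC !scalerA; apply: (tensor_in_inj tT' (k := o3)).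
rewrite -top_map_socle; have := act21 tT (j o0 m).
by rewrite tensor_outK eqxx scale1r => <-; rewrite !fZ (act21 tT').
Qed.

Lemma top_mapY m : top_map (Y *: m) = Y *: top_map m.
Proof.
apply: (sc_cancel be0); rewrite -top_mapC !scalerA; apply: (tensor_in_inj tT' (k := o3)).
rewrite -top_map_socle; have := act22 tT (j o0 m).
by rewrite tensor_outK eqxx scale1r => <-; rewrite !fZ (act22 tT').
Qed.

Lemma top_map_linear a m : top_map (a *: m) = a *: top_map m.
Proof.
apply: A_generated; [exact: top_mapD|exact: top_mapC|exact: top_mapX|exact: top_mapY].
Qed.

End Hom.

(** Compared on the socle: f(e0 (x) m) may have components outside e0, but f(e3 (x) m) = e3 (x)
    theta m is exact, so composition is visible there. *)
Lemma top_map_comp (M M' M'' : lmodType A) (T T' T'' : lmodType B)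
    (tt : F -> M -> T) (tt' : F -> M' -> T') (tt'' : F -> M'' -> T'')
    (tT : is_tensor tt) (tT' : is_tensor tt') (tT'' : is_tensor tt'')
    (f : T -> T') (f' : T' -> T'')
    (fZ : forall (b : B) u, f (b *: u) = b *: f u)
    (fZ' : forall (b : B) u, f' (b *: u) = b *: f' u) m :
  top_map tt tT'' (f' \o f) m = top_map tt' tT'' f' (top_map tt tT' f m).
Proof.
apply: (tensor_in_inj tT'' (k := o3)).
rewrite -!(top_map_socle tT) //=; last by move=> b u /=; rewrite fZ fZ'.
by rewrite (top_map_socle tT tT') // (top_map_socle tT' tT'').
Qed.

Lemma top_map_id (M : lmodType A) (T : lmodType B) (tt : F -> M -> T)
  (tT : is_tensor tt) m : top_map tt tT id m = m.
Proof. by rewrite /top_map tensor_outK eqxx scale1r. Qed.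

(** Such an [e] lowers the filtration e0, then e1 and e2, then e3, by at least one step. Being
    idempotent, it may be applied again, so it vanishes on e3, then on e1 and e2, then on e0. *)
Lemma top_map_nil (M : lmodType A) (T : lmodType B) (tt : F -> M -> T)
    (tT : is_tensor tt) (e : T -> T)
    (eD : forall u v, e (u + v) = e u + e v)
    (eZ : forall (b : B) u, e (b *: u) = b *: e u) :
  (forall x, e (e x) = e x) -> (forall m, top_map tt tT e m = 0) -> forall x, e x = 0.
Proof.
move=> ee e0.
have e3 m : e (tensor_in tt o3 m) = 0.
  by rewrite (top_map_socle tT tT) // e0 tensor_in0.
have rad m b p q : (exists u v, rho b = mx4 0 u v p q 0) ->
    e (b *: tensor_in tt o0 m) = 0.
  move=> hb; rewrite -ee eZ; have [n ->] := act_rad hb (e0 m); exact: e3.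
have e1 m : e (b1 *: tensor_in tt o0 m) = 0 
  by exact: (rad _ _ _ _ (ex_intro _ 1 (ex_intro _ 0 rho1))).
have e2 m : e (b2 *: tensor_in tt o0 m) = 0 
  by exact: (rad _ _ _ _ (ex_intro _ 0 (ex_intro _ 1 rho2))).
have e0' m : e (tensor_in tt o0 m) = 0.
  rewrite -ee [e (tensor_in _ _ _)](tensor_split tT) !eD e1 e2 e3 !addr0.
  have e00 : e 0 = 0 by have := eZ 0 0; rewrite !scale0r.
  by rewrite [tensor_out _ _ _]e0 tensor_in0.
by move=> x; rewrite (tensor_split tT x) !eD e0' e1 e2 e3 !addr0.
Qed.

Lemma mx_bim_indecomposable (M : lmodType A) (T : lmodType B) (tt : F -> M -> T) :
  is_tensor tt -> indecomposable M -> indecomposable T.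
Proof.
move=> tT [[m0 m0n] indM]; split.
  exists (tensor_in tt o3 m0); apply: contra_neq m0n => h.
  by apply: (tensor_in_inj tT (k := o3)); rewrite h tensor_in0.
move=> P Q [P0 PD PZ] [Q0 QD QZ] PQ dPQ.
have PN x : P x -> P (- x) by move=> Px; rewrite -scaleN1r; exact: PZ.
have QN x : Q x -> Q (- x) by move=> Qx; rewrite -scaleN1r; exact: QZ.
have dP x y x' y' : P x -> Q y -> P x' -> Q y' -> x + y = x' + y' -> x = x'.
  move=> Px Qy Px' Qy' h; apply/eqP; rewrite -subr_eq0; apply/eqP; apply: dPQ.
    by apply: PD => //; exact: PN.
  have -> : x - x' = y' - y by apply/eqP; rewrite subr_eq addrAC eq_sym subr_eq addrC -h addrC.
  by apply: QD => //; exact: QN.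
(* [e] is the projection onto P along Q; directness of the sum makes it B-linear. *)
have /choice [e he] v : exists x, P x /\ Q (v - x).
  have [x [y [Px Qy ->]]] := PQ v; exists x; split=> //.
  by rewrite addrC addKr.
have eP v : P (e v) by case: (he v).
have eQ v : Q (v - e v) by case: (he v).
have eE x y : P x -> Q y -> e (x + y) = x.
  by move=> Px Qy; apply: (dP _ (x + y - e (x + y)) _ y) => //; rewrite addrC subrK.
have eD u v : e (u + v) = e u + e v.
  rewrite -[u in LHS](subrK (e u)) -[v in LHS](subrK (e v)) addrACA addrC eE //.
    exact: PD.
  exact: QD.
have eZ (b : B) u : e (b *: u) = b *: e u.
  rewrite -[u in LHS](subrK (e u)) scalerDr addrC eE //; first exact: PZ.
  exact: QZ.
have eid x : P x -> e x = x by move=> Px; rewrite -[x in LHS]addr0 eE.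
have eker x : Q x -> e x = 0 by move=> Qx; rewrite -[x in LHS]add0r eE.
have ee x : e (e x) = e x by apply: eid.
pose th := top_map tt tT e.
have thD m m' : th (m + m') = th m + th m' by exact: top_mapD.
have thZ a m : th (a *: m) = a *: th m by apply: top_map_linear.
have thN m : th (- m) = - th m by rewrite -scaleN1r thZ scaleN1r.
have thth m : th (th m) = th m.
  by rewrite /th -top_map_comp // /top_map /= ee.
have th0 : th 0 = 0 by have := thZ 0 0; rewrite !scale0r.
(* The idempotent theta splits M into its fixed points and its kernel, one of which must vanish. *)
have [||||h|h] := indM (fun m => th m = m) (fun m => th m = 0).
- by split=> // [u v hu hv|a v hv]; rewrite ?thD ?thZ ?hu ?hv.
- by split=> // [u v hu hv|a v hv]; rewrite ?thD ?thZ ?hu ?hv ?addr0 ?scaler0.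
- move=> m; exists (th m), (m - th m); split=> //; last by rewrite addrC subrK.
  by rewrite thD thN thth subrr.
- by move=> m h1 h2; rewrite -h1.
- left=> x /eid <-; apply: (top_map_nil (tT := tT) eD eZ ee) => m.
  by apply: h; exact: thth.
(* Here theta has zero kernel, hence is the identity, and the complementary projection has zero top
   component. *)
- right=> x Qx; pose e' v := v - e v.
  suff : e' x = 0 by rewrite /e' (eker _ Qx) subr0.
  have e'D u v : e' (u + v) = e' u + e' v by rewrite /e' eD opprD addrACA.
  have e'Z (b : B) u : e' (b *: u) = b *: e' u by rewrite /e' eZ scalerBr.
  apply: (top_map_nil (tT := tT) e'D e'Z) => [y|m].
    by rewrite /e' [e (_ - _)]eker ?subr0.
  have -> : top_map tt tT e' m = m - th m.
    by rewrite /top_map /e' raddfB tensor_outK eqxx scale1r.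
  by apply: h; rewrite thD thN thth subrr.
Qed.

Lemma mx_bim_reflects_iso (M M' : lmodType A) (T T' : lmodType B)
    (tt : F -> M -> T) (tt' : F -> M' -> T') :
  is_tensor tt -> is_tensor tt' -> module_iso T T' -> module_iso M M'.
Proof.
move=> tT tT' [f [f' ff' f'f]].
have fD u v : f (u + v) = f u + f v by exact: raddfD.
have fZ (b : B) u : f (b *: u) = b *: f u by exact: linearZ.
have f'D u v : f' (u + v) = f' u + f' v.
  by apply: (can_inj ff'); rewrite f'f fD !f'f.
have f'Z (b : B) u : f' (b *: u) = b *: f' u.
  by apply: (can_inj ff'); rewrite f'f fZ !f'f.
pose th := top_map tt tT' f.
have lth : linear th.
  by move=> a u v; rewrite /th top_mapD // top_map_linear.
pose th' : {linear M -> M'} := HB.pack_for {linear M -> M'} th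
  (GRing.isLinear.Build A M M' *:%R th lth).
exists th'; exists (top_map tt' tT f') => m /=.
  rewrite /th -top_map_comp // (_ : f' \o f = id) ?top_map_id //.
  by apply/funext => x /=; rewrite ff'.
rewrite /th -top_map_comp // (_ : f \o f' = id) ?top_map_id //.
by apply/funext => x /=; rewrite f'f.
Qed.

End WildCriterion.

Lemma wild_criterion (C : fieldType) (B : algebra C)
    (rho : {rmorphism B -> 'M[free_algebra_XY C]_4})
    (b1 b2 : B) (al be s t : C) :
  let A := free_algebra_XY C in
  let X := free_gen C true : A in let Y := free_gen C false : A in
  (forall c, rho (alg_in B c) = (alg_in A c)%:M) ->
  al != 0 -> be != 0 -> t != 0 ->
  rho b1 = mx4 0 1 0 (alg_in A al) (alg_in A s * X) 0 ->
  rho b2 = mx4 0 0 1 (alg_in A t * X) (alg_in A be * Y) 0 -> wild B.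
Proof.
move=> A X Y rhoC al0 be0 t0 rho1 rho2.
have gen (M M' : lmodType A) (f : M -> M') :
    (forall u v, f (u + v) = f u + f v) ->
    (forall c u, f (alg_in A c *: u) = alg_in A c *: f u) ->
    (forall u, f (X *: u) = X *: f u) -> (forall u, f (Y *: u) = Y *: f u) ->
    forall a u, f (a *: u) = a *: f u.
  move=> fD fC fX fY a; elim/free_algebra_ind: a => [c|a b IHa IHb|x a IH|c a IH] m.
  - exact: fC.
  - by rewrite !scalerDl fD IHa IHb.
  - by rewrite -!scalerA -IH; case: x; [exact: fX|exact: fY].
  - by rewrite -!scalerA fC IH.
exists (mx_bimodule rhoC); split.
- exact: mx_bim_finitely_generated.
- exact: mx_bim_right_free.
- by move=> M T t' fM tT; exact: (tensor_finite_dim tT fM).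
- by move=> M T t' fM tT; exact: (mx_bim_indecomposable gen al0 be0 t0 rho1 rho2 tT).
- move=> M M' T T' t1 t2 fM fM' tT tT'.
  exact: (mx_bim_reflects_iso gen al0 be0 t0 rho1 rho2 tT tT').
Qed.

(** * Cartan integers *)

Section CartanMatrix.
Variables (C : numFieldType) (g : vectType C) (br : g -> g -> g).
Variables (h : {vspace g}) (r : nat) (alpha : 'I_r -> 'Hom(subvs_of h, C^o)).
Variable A : 'M[int]_r.
Hypotheses (brP : lie_bracket br) (baseP : is_base br alpha)
  (cartanP : is_cartan_matrix br alpha A).

Lemma lie_brDl x y z : br (x + y) z = br x z + br y z.
Proof. by case: brP => /(_ 1 x y z); rewrite !scale1r. Qed.
Lemma lie_brDr x y z : br x (y + z) = br x y + br x z.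
Proof. by case: brP => _ /(_ 1 x y z); rewrite !scale1r. Qed.
Lemma lie_br0r x : br x 0 = 0.
Proof. by apply: (addrI (br x 0)); rewrite -lie_brDr !addr0. Qed.
Lemma lie_brZr k x y : br x (k *: y) = k *: br x y.
Proof. by case: brP => _ /(_ k x y 0) + _ _; rewrite !addr0 lie_br0r addr0. Qed.
Lemma lie_br_anti x y : br x y = - br y x.
Proof.
case: brP => _ _ brxx _; apply/eqP; rewrite -addr_eq0.
by have := brxx (x + y); rewrite lie_brDl !lie_brDr !brxx add0r addr0 => ->.
Qed.
Lemma lie_brNr x y : br x (- y) = - br x y.
Proof. by rewrite -scaleN1r lie_brZr scaleN1r. Qed.
Lemma lie_jacobi x y z : br x (br y z) = br (br x y) z + br y (br x z).
Proof.
case: brP => _ _ _ /(_ x y z) /eqP; rewrite -addrA addr_eq0 => /eqP ->.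
by rewrite opprD addrC -lie_br_anti (lie_br_anti z x) lie_brNr opprK.
Qed.

Lemma root_space_br (a b : 'Hom(subvs_of h, C^o)) x y :
  in_root_space br a x -> in_root_space br b y -> in_root_space br (a + b) (br x y).
Proof.
move=> hx hy t; rewrite lie_jacobi hx hy lie_brZr lie_br_anti lie_brZr -scalerN -lie_br_anti.
by rewrite add_lfunE scalerDl.
Qed.

Lemma simple_roots_indep (c : 'I_r -> C) :
  \sum_i c i *: alpha i = 0 -> forall i, c i = 0.
Proof.
case: baseP => _ fr _ hc; pose X := [tuple alpha i | i < r].
have /freeP fX : free X by [].
apply: fX; rewrite -[RHS]hc; apply: eq_bigr => i _.
by rewrite -tnth_nth tnth_mktuple.
Qed.

(** The coefficients of a root over the base have one sign, while this difference has 1 at [j] and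
    -1 at [i]. *)
Lemma simple_root_sub_not_root i j : i != j -> ~ is_root br (alpha j - alpha i).
Proof.
move=> ij rt; case: baseP => _ _ /(_ _ rt) [n hn].
have deltaE k : \sum_l (l == k)%:R *: alpha l = alpha k.
  rewrite (bigD1 k) //= eqxx scale1r big1 ?addr0 // => l /negPf ->.
  by rewrite scale0r.
have sub_delta : \sum_l ((l == j)%:R - (l == i)%:R) *: alpha l = alpha j - alpha i.
  by under eq_bigr do rewrite scalerBl; rewrite sumrB !deltaE.
case: hn => hn.
  suff /simple_roots_indep/(_ i)/eqP :
      \sum_k ((k == j)%:R - (k == i)%:R - (n k)%:R) *: alpha k = 0.
    have -> : (i == j)%:R - (i == i)%:R - (n i)%:R = - (n i).+1%:R :> C.
      by rewrite eqxx (negPf ij) -natr1 mulr0n mulr1n; ring.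
    by rewrite oppr_eq0 pnatr_eq0.
  under eq_bigr do rewrite scalerBl; rewrite sumrB sub_delta hn.
  by apply/eqP; rewrite subr_eq0; apply/eqP; apply: eq_bigr => k _; rewrite scaler_nat.
suff /simple_roots_indep/(_ j)/eqP :
    \sum_k ((k == j)%:R - (k == i)%:R + (n k)%:R) *: alpha k = 0.
  by rewrite eqxx [j == i]eq_sym (negPf ij) subr0 nat1r pnatr_eq0.
under eq_bigr do rewrite scalerDl; rewrite big_split /= sub_delta hn.
apply/eqP; rewrite addrC subr_eq0; apply/eqP; apply: eq_bigr => k _.
by rewrite scaler_nat.
Qed.

(** Otherwise the characteristic polynomial would have more than [dim g] roots. This bounds the
    length of root strings. *)
Lemma eigenvectors_vanish (f : g -> g) (z : nat -> g) (a : nat -> C) :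
  linear f -> injective a -> (forall k, f (z k) = a k *: z k) -> exists k, z k = 0.
Proof.
move=> lf ia fz; apply: contrapT => nz.
have z0 k : z k != 0 by apply/eqP => zk; apply: nz; exists k.
pose F : {linear g -> g} := HB.pack_for {linear g -> g} f
  (GRing.isLinear.Build C g g *:%R f lf).
pose m := lin1_mx (v2r \o F \o r2v); pose N := dim g.
have ev k : root (char_poly m) (a k).
  rewrite -eigenvalue_root_char; apply/eigenvalueP; exists (v2r (z k)).
    by rewrite mul_rV_lin1 /= v2rK fz linearZ.
  by rewrite -(linear0 v2r) (inj_eq (@v2r_inj _ _)).
suff : (size [seq a k | k <- iota 0 N.+1] < size (char_poly m))%N.
  by rewrite size_char_poly size_map size_iota ltnn.
apply: max_poly_roots.
- by rewrite -size_poly_eq0 size_char_poly.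
- by apply/allP => _ /mapP[k _ ->].
- by rewrite map_inj_uniq // iota_uniq.
Qed.

Lemma cartan_diag i : A i i = 2.
Proof.
have [x [y [hi [_ _ _ h2 hA]]]] := cartanP i.
by apply/eqP; rewrite -(eqr_int C) -hA h2.
Qed.

(* The string of alpha_i through alpha_j starts at alpha_j and has finite length
   n, and the sl_2-relations along it give A i j = 1 - n. *)
Lemma cartan_offdiag i j : i != j -> A i j <= 0.
Proof.
move=> ij; have [x [y [hi [rx ry hxy h2 hA]]]] := cartanP i.
have [rj _ _] := baseP; have [_ [z z0 rz]] := rj j.
have yz : br y z = 0.
  apply/eqP/negPn/negP => yz; apply: (simple_root_sub_not_root ij); split.
    apply/eqP => ha; suff /simple_roots_indep/(_ j)/eqP :
        \sum_k ((k == j)%:R - (k == i)%:R) *: alpha k = 0.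
      by rewrite eqxx [j == i]eq_sym (negPf ij) subr0 oner_eq0.
    under eq_bigr do rewrite scalerBl; rewrite sumrB -[RHS]ha.
    by congr (_ - _); [rewrite (bigD1 j) | rewrite (bigD1 i)] => //=;
      rewrite eqxx scale1r big1 ?addr0 // => l /negPf ->; rewrite scale0r.
  by exists (br y z) => //; rewrite addrC; exact: root_space_br.
pose a : C := (A i j)%:~R; pose Z k := iter k (br x) z.
have hx : br (vsval hi) x = 2 *: x by rewrite rx h2.
have hZ k : br (vsval hi) (Z k) = (a + 2 * k%:R) *: Z k.
  elim: k => [|k IH] /=; first by rewrite mulr0 addr0 rz hA.
  rewrite lie_jacobi hx IH lie_brZr lie_br_anti lie_brZr -scalerN -lie_br_anti.
  by rewrite -scalerDl -natr1; congr (_ *: _); ring.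
(* The factor is the sum of the weights a + 2 m over m <= k. *)
have yZ k : br y (Z k.+1) = - (k.+1%:R * (a + k%:R)) *: Z k.
  have yxZ m : br y (Z m.+1) = - br (vsval hi) (Z m) + br x (br y (Z m)).
    by rewrite /= lie_jacobi (lie_br_anti y x) -hxy lie_br_anti lie_brNr -lie_br_anti.
  elim: k => [|k IH]; rewrite yxZ hZ.
    have -> : br y (Z 0) = 0 by [].
    by rewrite lie_br0r addr0 -scaleNr; congr (_ *: _); ring.
  rewrite IH lie_brZr -scaleNr -scalerDl; congr (_ *: _).
  by rewrite -!natr1; ring.
have [k0 Zk0] : exists k, Z k = 0.
  apply: (@eigenvectors_vanish (br (vsval hi)) Z (fun k => a + 2 * k%:R)) => //.
    by move=> c u v; rewrite lie_brDr lie_brZr.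
  move=> k l /addrI/(mulfI _) kl; apply/eqP; rewrite -(eqr_nat C); apply/eqP/kl.
  by rewrite pnatr_eq0.
have [[|k] /eqP Zk mink] := ex_minnP (ex_intro (fun k => Z k == 0) k0 (introT eqP Zk0)).
  by move: Zk z0 => /= ->; rewrite eqxx.
have Zk1 : Z k != 0 by apply/negP => /mink; rewrite ltnn.
have := yZ k; rewrite Zk lie_br0r => /esym/eqP.
rewrite scaler_eq0 (negPf Zk1) orbF oppr_eq0 mulf_eq0 pnatr_eq0 /= => /eqP ak.
by rewrite -(ler_int C) -/a; have -> : a = - k%:R; [apply/eqP; rewrite -addr_eq0 ak|
  rewrite oppr_le0 ler0n].
Qed.
End CartanMatrix.

(** * Quantum integers and the Serre relations *)

Section QNumbers.
Variables (L : fieldType) (w : L).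

Definition qz (m : int) : L := (w ^ m - w ^ (- m)) / (w - w^-1).

(** The Gaussian binomial with an arbitrary integer on top, since weights can be negative. *)
Definition qbin (m : int) (t : nat) : L := \prod_(k < t) qz (m - k%:Z) / qfact w t.

Lemma qint_qz n : qint w n = qz n%:Z.
Proof. by rewrite /qint /qz -exprnP exprnN. Qed.

Lemma qz0 : qz 0 = 0.
Proof. by rewrite /qz oppr0 subrr mul0r. Qed.

Lemma qfactS n : qfact w n.+1 = qfact w n * qz n.+1%:Z.
Proof. by rewrite /qfact big_nat_recr //= qint_qz. Qed.

Lemma qfact0 : qfact w 0 = 1.
Proof. by rewrite /qfact big_geq. Qed.

Lemma qbin0 m : qbin m 0 = 1.
Proof. by rewrite /qbin big_ord0 qfact0 divr1. Qed.

Hypotheses (w0 : w != 0) (w_generic : forall n, (0 < n)%N -> w ^+ n != 1).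

Let wz0 m : w ^ m != 0. Proof. exact: expfz_neq0. Qed.

Lemma sub_invr_neq0 : w - w^-1 != 0.
Proof.
rewrite subr_eq0; apply/eqP => h; have /eqP := @w_generic 2 isT; apply.
by rewrite expr2 {2}h mulfV.
Qed.
Let ww0 := sub_invr_neq0.

Lemma qz_neq0 n : qz n.+1%:Z != 0.
Proof.
rewrite /qz mulf_neq0 ?invr_eq0 // subr_eq0; apply/eqP => h.
have /eqP := @w_generic (n.+1 + n.+1) isT; apply.
by rewrite exprD [w ^+ n.+1 in X in _ * X]exprnP h -exprnN mulfV // expf_neq0.
Qed.

Lemma qfact_neq0 n : qfact w n != 0.
Proof.
elim: n => [|n IH]; first by rewrite qfact0 oner_neq0.
by rewrite qfactS mulf_neq0 ?qz_neq0.
Qed.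

Lemma qz1 : qz 1 = 1.
Proof. by rewrite /qz expr1z exprN1 mulfV. Qed.

Lemma qz_two : qz 2 = w + w^-1.
Proof.
rewrite /qz -exprnP -exprnN; field.
by rewrite w0 subr_eq0 -expr2 w_generic.
Qed.

Lemma qbin_recl m t : qbin m t.+1 = qz m * (qbin (m - 1) t / qz t.+1%:Z).
Proof.
rewrite /qbin big_ord_recl qfactS subr0 invfM !mulrA; congr (_ * _ / _ / _).
by apply: eq_bigr => k _; congr qz; rewrite /= /bump; lia.
Qed.

Lemma qbin_recr m t : qbin m t.+1 = qz (m - t%:Z) * (qbin m t / qz t.+1%:Z).
Proof.
rewrite /qbin big_ord_recr qfactS /= invfM [_ * qz _]mulrC -!mulrA.
by congr (_ * _).
Qed.

Lemma qz_pascal m t : qz m = w ^ t * qz (m - t) + w ^ (t - m) * qz t.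
Proof.
rewrite /qz !mulrA -mulrDl; congr (_ / _); rewrite !mulrBr -!expfzDr //.
have [-> -> ->] : [/\ t + (m - t) = m, t + - (m - t) = t - m + t & t - m - t = - m].
  by split; lia.
by rewrite addrA subrK.
Qed.

Lemma qbin_pascal m t :
  qbin m t.+1 = w ^ t.+1%:Z * qbin (m - 1) t.+1 + w ^ (t.+1%:Z - m) * qbin (m - 1) t.
Proof.
have qt0 : qz t.+1%:Z != 0 by exact: qz_neq0.
rewrite qbin_recl [qbin (m - 1) t.+1]qbin_recr (qz_pascal m t.+1%:Z).
rewrite (_ : m - 1 - t%:Z = m - t.+1%:Z); last by lia.
by field.
Qed.

(** The quantum form of (s - t)(m - t) + (m + s - t) t = s m; it drives the inductions for moving F
    across divided powers of E. *)
Lemma qz_kostant (s t m : int) :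
  qz (s - t) * qz (m - t) + qz (m + s - t) * qz t = qz s * qz m.
Proof.
rewrite /qz !(opprB, opprD, opprK) !expfzDr // -!invr_expz; field.
by rewrite w0 !wz0 subr_eq0 -expr2 w_generic.
Qed.

Lemma qbin_kostant (s t : nat) (m : int) :
  qz (s%:Z - t.+1%:Z) * qbin (m - 1) t.+1 + qz (m + s%:Z - t.+1%:Z) * qbin (m - 1) t
  = qz s%:Z * qbin m t.+1.
Proof.
have qt0 : qz t.+1%:Z != 0 by exact: qz_neq0.
rewrite [qbin m _]qbin_recl [qbin (m - 1) t.+1]qbin_recr [RHS]mulrA -(qz_kostant s t.+1%:Z).
rewrite (_ : m - 1 - t%:Z = m - t.+1%:Z); last by lia.
by field.
Qed.

Lemma qfact_split n k :
  qfact w (k + n) = \prod_(i < k) qz ((k + n)%:Z - i%:Z) * qfact w n.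
Proof.
elim: k => [|k IH]; first by rewrite big_ord0 mul1r.
rewrite addSn qfactS IH big_ord_recl subr0 mulrC -mulrA; congr (_ * (_ * _)).
by apply: eq_bigr => i _; congr qz; rewrite /= /bump; lia.
Qed.

Lemma qbinomE n k : (k <= n)%N -> qbinom w n k = qbin n%:Z k.
Proof.
move=> kn; have := qfact_split (n - k) k; rewrite /qbinom /qbin subnKC // => ->.
by field; rewrite !qfact_neq0.
Qed.

(** With [qz_step_neg], the inductive step for commuting x^m with f: the first handles the
    coefficient of K, the second that of its inverse. *)
Lemma qz_step_pos (m : int) :
  qz m * (w ^ (m - 1) * w ^ 2) + 1 = qz (m + 1) * w ^ m.
Proof.
have e1 : w ^ (m - 1) * w ^ 2 = w ^ m * w.
  by rewrite -[w in RHS]expr1z -!expfzDr //; congr (w ^ _); lia.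
rewrite e1 /qz !opprD !expfzDr // !expr1z !exprN1 -!invr_expz; field.
by rewrite w0 wz0 subr_eq0 -expr2 w_generic.
Qed.

Lemma qz_step_neg (m : int) :
  qz m * (w ^ (1 - m) * w ^ (- 2)) + 1 = qz (m + 1) * w ^ (- m).
Proof.
have e1 : w ^ (1 - m) * w ^ (- 2) = (w ^ m)^-1 * w^-1.
  by rewrite -[w^-1]exprN1 invr_expz -!expfzDr //; congr (w ^ _); lia.
rewrite e1 /qz !opprD !expfzDr // !expr1z !exprN1 -!invr_expz; field.
by rewrite w0 wz0 subr_eq0 -expr2 w_generic.
Qed.

Lemma qbin_nat_small n : qbin n%:Z n.+1 = 0.
Proof. by rewrite qbin_recr subrr qz0 mul0r. Qed.

(** By Pascal's rule the partial sum up to [m] is (-1)^m w^(m n) [n - 1 choose m], which vanishes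
    for m = n. *)
Lemma qbin_alternating_sum n : (0 < n)%N ->
  \sum_(s < n.+1) (-1) ^+ s * qbin n%:Z s * w ^ (s%:Z * (n%:Z - 1)) = 0.
Proof.
case: n => // n _; set N : int := n.+1%:Z.
pose a s := (-1) ^+ s * (w ^ (s%:Z * N) * qbin n%:Z s).
suff E m : \sum_(s < m.+1) (-1) ^+ s * qbin N s * w ^ (s%:Z * (N - 1)) = a m.
  by rewrite E /a qbin_nat_small !mulr0.
elim: m => [|m IH]; first by rewrite big_ord1 /a !qbin0 !(mul0r, mulr1).
have nN : n%:Z = N - 1 by rewrite /N; lia.
have e1 : w ^ (m.+1%:Z * N) = w ^ m.+1%:Z * w ^ (m.+1%:Z * (N - 1)).
  by rewrite -expfzDr //; congr (w ^ _); ring.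
have e2 : w ^ (m%:Z * N) = w ^ (m.+1%:Z - N) * w ^ (m.+1%:Z * (N - 1)).
  by rewrite -expfzDr //; congr (w ^ _); rewrite (intS m); ring.
rewrite big_ord_recr /= IH qbin_pascal /a -nN e1 e2 nN exprS.
ring.
Qed.
End QNumbers.

Lemma qzV (L : fieldType) (w : L) m : qz w^-1 m = qz w m.
Proof.
rewrite /qz !exprz_inv !opprK invrK -[w^-1 - w]opprB -[_ - w ^ m]opprB.
by rewrite invrN mulrNN.
Qed.

Lemma qbinV (L : fieldType) (w : L) m t : qbin w^-1 m t = qbin w m t.
Proof.
rewrite /qbin /qfact; congr (_ / _); apply: eq_bigr => k _; first exact: qzV.
by rewrite !qint_qz qzV.
Qed.

(** * Quantum Serre elements commute with opposite generators *)

Section SerreCommutes.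
#[local] Opaque qz qbin.
Variables (L : fieldType) (w : L) (V : lmodType L).
Hypotheses (w0 : w != 0) (w_generic : forall n, (0 < n)%N -> w ^+ n != 1).
Local Notation En := (end_algebra V).

Definition qserre (S : algebra L) n (x y : S) : S :=
  \sum_(s < n.+1) alg_in S ((-1) ^+ s * qbinom w n s) * (x ^+ (n - s) * y * x ^+ s).

Lemma qserreE n (x y : En) v :
  qserre n x y v =
  \sum_(s < n.+1) ((-1) ^+ s * qbin w n s) *: (x ^+ (n - s)) (y ((x ^+ s) v)).
Proof.
rewrite end_sumE; apply: eq_bigr => s _.
by rewrite qbinomE // -ltnS.
Qed.

Lemma end_expD (x : En) a b v : (x ^+ (a + b)) v = (x ^+ a) ((x ^+ b) v).
Proof. by rewrite exprD. Qed.

Lemma end_commX (x f : En) a v : (forall v, x (f v) = f (x v)) ->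
  (x ^+ a) (f v) = f ((x ^+ a) v).
Proof. by move=> xf; elim: a v => // a IH v; rewrite !exprSr !end_mulE xf IH. Qed.

Lemma end_qcommX (x K : En) z b v : (forall v, K (x v) = z *: x (K v)) ->
  K ((x ^+ b) v) = z ^+ b *: (x ^+ b) (K v).
Proof.
move=> h; elim: b v => [|b IH] v; first by rewrite expr0 scale1r.
by rewrite !exprSr !end_mulE IH h !end_scale scalerA.
Qed.

Lemma expfz_expn (a : int) (s : nat) : (w ^ a) ^+ s = w ^ (s%:Z * a).
Proof. by rewrite exprnP exprz_exp mulrC. Qed.

Variables (n : nat) (x y f K K' : En) (c : L).
Hypothesis n0 : (0 < n)%N.

(** Here [f] interacts with the middle factor [y] only. Moving K and K' to the right, every term
    yields multiples of the same vectors x^n K v and x^n K' v, and their coefficients add up to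
    vanishing alternating sums. *)
Lemma qserre_commutes_right :
  (forall v, x (f v) = f (x v)) ->
  (forall v, y (f v) = f (y v) + c *: (K v - K' v)) ->
  (forall v, K (x v) = w ^ (1 - n%:Z) *: x (K v)) ->
  (forall v, K' (x v) = w ^ (n%:Z - 1) *: x (K' v)) ->
  forall v, qserre n x y (f v) = f (qserre n x y v).
Proof.
move=> xf yf Kx K'x v; rewrite !qserreE.
rewrite [f (\sum_(_ < _) _)](_ : _ =
    \sum_(s < n.+1) ((-1) ^+ s * qbin w n s) *: f ((x ^+ (n - s)) (y ((x ^+ s) v)))); last first.
  elim/big_rec2: _ => [|s u u' _ <-]; first exact: end_0.
  by rewrite end_add end_scale.
apply/eqP; rewrite -subr_eq0 -sumrB; apply/eqP.
transitivity (\sum_(s < n.+1)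
   (((-1) ^+ s * qbin w n s * w ^ (s%:Z * (1 - n%:Z))) *: (c *: (x ^+ n) (K v)) -
    ((-1) ^+ s * qbin w n s * w ^ (s%:Z * (n%:Z - 1))) *: (c *: (x ^+ n) (K' v)))).
  apply: eq_bigr => s _; rewrite (end_commX _ _ xf) yf -scalerBr end_add (end_commX _ _ xf).
  rewrite addrAC subrr add0r (end_qcommX _ _ Kx) (end_qcommX _ _ K'x).
  rewrite end_scale end_add -scaleN1r !end_scale -!end_expD subnK -1?ltnS //.
  rewrite scaleN1r !expfz_expn !scalerBr !scalerA.
  by congr (_ *: _ - _ *: _); ring.
rewrite sumrB -!scaler_suml qbin_alternating_sum // scale0r subr0.
(* The sum for [K] is the one for [K'] with [w] inverted, and [qbin] is invariant under this
   inversion. *)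
rewrite [X in X *: _](_ : _ = 0) ?scale0r // -[RHS](@qbin_alternating_sum L w^-1 _ _ n) //.
- by apply: eq_bigr => s _; rewrite qbinV exprz_inv; congr (_ * _ * w ^ _); lia.
- by rewrite invr_eq0.
- by move=> m m0; rewrite exprVn invr_eq1 w_generic.
Qed.

(** Here [f] interacts with [x]. The commutator of x^(n - s) y x^s with f is [n - s] G_s + [s] G_(s
    - 1), and the signed sum telescopes because [n choose s][n - s] = [n choose s + 1][s + 1]. *)
Lemma qserre_commutes_left :
  (forall v, y (f v) = f (y v)) ->
  (forall v, x (f v) = f (x v) + (w - w^-1)^-1 *: (K v - K' v)) ->
  (forall v, K (x v) = w ^ 2 *: x (K v)) ->
  (forall v, K' (x v) = w ^ (- 2) *: x (K' v)) ->
  (forall v, K (y v) = w ^ (1 - n%:Z) *: y (K v)) ->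
  (forall v, K' (y v) = w ^ (n%:Z - 1) *: y (K' v)) ->
  forall v, qserre n x y (f v) = f (qserre n x y v).
Proof.
move=> yf xf Kx K'x Ky K'y v.
have ww0 := sub_invr_neq0 w0 w_generic.
set k := (w - w^-1)^-1 in xf.
have xmf m u : (x ^+ m) (f u) = f ((x ^+ m) u) + (qz w m * k) *:
    (w ^ (m%:Z - 1) *: (x ^+ m.-1) (K u) - w ^ (1 - m%:Z) *: (x ^+ m.-1) (K' u)).
  case: m => [|m]; first by rewrite qz0 mul0r scale0r addr0.
  elim: m u => [|m IH] u; first by rewrite !expr1 xf qz1 // subrr !scale1r mul1r.
  rewrite exprSr end_mulE xf end_add IH end_scale -addrA; congr (_ + _).
  rewrite Kx K'x !end_scale [m.+2.-1]/= [m.+1.-1]/= -!(end_mulE (x ^+ m) x) -!exprSr.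
  rewrite end_sub.
  rewrite !scalerBr !scalerA addrACA -opprD -!scalerDl.
  have eS : m.+2%:Z = m.+1%:Z + 1 by rewrite intS addrC.
  have := qz_step_pos w0 w_generic m.+1%:Z; have := qz_step_neg w0 w_generic m.+1%:Z.
  have e3 : m.+2%:Z - 1 = m.+1%:Z by clear; lia.
  have e4 : 1 - m.+2%:Z = - m.+1%:Z by clear; lia.
  rewrite e3 e4 -eS => e1 e2.
  congr (_ *: _ - _ *: _).
    by rewrite [RHS]mulrAC -e2 mulrDl mul1r; congr (_ + _); rewrite -!mulrA; congr (_ * _); ring.
  by rewrite [RHS]mulrAC -e1 mulrDl mul1r; congr (_ + _); rewrite -!mulrA; congr (_ * _); ring.
(* [G s] has n - 1 factors x, of which s stand to the right of y. The truncated predecessors at s =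
   n and s = 0 are harmless: they are multiplied by [0]. *)
pose G s := k *: (w ^ s%:Z *: (x ^+ (n - s).-1) (y ((x ^+ s) (K v))) -
                  w ^ (- s%:Z) *: (x ^+ (n - s).-1) (y ((x ^+ s) (K' v)))).
have term s : (s <= n)%N -> (x ^+ (n - s)) (y ((x ^+ s) (f v))) =
    f ((x ^+ (n - s)) (y ((x ^+ s) v))) + (qz w (n - s)%:Z *: G s + qz w s%:Z *: G s.-1).
  move=> sn; rewrite (xmf s) !end_add [y (f _)]yf (xmf (n - s)%N) -addrA.
  have ns : (n - s)%:Z = n%:Z - s%:Z by lia.
  congr (_ + (_ + _)).
    rewrite Ky K'y (end_qcommX _ _ Kx) (end_qcommX _ _ K'x) !end_scale /G -scalerA.
    do 2!congr (_ *: _); rewrite !scalerA !expfz_expn -!expfzDr // ns.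
    by congr (_ *: _ - _ *: _); congr (w ^ _); clear; lia.
  case: s sn {ns} => [|s] sn; first by rewrite qz0 mul0r !scale0r !end_0.
  rewrite !end_scale !end_sub !end_scale /G /= -subnS -scalerA.
  by do 2!congr (_ *: _); congr (_ *: _ - _ *: _); congr (w ^ _); lia.
clearbody G; apply/eqP; rewrite -subr_eq0 !qserreE.
rewrite [f (\sum_(_ < _) _)](_ : _ =
    \sum_(s < n.+1) ((-1) ^+ s * qbin w n s) *: f ((x ^+ (n - s)) (y ((x ^+ s) v)))); last first.
  elim/big_rec2: _ => [|s u u' _ <-]; first exact: end_0.
  by rewrite end_add end_scale.
rewrite -sumrB.
pose b s := ((-1) ^+ s * qbin w n s.+1 * qz w s.+1%:Z) *: G s.
have bE s : ((-1) ^+ s * qbin w n s * qz w (n%:Z - s%:Z)) *: G s = b s.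
  rewrite /b qbin_recr; congr (_ *: _).
  by field; exact: qz_neq0.
transitivity (\sum_(s < n.+1) (b s + ((-1) ^+ s * qbin w n s * qz w s%:Z) *: G s.-1) == 0).
  congr (_ == _); apply: eq_bigr => s _; rewrite term -1?ltnS // scalerDr addrC addKr.
  rewrite scalerDr !scalerA -bE.
  by rewrite (_ : (n - s)%:Z = n%:Z - s%:Z) //; have := ltn_ord s; clear; lia.
(* The partial sums telescope to [b m], and [b n] contains the factor [n choose n + 1] = 0. *)
suff -> m : \sum_(s < m.+1) (b s + ((-1) ^+ s * qbin w n s * qz w s%:Z) *: G s.-1) = b m.
  by rewrite /b qbin_nat_small mulr0 mul0r scale0r eqxx.
elim: m => [|m IH]; first by rewrite big_ord1 qz0 !mulr0 scale0r addr0.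
rewrite big_ord_recr IH /= addrCA [b m]/b -scalerDl exprS !mulN1r !mulNr addrC.
by rewrite addrC subrr scale0r addr0.
Qed.

End SerreCommutes.

(** * The dual Verma module *)

Section DualVerma.
Variables (L : fieldType) (v : L) (r : nat) (A : 'M[int]_r) (d : 'I_r -> nat).
Hypotheses (v0 : v != 0) (v_generic : forall n, (0 < n)%N -> v ^+ n != 1).
Hypotheses (d_gt0 : forall i, (0 < d i)%N)
  (symA : forall i j, (d i)%:Z * A i j = (d j)%:Z * A j i)
  (diagA : forall i, A i i = 2) (offA : forall i j, i != j -> A i j <= 0).

Definition wordfun : lmodType L := (seq 'I_r -> L^o).
Local Notation V := wordfun.
Local Notation En := (end_algebra V).
Local Notation vi i := (v ^+ d i).

Lemma vi0 i : vi i != 0. Proof. exact: expf_neq0. Qed.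
Lemma vi_generic i n : (0 < n)%N -> vi i ^+ n != 1.
Proof. by move=> n0; rewrite -exprM v_generic // muln_gt0 d_gt0. Qed.

(* The word s has K_i-eigenvalue v_i^(- wt i s); the lowest weight is -2 rho, so
   that E_i^2 does not kill the vacuum. *)
Definition wt (i : 'I_r) (s : seq 'I_r) : int := 2 - \sum_(c <- s) A i c.

Lemma wt_cons i k s : wt i (k :: s) = wt i s - A i k.
Proof. by rewrite /wt big_cons; ring. Qed.

(* F_i deletes the first letter i of a word, in the dual of the free algebra, and
   the value of E_i is then forced by F_k E_i = E_i F_k + delta_ik [wt i]. *)
Definition lowerF_fun (i : 'I_r) (x : V) : V := fun s => x (i :: s).
Definition diag_fun (i : 'I_r) (g : int -> L) (x : V) : V := fun s => g (wt i s) * x s.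
Fixpoint raiseE_fun (i : 'I_r) (x : V) (s : seq 'I_r) : L :=
  if s is k :: s' then
    raiseE_fun i (lowerF_fun k x) s' + (if k == i then qz (vi i) (wt i s') * x s' else 0)
  else 0.

Fact lowerF_linear i : linear (lowerF_fun i). Proof. by []. Qed.
Fact diag_linear i g : linear (diag_fun i g).
Proof.
move=> a x y; apply/funext => s.
change (g (wt i s) * (a * x s + y s) = a * (g (wt i s) * x s) + g (wt i s) * y s).
by ring.
Qed.
Fact raiseE_linear i : linear (raiseE_fun i : V -> V).
Proof.
move=> a x y; apply/funext => s.
change (raiseE_fun i (a *: x + y) s = a * raiseE_fun i x s + raiseE_fun i y s).
elim: s x y => [|k s IH] x y /=; first by rewrite mulr0 addr0.
rewrite lowerF_linear IH; case: ifP => _; last by rewrite !addr0.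
rewrite [(a *: x + y) s](_ : _ = a * x s + y s) //; ring.
Qed.

Definition opF i : En := mk_end (lowerF_linear i).
(** One family for [K_i], its inverse, the quantum integer of the weight and the binomials in
    Kostant's formula. *)
Definition opD i g : En := mk_end (diag_linear i g).
Definition opE i : En := mk_end (raiseE_linear i).

Lemma opF_E i x s : opF i x s = x (i :: s). Proof. by []. Qed.
Lemma opD_E i g x s : opD i g x s = g (wt i s) * x s. Proof. by []. Qed.
Lemma opE_nil i x : opE i x [::] = 0. Proof. by []. Qed.

Lemma opF_opE k i x : opF k (opE i x) =
  opE i (opF k x) + (if k == i then opD i (qz (vi i)) x else 0).
Proof.
apply/funext => s.
change (opE i (opF k x) s + (if k == i then qz (vi i) (wt i s) * x s else 0) =
  opE i (opF k x) s + (if k == i then opD i (qz (vi i)) x else 0) s).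
by case: eqP.
Qed.

Lemma opF_opD k i g x : opF k (opD i g x) = opD i (fun z => g (z - A i k)) (opF k x).
Proof. by apply/funext => s; rewrite opF_E !opD_E wt_cons. Qed.

Lemma opE_cons i x k s : opE i x (k :: s) =
  opE i (opF k x) s + (if k == i then qz (vi i) (wt i s) * x s else 0).
Proof. by []. Qed.

Lemma opE_opD k i g x : opE k (opD i g x) = opD i (fun z => g (z + A i k)) (opE k x).
Proof.
apply/funext => s; rewrite opD_E; elim: s g x => [|c s IH] g x; first by rewrite !opE_nil mulr0.
rewrite !opE_cons opF_opD IH wt_cons mulrDr; congr (_ + _).
  by congr (g _ * _); rewrite addrAC.
case: eqP => [->|_]; last by rewrite mulr0.
by rewrite opD_E subrK mulrCA.
Qed.

Lemma opD_opD i g j h x : opD i g (opD j h x) = opD j h (opD i g x).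
Proof. by apply/funext => s; rewrite !opD_E mulrCA. Qed.

Lemma opD_ext i g h x : (forall z, g z = h z) -> opD i g x = opD i h x.
Proof. by move=> gh; apply/funext => s; rewrite !opD_E gh. Qed.

Lemma opD_scale i a g x : opD i (fun z => a * g z) x = a *: opD i g x.
Proof. by apply/funext => s; exact/esym/mulrA. Qed.

Lemma opD_add i g h x : opD i (fun z => g z + h z) x = opD i g x + opD i h x.
Proof. by apply/funext => s; exact: mulrDl. Qed.

Definition opK i : En := opD i (fun z => vi i ^ (- z)).
Definition opKi i : En := opD i (fun z => vi i ^ z).

Lemma opK_opKi i x : opK i (opKi i x) = x.
Proof.
apply/funext => s; rewrite /opK /opKi !opD_E mulrA -expfzDr ?vi0 // addNr expr0z.
exact: mul1r.
Qed.
Lemma opKi_opK i x : opKi i (opK i x) = x.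
Proof. by rewrite /opKi opD_opD opK_opKi. Qed.

Lemma vi_symA i j : vi j ^ A j i = vi i ^ A i j.
Proof. by rewrite !exprnP !exprz_exp symA. Qed.

Lemma opK_opE i j x : opK i (opE j x) = vi i ^ A i j *: opE j (opK i x).
Proof.
rewrite /opK opE_opD -opD_scale; apply: opD_ext => z.
by rewrite -expfzDr ?vi0 //; congr (_ ^ _); lia.
Qed.
Lemma opKi_opE i j x : opKi i (opE j x) = vi i ^ (- A i j) *: opE j (opKi i x).
Proof.
rewrite /opKi opE_opD -opD_scale; apply: opD_ext => z.
by rewrite -expfzDr ?vi0 //; congr (_ ^ _); lia.
Qed.
Lemma opK_opF i j x : opK i (opF j x) = vi i ^ (- A i j) *: opF j (opK i x).
Proof.
rewrite /opK opF_opD -opD_scale; apply: opD_ext => z.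
by rewrite -expfzDr ?vi0 //; congr (_ ^ _); lia.
Qed.
Lemma opKi_opF i j x : opKi i (opF j x) = vi i ^ A i j *: opF j (opKi i x).
Proof.
rewrite /opKi opF_opD -opD_scale; apply: opD_ext => z.
by rewrite -expfzDr ?vi0 //; congr (_ ^ _); lia.
Qed.

Lemma opD_qz i x : opD i (qz (vi i)) x = (vi i - (vi i)^-1)^-1 *: (opKi i x - opK i x).
Proof.
apply/funext => s; rewrite opD_E.
change (qz (vi i) (wt i s) * x s =
  (vi i - (vi i)^-1)^-1 * (vi i ^ wt i s * x s - vi i ^ (- wt i s) * x s)).
by rewrite /qz -mulrBl mulrA [_^-1 * _]mulrC.
Qed.

Lemma opE_opF_comm i j x : opE i (opF j x) = opF j (opE i x) +
  (if i == j then (vi i - (vi i)^-1)^-1 *: (opK i x - opKi i x) else 0).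
Proof.
rewrite opF_opE [j == i]eq_sym; case: eqP => [->|_]; last by rewrite !addr0.
by rewrite opD_qz -addrA -scalerDr addrA subrK subrr scaler0 addr0.
Qed.

(** * The Serre elements acting on functions on words *)

Section Serre.
Variables (i j : 'I_r).
Hypothesis ij : i != j.
Local Notation n := (`|1 - A i j|%N).

(** Nonpositivity of [A i j] resolves the absolute value: n = 1 - A i j. *)
Let n_gt0 : (0 < n)%N. Proof. by have := offA ij; lia. Qed.
Let n_int : 1 - n%:Z = A i j. Proof. by have := offA ij; lia. Qed.
Let n_int' : n%:Z - 1 = - A i j. Proof. by have := offA ij; lia. Qed.

Definition serreE : En := qserre (vi i) n (opE i) (opE j).
Definition serreF : En := qserre (vi i) n (opF i) (opF j).

Lemma serreE_opF k x : serreE (opF k x) = opF k (serreE x).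
Proof.
have [ki|ki] := eqVneq i k.
  subst k; apply: (@qserre_commutes_left _ _ _ (vi0 i) (@vi_generic i)
    _ _ _ _ (opK i) (opKi i)) => // y.
  - by rewrite opE_opF_comm eq_sym (negPf ij) addr0.
  - by rewrite opE_opF_comm eqxx.
  - by rewrite opK_opE diagA.
  - by rewrite opKi_opE diagA.
  - by rewrite n_int opK_opE.
  - by rewrite n_int' opKi_opE.
have [kj|kj] := eqVneq j k.
  subst k; apply: (@qserre_commutes_right _ _ _ (vi0 i) (@vi_generic i) _ _ _ _ (opK j) (opKi j)
     (vi j - (vi j)^-1)^-1) => // y.
  - by rewrite opE_opF_comm (negPf ij) addr0.
  - by rewrite opE_opF_comm eqxx.
  - by rewrite n_int opK_opE vi_symA.
  - by rewrite n_int' opKi_opE -!invr_expz vi_symA.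
(* For k different from i and j both commutators vanish, so zero operators stand in for [K] and
   [K']. *)
apply: (@qserre_commutes_right _ _ _ (vi0 i) (@vi_generic i) _ _ _ _ 0 0 0) => // y.
- by rewrite opE_opF_comm (negPf ki) addr0.
- by rewrite opE_opF_comm (negPf kj) scale0r.
- by rewrite !end_0E end_0 scaler0.
- by rewrite !end_0E end_0 scaler0.
Qed.

Lemma serreF_opE k x : serreF (opE k x) = opE k (serreF x).
Proof.
have [ki|ki] := eqVneq i k.
  subst k; apply: (@qserre_commutes_left _ _ _ (vi0 i) (@vi_generic i)
    _ _ _ _ (opKi i) (opK i)) => // y.
  - by rewrite opF_opE eq_sym (negPf ij) addr0.
  - by rewrite opF_opE eqxx opD_qz.
  - by rewrite opKi_opF diagA.
  - by rewrite opK_opF diagA.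
  - by rewrite n_int opKi_opF.
  - by rewrite n_int' opK_opF.
have [kj|kj] := eqVneq j k.
  subst k; apply: (@qserre_commutes_right _ _ _ (vi0 i) (@vi_generic i) _ _ _ _ (opKi j) (opK j)
     (vi j - (vi j)^-1)^-1) => // y.
  - by rewrite opF_opE (negPf ij) addr0.
  - by rewrite opF_opE eqxx opD_qz.
  - by rewrite n_int opKi_opF vi_symA.
  - by rewrite n_int' opK_opF -!invr_expz vi_symA.
apply: (@qserre_commutes_right _ _ _ (vi0 i) (@vi_generic i) _ _ _ _ 0 0 0) => // y.
- by rewrite opF_opE (negPf ki) addr0.
- by rewrite opF_opE (negPf kj) scale0r.
- by rewrite !end_0E end_0 scaler0.
- by rewrite !end_0E end_0 scaler0.
Qed.

(** A value at a word is the value at the empty word after applying F's. The Serre element commutes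
    with these, and each of its terms begins with E_i or E_j, whose values at the empty word are
    0. *)
Lemma serreE_eq0 x : serreE x = 0.
Proof.
apply/funext => s; elim: s x => [|k s IH] x.
  rewrite /serreE (qserreE (vi0 i) (@vi_generic i)) fct_sumE big1 // => t _.
  change (((-1) ^+ t * qbin (vi i) n t) *
    ((opE i ^+ (n - t)) (opE j ((opE i ^+ t) x)) [::]) = 0).
  by case: (n - t)%N => [|m]; rewrite ?exprS mulr0.
by rewrite -[LHS]/(opF k (serreE x) s) -serreE_opF IH.
Qed.

(** The Serre element is homogeneous of weight n alpha_i + alpha_j up to sign, so it only shifts the
    argument of [g]. *)
Lemma serreF_opD l g x : serreF (opD l g x) =
  opD l (fun z => g (z - A l i * n%:Z - A l j)) (serreF x).
Proof.
have FX a h y : (opF i ^+ a) (opD l h y) = opD l (fun z => h (z - A l i * a%:Z)) ((opF i ^+ a) y).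
  elim: a h y => [|a IH] h y.
    by rewrite expr0 !end_1E; apply: opD_ext => z; rewrite mulr0 subr0.
  rewrite !exprSr !end_mulE opF_opD IH; apply: opD_ext => z; congr h.
  by rewrite intS; ring.
rewrite /serreF !(qserreE (vi0 i) (@vi_generic i)).
rewrite [RHS](_ : _ = \sum_(s < n.+1) opD l (fun z => g (z - A l i * n%:Z - A l j))
   (((-1) ^+ s * qbin (vi i) n s) *: (opF i ^+ (n - s)) (opF j ((opF i ^+ s) x)))); last first.
  by elim/big_rec2: _ => [|s u u' _ <-]; rewrite ?end_0 ?end_add.
apply: eq_bigr => s _; rewrite end_scale FX opF_opD FX; congr (_ *: _).
apply: opD_ext => z; congr g.
rewrite (_ : n%:Z = (n - s)%:Z + s%:Z); first by ring.
by have := ltn_ord s; clear; lia.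
Qed.
End Serre.

(** The first letter acts first, so the value of [opF_word t x] at the empty word is [x t]. *)
Fixpoint opF_word (t : seq 'I_r) (x : V) : V :=
  if t is k :: t' then opF_word t' (opF k x) else x.

Lemma opF_word_cons k t x : opF_word (k :: t) x = opF_word t (opF k x).
Proof. by []. Qed.

Lemma opF_word_linear t : linear (opF_word t).
Proof. by elim: t => // k t IH a x y; exact: (IH a (opF k x) (opF k y)). Qed.

(* The largest submodule of the dual Verma module on which the Serre relations
   between the F's hold as well. *)
Definition serre_null (x : V) : Prop :=
  forall i j, i != j -> forall t, serreF i j (opF_word t x) = 0.

Lemma opF_word_opD t l g x : exists h, opF_word t (opD l g x) = opD l h (opF_word t x).
Proof.
elim: t g x => [|k t IH] g x; first by exists g.
by rewrite !opF_word_cons opF_opD; exact: IH.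
Qed.

Lemma opF_word0 t : opF_word t 0 = 0.
Proof. by elim: t => // k t IH; rewrite opF_word_cons end_0. Qed.

Lemma serre_null_lin a x y : serre_null x -> serre_null y -> serre_null (a *: x + y).
Proof.
by move=> nx ny i j ij t; rewrite opF_word_linear end_add end_scale nx // ny // scaler0 addr0.
Qed.

Lemma serre_null0 : serre_null 0.
Proof. by move=> i j ij t; rewrite opF_word0 end_0. Qed.

Lemma serre_null_opD l g x : serre_null x -> serre_null (opD l g x).
Proof.
move=> nx i j ij t; have [h ->] := opF_word_opD t l g x.
by rewrite serreF_opD nx // end_0.
Qed.

Lemma serre_null_opF k x : serre_null x -> serre_null (opF k x).
Proof. by move=> nx i j ij t; exact: (nx i j ij (k :: t)). Qed.

(** [serreF] commutes with E_k, and moving a letter F_c across E_k costs only a diagonal operator,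
    which preserves the submodule. *)
Lemma serre_null_opE k x : serre_null x -> serre_null (opE k x).
Proof.
move=> nx i j ij t; elim: t x nx => [|c t IH] x nx.
  by rewrite [opF_word _ _]/(opE k x) serreF_opE // (nx i j ij [::]) end_0.
have wD y z : opF_word t (y + z) = opF_word t y + opF_word t z.
  by have := opF_word_linear t 1 y z; rewrite !scale1r.
rewrite opF_word_cons opF_opE wD end_add IH ?add0r; last exact: serre_null_opF.
case: ifP => _; last exact: serre_null0.
exact: serre_null_opD.
Qed.

Definition vacuum : V := fun s => (s == [::])%:R.

Lemma serre_null_vacuum : serre_null vacuum.
Proof.
move=> i j ij t.
have F0 k (y : V) : (forall s, s != [::] -> y s = 0) -> opF k y = 0.
  by move=> y0; apply/funext => s; exact: y0.
have tv : forall s, s != [::] -> opF_word t vacuum s = 0.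
  case: t => [|k t] s s0; first by rewrite [LHS]/(vacuum s) /vacuum (negPf s0).
  rewrite opF_word_cons F0 ?opF_word0 // => {}s {}s0.
  by rewrite /vacuum (negPf s0).
rewrite /serreF (qserreE (vi0 i) (@vi_generic i)) big1 // => s _.
have -> : opF j ((opF i ^+ s) (opF_word t vacuum)) = 0.
  case: (nat_of_ord s) => [|m]; first by rewrite expr0 end_1E F0.
  by rewrite exprSr end_mulE [opF i _]F0 // !end_0.
by rewrite end_0 scaler0.
Qed.

Definition vacuum_word (e : seq 'I_r) : V := foldr (fun k x => opE k x) vacuum e.

Lemma opE_homogeneous n k (x : V) :
  (forall w, size w != n -> x w = 0) -> forall w, size w != n.+1 -> opE k x w = 0.
Proof.
move=> hx w; elim: w n x hx => [|c w IH] n x hx; first by rewrite opE_nil.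
rewrite eqSS => wn; rewrite opE_cons hx // mulr0 if_same addr0.
case: n hx wn => [|n] hx wn.
  have -> : opF c x = 0 by apply/funext => s; exact: hx.
  by rewrite end_0.
by apply: (IH n) => // s sn; apply: hx; rewrite eqSS.
Qed.

Lemma vacuum_word_size e w : size w != size e -> vacuum_word e w = 0.
Proof.
elim: e w => [|k e IH] w; first by rewrite /vacuum_word /= /vacuum => /nilP/eqP/negPf ->.
exact: opE_homogeneous.
Qed.

Lemma opF_vacuum k : opF k vacuum = 0.
Proof. by apply/funext. Qed.

Lemma vacuum_word1 a c : vacuum_word [:: a] [:: c] = (c == a)%:R * qz (vi a) 2.
Proof.
apply: (etrans (opE_cons a vacuum c [::])); rewrite opF_vacuum end_0 add0r /wt big_nil subr0.
by case: eqP => _; rewrite ?mul0r // mul1r /vacuum mulr1.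
Qed.

(** F_c meets either E_b, which acts on the vacuum, or E_a, which acts on a vector of weight 2 - A a
    b. When all four letters agree, the second coefficient is [0] and [2]^2 remains. *)
Lemma vacuum_word2 a b c k : vacuum_word [:: a; b] [:: c; k] =
  ((c == b) && (k == a))%:R * (qz (vi a) 2 * qz (vi b) 2) +
  ((c == a) && (k == b))%:R * (qz (vi a) (2 - A a k) * qz (vi b) 2).
Proof.
apply: (etrans (opE_cons a (opE b vacuum) c [:: k])); rewrite opF_opE opF_vacuum end_0 add0r.
rewrite -[opE b vacuum]/(vacuum_word [:: b]) vacuum_word1 /wt big_seq1.
congr (_ + _); last first.
  by case: (c == a); rewrite ?mul0r //= mulrCA.
case: (c == b); last by rewrite end_0 mul0r.
have -> : opD b (qz (vi b)) vacuum = qz (vi b) 2 *: vacuum.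
  apply/funext => s; change (qz (vi b) (wt b s) * vacuum s = qz (vi b) 2 * vacuum s).
  by case: s => [|u s]; rewrite /vacuum ?mulr0 // /wt big_nil subr0.
rewrite end_scale -[X in X = _]/(qz (vi b) 2 * vacuum_word [:: a] [:: k]) vacuum_word1.
by rewrite mulrCA [qz (vi b) 2 * _]mulrC.
Qed.

Section Action.

Definition gen_op (g : qgen r) : En :=
  match g with gE i => opE i | gF i => opF i | gK i => opK i | gKinv i => opKi i end.

Local Notation gen_act := (free_lift gen_op).

Lemma gen_act_serre w n a b :
  gen_act (qserre w n (free_gen L a) (free_gen L b)) = qserre w n (gen_op a) (gen_op b).
Proof.
rewrite /qserre free_lift_sum; apply: eq_bigr => s _.
by rewrite free_liftM free_liftC !free_liftM !free_liftX !free_lift_gen.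
Qed.

End Action.

(** * A lattice stable under divided powers *)

Section Lattice.
Variable S : subringClosed L.
Hypotheses (Sv : v \in S) (SvV : v^-1 \in S).

Lemma vz_in i (m : int) : vi i ^ m \in S.
Proof.
case: m => m; first by rewrite -exprnP !rpredX.
by rewrite NegzE -exprnN -exprVn rpredX // -exprVn rpredX.
Qed.

(** Powers of [v] are units of S, so Pascal's rule can be solved in both directions of [m], starting
    from [0 choose t + 1] = 0. *)
Lemma qbin_in i m t : qbin (vi i) m t \in S.
Proof.
have g0 := vi0 i; have gg := @vi_generic i.
elim: t m => [|t IH] m; first by rewrite qbin0 rpred1.
have down k : qbin (vi i) (k - 1) t.+1 =
    vi i ^ (- t.+1%:Z) * (qbin (vi i) k t.+1 - vi i ^ (t.+1%:Z - k) * qbin (vi i) (k - 1) t).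
  by rewrite (qbin_pascal g0 gg k) addrK mulrA -expfzDr // addNr expr0z mul1r.
elim/int_ind: m => [|n IHn|n IHn].
- by rewrite (qbin_recl g0 gg) qz0 mul0r rpred0.
- rewrite (qbin_pascal g0 gg) (_ : n.+1%:Z - 1 = n%:Z); last by clear; lia.
  by rewrite rpredD // rpredM // vz_in.
- rewrite (_ : - n.+1%:Z = - n%:Z - 1); last by rewrite intS; ring.
  rewrite down; apply: rpredM; first exact: vz_in.
  by apply: rpredB => //; apply: rpredM => //; exact: vz_in.
Qed.

Lemma qz_in i m : qz (vi i) m \in S.
Proof.
have := qbin_in i m 1; have gg := @vi_generic i.
by rewrite (qbin_recl (vi0 i) gg) qbin0 (qz1 (vi0 i) gg) divr1 mulr1.
Qed.

Definition opFd k m : En := alg_in En (qfact (vi k) m)^-1 * opF k ^+ m.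
Definition opEd k m : En := alg_in En (qfact (vi k) m)^-1 * opE k ^+ m.

Lemma opFdE k m x : opFd k m x = (qfact (vi k) m)^-1 *: (opF k ^+ m) x.
Proof. by []. Qed.
Lemma opEdE k m x : opEd k m x = (qfact (vi k) m)^-1 *: (opE k ^+ m) x.
Proof. by []. Qed.

Lemma opEd0 k x : opEd k 0 x = x.
Proof. by rewrite opEdE qfact0 invr1 scale1r. Qed.
Lemma opFd0 k x : opFd k 0 x = x.
Proof. by rewrite opFdE qfact0 invr1 scale1r. Qed.

Lemma opF_opFd k m x : opF k (opFd k m x) = qz (vi k) m.+1 *: opFd k m.+1 x.
Proof.
rewrite !opFdE end_scale scalerA exprS end_mulE qfactS invfM mulrCA mulfV ?mulr1 //.
exact: (qz_neq0 (vi0 k) (@vi_generic k)).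
Qed.

Lemma opF_opEd k n x : opF k (opEd k n.+1 x) =
  opEd k n.+1 (opF k x) + opEd k n (opD k (fun z => qz (vi k) (z - n%:Z)) x).
Proof.
have g0 := vi0 k; have gg := @vi_generic k.
suff E : opF k ((opE k ^+ n.+1) x) = (opE k ^+ n.+1) (opF k x) +
    qz (vi k) n.+1 *: (opE k ^+ n) (opD k (fun z => qz (vi k) (z - n%:Z)) x).
  rewrite !opEdE end_scale E scalerDr scalerA qfactS invfM -mulrA mulVf ?mulr1 //.
  exact: qz_neq0.
elim: n => [|n IH].
  rewrite !expr1 opF_opE eqxx qz1 // scale1r; congr (_ + _).
  by apply: opD_ext => z; rewrite subr0.
rewrite exprS end_mulE opF_opE eqxx IH end_add -end_mulE -exprS -addrA; congr (_ + _).
rewrite end_scale -end_mulE -exprS.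
have DX h m y : opD k h ((opE k ^+ m) y) = (opE k ^+ m) (opD k (fun z => h (z - 2 * m%:Z)) y).
  elim: m h y => [|m IHm] h y.
    by rewrite expr0 !end_1E; apply: opD_ext => z; rewrite mulr0 subr0.
  rewrite exprS end_mulE (_ : opD k h (opE k _) = opE k (opD k (fun z => h (z - 2)) ((opE k ^+ m) y))).
    rewrite IHm; congr (opE k ((opE k ^+ m) _)); apply: opD_ext => z; congr h; rewrite intS; ring.
  by rewrite opE_opD; apply: opD_ext => z; rewrite diagA addrK.
rewrite DX -[RHS]end_scale -[X in X + _ = _]end_scale -end_add; congr ((opE k ^+ n.+1) _).
rewrite -!opD_scale -opD_add; apply: opD_ext => z.
have := qz_kostant g0 gg n.+2%:Z n.+1%:Z (z - n.+1%:Z).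
rewrite (_ : n.+2%:Z - n.+1%:Z = 1); last by clear; lia.
rewrite qz1 // mul1r (_ : z - n.+1%:Z + n.+2%:Z - n.+1%:Z = z - n%:Z); last by clear; lia.
rewrite (_ : z - 2 * n.+1%:Z = z - n.+1%:Z - n.+1%:Z); last by clear; lia.
by move=> <-; rewrite addrC mulrC.
Qed.

(* Kostant's commutation formula, where z is the weight of F^(s - t) x. *)
Lemma opFd_opEd k s n x : opFd k s (opEd k n x) =
  \sum_(t < s.+1) if (t <= n)%N then
     opEd k (n - t) (opD k (fun z => qbin (vi k) (z - s%:Z - n%:Z + 2 * t%:Z) t) (opFd k (s - t) x))
   else 0.
Proof.
have g0 := vi0 k; have gg := @vi_generic k.
elim: s => [|s IH].
  rewrite big_ord1 leq0n subn0 !opFd0; congr (opEd k n _); apply/funext => z.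
  by rewrite opD_E qbin0 mul1r.
have qs0 := qz_neq0 g0 gg s.
(* F F^(s) = [s + 1] F^(s + 1), and [s + 1] is nonzero for generic [v]. *)
apply: (scalerI qs0); rewrite -opF_opFd IH.
(* [U] collects the terms where the additional F passes E^(n - t), and [W] those where it cancels
   one E; the latter join [U] with index t + 1. *)
pose U t := if (t <= n)%N then qz (vi k) (s.+1%:Z - t%:Z) *: opEd k (n - t)
   (opD k (fun z => qbin (vi k) (z - 2 - s%:Z - n%:Z + 2 * t%:Z) t) (opFd k (s.+1 - t) x)) else 0.
pose W t := if (t < n)%N then opEd k (n - t.+1) (opD k (fun z => qz (vi k) (z - (n - t.+1)%:Z))
   (opD k (fun z => qbin (vi k) (z - s%:Z - n%:Z + 2 * t%:Z) t) (opFd k (s - t) x))) else 0.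
transitivity (\sum_(t < s.+1) U t + \sum_(t < s.+1) W t).
  rewrite (_ : _ + _ = \sum_(t < s.+1) (U t + W t)); last by rewrite big_split.
  rewrite end_sum; apply: eq_bigr => t _; rewrite /U /W.
  have ts : (t <= s)%N by rewrite -ltnS.
  case: (ltngtP t n) => [tn|tn|tn].
  - have -> : (n - t = (n - t.+1).+1)%N by clear -tn; lia.
    rewrite opF_opEd; congr (_ + _).
    rewrite opF_opD opF_opFd subSn // !end_scale.
    congr (qz (vi k) _ *: _); first by clear -ts; lia.
    by congr (_ *: opEd k _ _); apply: opD_ext => z; rewrite diagA; congr (qbin _ _ _); ring.
  - by rewrite end_0 addr0.
  - rewrite tn subnn !opEd0 addr0 opF_opD opF_opFd subSn // -?tn // end_scale.
    congr (qz (vi k) _ *: _); first by clear -ts; lia.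
    by apply: opD_ext => z; rewrite diagA; congr (qbin _ _ _); ring.
rewrite scaler_sumr [RHS]big_ord_recl.
have -> : \sum_(t < s.+1) U t = U 0 + \sum_(t < s.+1) U t.+1.
  have Us : U s.+1 = 0.
    by rewrite /U subrr qz0 scale0r; case: ifP.
  transitivity (\sum_(t < s.+2) U t); last by rewrite big_ord_recl.
  have Um : U (nat_of_ord (@ord_max s.+1)) = 0 by exact: Us.
  by rewrite [RHS]big_ord_recr Um; exact/esym/addr0.
rewrite -addrA (_ : _ + \sum_(t < s.+1) W t = \sum_(t < s.+1) (U t.+1 + W t));
  last by rewrite big_split.
congr (_ + _).
  rewrite /U !leq0n !subn0 subr0; congr (qz _ _ *: opEd k n _).
  by apply: opD_ext => z; rewrite !qbin0.
apply: eq_bigr => t _; rewrite lift0 /U /W.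
case: ltnP => tn; last by rewrite scaler0 addr0.
rewrite subSS; set y := opFd k (s - t) x.
pose y1 : V := opD k (fun z => qbin (vi k) (z - 2 - s%:Z - n%:Z + 2 * t.+1%:Z) t.+1) y.
pose y2 : V := opD k (fun z => qz (vi k) (z - (n - t.+1)%:Z))
  (opD k (fun z => qbin (vi k) (z - s%:Z - n%:Z + 2 * t%:Z) t) y).
transitivity (opEd k (n - t.+1) (qz (vi k) (s.+1%:Z - t.+1%:Z) *: y1 + y2)).
  by rewrite [RHS]end_add [opEd _ _ (_ *: y1)]end_scale.
rewrite -[RHS]end_scale; congr (opEd k (n - t.+1) _); apply/funext => u.
symmetry; change (qz (vi k) s.+1%:Z *
    (qbin (vi k) (wt k u - s.+1%:Z - n%:Z + 2 * t.+1%:Z) t.+1 * y u) =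
  qz (vi k) (s.+1%:Z - t.+1%:Z) *
    (qbin (vi k) (wt k u - 2 - s%:Z - n%:Z + 2 * t.+1%:Z) t.+1 * y u) +
  qz (vi k) (wt k u - (n - t.+1)%:Z) *
    (qbin (vi k) (wt k u - s%:Z - n%:Z + 2 * t%:Z) t * y u)).
set M := wt k u - s.+1%:Z - n%:Z + 2 * t.+1%:Z.
have e1 : wt k u - 2 - s%:Z - n%:Z + 2 * t.+1%:Z = M - 1 by rewrite /M; clear; lia.
have e2 : wt k u - s%:Z - n%:Z + 2 * t%:Z = M - 1 by rewrite /M; clear; lia.
have e3 : wt k u - (n - t.+1)%:Z = M + s.+1%:Z - t.+1%:Z by rewrite /M; clear -tn; lia.
rewrite e1 e2 e3 mulrA -(qbin_kostant g0 gg s.+1 t M) mulrDl -!mulrA.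
by [].
Qed.

Fixpoint opFd_word (bl : seq ('I_r * nat)) (x : V) : V :=
  if bl is b :: bl' then opFd_word bl' (opFd b.1 b.2 x) else x.

(** Integrality is tested on products of divided powers of the F's, not merely on words. Stability
    under F^(m) is thus built in, and stability under E^(m) is what Kostant's formula provides. *)
Definition in_lattice (x : V) : Prop := forall bl, opFd_word bl x [::] \in S.

Lemma opFd_word_cons b bl x : opFd_word (b :: bl) x = opFd_word bl (opFd b.1 b.2 x).
Proof. by []. Qed.

Lemma opFd_wordD bl x y : opFd_word bl (x + y) = opFd_word bl x + opFd_word bl y.
Proof. by elim: bl x y => // b bl IH x y; rewrite !opFd_word_cons end_add IH. Qed.

Lemma in_latticeD x y : in_lattice x -> in_lattice y -> in_lattice (x + y).
Proof. by move=> lx ly bl; rewrite opFd_wordD; apply: rpredD; [exact: lx|exact: ly]. Qed.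

Lemma in_lattice0 : in_lattice 0.
Proof.
move=> bl; have -> : opFd_word bl 0 = 0; last exact: rpred0.
by elim: bl => // b bl IH; rewrite opFd_word_cons end_0.
Qed.

Lemma opFd_opD k m l g x : exists2 h, (forall z, h z = g (z - A l k * m%:Z)) &
  opFd k m (opD l g x) = opD l h (opFd k m x).
Proof.
exists (fun z => g (z - A l k * m%:Z)) => //.
rewrite !opFdE end_scale; congr (_ *: _).
elim: m g x => [|m IH] g x.
  by rewrite expr0 !end_1E; apply: opD_ext => z; rewrite mulr0 subr0.
rewrite !exprSr !end_mulE opF_opD IH; apply: opD_ext => z; congr g.
by rewrite intS; ring.
Qed.

Lemma in_lattice_opD l g x : (forall z, g z \in S) -> in_lattice x -> in_lattice (opD l g x).
Proof.
move=> gS lx bl; suff [h hS ->] : exists2 h, (forall z, h z \in S) &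
    opFd_word bl (opD l g x) = opD l h (opFd_word bl x).
  by rewrite opD_E; apply: rpredM => //; exact: lx.
elim: bl g gS x {lx} => [|b bl IH] g gS x; first by exists g.
rewrite !opFd_word_cons; have [h hE ->] := opFd_opD b.1 b.2 l g x.
by apply: IH => z; rewrite hE.
Qed.

Lemma in_lattice_scale a x : a \in S -> in_lattice x -> in_lattice (a *: x).
Proof.
move=> aS lx bl; have -> : opFd_word bl (a *: x) = a *: opFd_word bl x.
  by elim: bl x {lx} => // b bl IH x; rewrite !opFd_word_cons end_scale IH.
by apply: rpredM => //; exact: lx.
Qed.

Lemma in_lattice_opFd k m x : in_lattice x -> in_lattice (opFd k m x).
Proof. by move=> lx bl; exact: (lx ((k, m) :: bl)). Qed.

(** E^(m) is moved to the left through the test product, by Kostant's formula for equal indices and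
    by plain commutation otherwise; at the empty word it gives 0 unless m = 0. *)
Lemma in_lattice_opEd k m x : in_lattice x -> in_lattice (opEd k m x).
Proof.
move=> lx bl; elim: bl k m x lx => [|[c s] bl IH] k m x lx.
  case: m => [|m]; first by rewrite opEd0; exact: (lx [::]).
  suff E : opEd k m.+1 x [::] = 0.
    by rewrite -[X in X \in S]/(opEd k m.+1 x [::]) E rpred0.
  change ((qfact (vi k) m.+1)^-1 * (opE k ^+ m.+1) x [::] = 0).
  by rewrite exprS end_mulE opE_nil mulr0.
rewrite opFd_word_cons [_.1]/= [_.2]/=; have [->|ck] := eqVneq c k.
  rewrite opFd_opEd.
  have lin (I : Type) (rr : seq I) (F : I -> V) : (forall i, opFd_word bl (F i) [::] \in S) ->
      opFd_word bl (\sum_(i <- rr) F i) [::] \in S.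
    move=> FS; elim: rr => [|i rr IHr]; first by rewrite big_nil; exact: in_lattice0.
    by rewrite big_cons opFd_wordD; apply: rpredD.
  apply: lin => t; case: ifP => _; last exact: in_lattice0.
  by apply/IH/in_lattice_opD; [move=> z; exact: qbin_in|exact: in_lattice_opFd].
have -> : opFd c s (opEd k m x) = opEd k m (opFd c s x).
  rewrite !opFdE !opEdE !end_scale scalerA mulrC -scalerA; do 2!congr (_ *: _).
  have FE y : opF c (opE k y) = opE k (opF c y) by rewrite opF_opE (negPf ck) addr0.
  have FX a y : (opF c ^+ a) (opE k y) = opE k ((opF c ^+ a) y) by exact: end_commX.
  by symmetry; apply: end_commX => y; rewrite FX.
exact/IH/in_lattice_opFd.
Qed.

Lemma in_lattice_opK i x : in_lattice x -> in_lattice (opK i x).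
Proof. by apply: in_lattice_opD => z; exact: vz_in. Qed.
Lemma in_lattice_opKi i x : in_lattice x -> in_lattice (opKi i x).
Proof. by apply: in_lattice_opD => z; exact: vz_in. Qed.

Lemma in_lattice_vacuum : in_lattice vacuum.
Proof.
have F0 k (y : V) : (forall s, s != [::] -> y s = 0) -> opF k y = 0.
  by move=> y0; apply/funext => s; exact: y0.
elim=> [|[k [|m]] bl IH]; first by rewrite rpred1.
  by rewrite opFd_word_cons opFd0.
rewrite opFd_word_cons opFdE exprSr end_mulE F0 ?end_0 ?scaler0; first exact: in_lattice0.
by move=> s /negPf s0; rewrite /vacuum s0.
Qed.

End Lattice.
End DualVerma.

(** * Laurent polynomials and their specialization *)

Section Laurent.

Lemma horner_vQ (p : {poly int}) : (map_poly intr p).[vQ] = tofrac (map_poly intr p).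
Proof.
have -> : map_poly intr p = map_poly (@tofrac _) (map_poly polyC (map_poly (intr : int -> rat) p)).
  rewrite -!map_poly_comp; apply: eq_map_poly => m /=.
  by rewrite -[RHS]/(tofrac (polyC m%:~R)) !rmorph_int.
rewrite horner_map; congr (tofrac _).
by rewrite -[RHS]comp_polyXr.
Qed.

(** This makes the substitution of [q] for v well defined on Laurent polynomials. *)
Lemma vQ_transcendental (p : {poly int}) : (map_poly intr p).[vQ] = 0 -> p = 0.
Proof.
rewrite horner_vQ => /eqP; rewrite tofrac_eq0 => /eqP p0.
by apply: (@map_inj_poly _ _ (intr : int -> rat)); rewrite ?map_poly0 // => m n /intr_inj.
Qed.

Lemma vQ_neq0 : vQ != 0.
Proof. by rewrite tofrac_eq0 polyX_eq0. Qed.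

Lemma vQ_generic n : (0 < n)%N -> vQ ^+ n != 1.
Proof.
move=> n0; rewrite -tofracXn -tofrac1 tofrac_eq; apply/eqP => /(congr1 (fun p : {poly rat} => size p)).
by rewrite size_polyXn size_poly1 => -[n0']; rewrite n0' in n0.
Qed.

End Laurent.

Section LaurentField.
Variables (L : fieldType) (x : L).
Hypothesis x0 : x != 0.
Implicit Types p : {poly int}.

Lemma laurent_atD p n p' n' :
  laurent_at x p n + laurent_at x p' n' = laurent_at x (p * 'X^n' + p' * 'X^n) (n + n').
Proof.
rewrite /laurent_at rmorphD !rmorphM /= !map_polyXn ?(hornerD, hornerN, hornerM, hornerXn) exprD.
by field; rewrite !expf_neq0.
Qed.
Lemma laurent_atM p n p' n' :
  laurent_at x p n * laurent_at x p' n' = laurent_at x (p * p') (n + n').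
Proof.
rewrite /laurent_at rmorphM /= hornerM exprD.
by field; rewrite !expf_neq0.
Qed.
Lemma laurent_atN p n : - laurent_at x p n = laurent_at x (- p) n.
Proof. by rewrite /laurent_at rmorphN hornerN mulNr. Qed.
Lemma laurent_at1 : laurent_at x 1 0 = 1.
Proof. by rewrite /laurent_at rmorph1 hornerC divr1. Qed.
Lemma laurent_at0 : laurent_at x 0 0 = 0.
Proof. by rewrite /laurent_at rmorph0 horner0 mul0r. Qed.
Lemma laurent_atX : laurent_at x 'X 0 = x.
Proof. by rewrite /laurent_at map_polyX hornerX divr1. Qed.
Lemma laurent_atV : laurent_at x 1 1 = x^-1.
Proof. by rewrite /laurent_at rmorph1 hornerC mul1r expr1. Qed.
End LaurentField.

Definition laurent : {pred Qv} := fun a => `[< exists p n, a = laurent_at vQ p n >].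

Fact laurent_subring_closed : subring_closed laurent.
Proof.
have v0 := vQ_neq0.
split=> [|x y /asboolP[p [n ->]] /asboolP[p' [n' ->]]|x y /asboolP[p [n ->]] /asboolP[p' [n' ->]]];
  apply/asboolP.
- by exists 1, 0; rewrite laurent_at1.
- by do 2!eexists; rewrite laurent_atN laurent_atD.
- by do 2!eexists; rewrite laurent_atM.
Qed.
HB.instance Definition _ := GRing.isSubringClosed.Build Qv laurent laurent_subring_closed.

Lemma laurentP a : a \in laurent -> exists p n, a = laurent_at vQ p n.
Proof. by move=> h; exact/asboolP. Qed.
Lemma laurent_in p n : laurent_at vQ p n \in laurent.
Proof. by apply/asboolP; exists p, n. Qed.
Lemma vQ_in : vQ \in laurent.
Proof. by rewrite -[vQ]laurent_atX laurent_in. Qed.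
Lemma vQV_in : vQ^-1 \in laurent.
Proof. by rewrite -laurent_atV laurent_in. Qed.

Section Evaluation.
Variables (C : fieldType) (q : C).
Hypothesis q0 : q != 0.

(** A presentation p / v^n is chosen; outside [laurent] the value 0 is a default. *)
Definition laurent_ev (a : Qv) : C :=
  if pselect (exists pn : {poly int} * nat, a = laurent_at vQ pn.1 pn.2) is left h
  then let pn := projT1 (cid h) in laurent_at q pn.1 pn.2 else 0.

Lemma laurent_evE p n : laurent_ev (laurent_at vQ p n) = laurent_at q p n.
Proof.
rewrite /laurent_ev; case: pselect => [h|[]]; last by exists (p, n).
case: (cid h) => -[p' n'] /= E.
have : (map_poly intr (p * 'X^n' - p' * 'X^n)).[vQ] = 0.
  rewrite rmorphB !rmorphM /= !map_polyXn ?(hornerD, hornerN, hornerM, hornerXn).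
  move: E => /eqP; rewrite /laurent_at eqr_div ?expf_neq0 ?vQ_neq0 // => /eqP ->.
  by rewrite subrr.
move=> /vQ_transcendental /eqP; rewrite subr_eq0 => /eqP /(congr1 (fun p => (map_poly intr p).[q])).
rewrite !rmorphM /= !map_polyXn ?(hornerD, hornerN, hornerM, hornerXn) => Eq.
by apply/eqP; rewrite /laurent_at eqr_div ?expf_neq0 // Eq.
Qed.

Lemma laurent_evD a b : a \in laurent -> b \in laurent ->
  laurent_ev (a + b) = laurent_ev a + laurent_ev b.
Proof.
move=> /laurentP[p [n ->]] /laurentP[p' [n' ->]].
by rewrite laurent_atD ?vQ_neq0 // !laurent_evE laurent_atD.
Qed.
Lemma laurent_evM a b : a \in laurent -> b \in laurent ->
  laurent_ev (a * b) = laurent_ev a * laurent_ev b.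
Proof.
move=> /laurentP[p [n ->]] /laurentP[p' [n' ->]].
by rewrite laurent_atM ?vQ_neq0 // !laurent_evE laurent_atM.
Qed.
Lemma laurent_ev1 : laurent_ev 1 = 1.
Proof. by rewrite -(laurent_at1 vQ) laurent_evE laurent_at1. Qed.
Lemma laurent_ev0 : laurent_ev 0 = 0.
Proof. by rewrite -(laurent_at0 vQ) laurent_evE laurent_at0. Qed.
Lemma laurent_evX n : laurent_ev (vQ ^+ n) = q ^+ n.
Proof.
elim: n => [|n IH]; first by rewrite !expr0 laurent_ev1.
rewrite !exprS laurent_evM ?rpredX ?vQ_in // IH; congr (_ * _).
by rewrite -[vQ]laurent_atX laurent_evE laurent_atX.
Qed.
Lemma laurent_evV n : laurent_ev (vQ ^- n) = q ^- n.
Proof.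
rewrite -[LHS]mul1r -(@mulVf _ (q ^+ n)) ?expf_neq0 // -mulrA -laurent_evX -laurent_evM ?rpredX ?vQ_in //.
  by rewrite mulfV ?expf_neq0 ?vQ_neq0 // laurent_ev1 laurent_evX mulr1.
by rewrite -exprVn rpredX // vQV_in.
Qed.
End Evaluation.

(** * Modules over quotient algebras *)

Section QuotientAlgebra.
Variables (K : comPzRingType) (A : algebra K) (R : A -> Prop).
Local Notation Q := (quotient_algebra R).
Local Notation pi := (quotient_proj R).

Lemma quotient_projM a b : pi (a * b) = pi a * pi b.
Proof. exact: quotient_piM. Qed.
Lemma quotient_projD a b : pi (a + b) = pi a + pi b.
Proof. exact: quotient_piD. Qed.
Lemma quotient_projC c : pi (alg_in A c) = alg_in Q c.
Proof. by []. Qed.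
Lemma quotient_projP a b : pi a = pi b <-> in_ideal R (a - b).
Proof. exact: quotient_piP. Qed.
Lemma quotient_proj_rel a b : R (a - b) -> pi a = pi b.
Proof. by move=> h; apply/quotient_projP/in_ideal_gen. Qed.

Definition quotient_repr (u : Q) : A := repr (u : quotient_car R).
Lemma quotient_proj_repr u : pi (quotient_repr u) = u.
Proof. exact: quotient_reprK. Qed.
End QuotientAlgebra.

(** * Algebras given by relations that hold on a submodule *)

Section QuotientAction.
Variables (K : fieldType) (X : choiceType) (R : free_algebra K X -> Prop).
Variables (V : lmodType K) (op : X -> end_algebra V) (N : V -> Prop).
Hypotheses (N_lin : forall a x y, N x -> N y -> N (a *: x + y)) (N0 : N 0)
  (N_op : forall g x, N x -> N (op g x))
  (N_rel : forall u x, R u -> N x -> free_lift op u x = 0).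

Lemma free_act_stable u x : N x -> N (free_lift op u x).
Proof.
elim/free_algebra_ind: u x => [c|a b IHa IHb|g a IH|c a IH] x nx.
- by rewrite free_liftC end_inE -[_ *: _]addr0; apply: N_lin.
- rewrite free_liftD end_addE -[free_lift op a x]scale1r; apply: N_lin; first exact: IHa.
  exact: IHb.
- by rewrite free_liftM end_mulE free_lift_gen; apply/N_op/IH.
- rewrite free_liftM end_mulE free_liftC end_inE -[_ *: _]addr0.
  by apply: N_lin => //; exact: IH.
Qed.

(** The relations hold on N only, so for a right multiple of a relation the vector must first stay
    in N; hence the stability of N. *)
Lemma ideal_act0 u x : in_ideal R u -> N x -> free_lift op u x = 0.
Proof.
move=> Iu; elim: Iu x => [{}u Ru x nx||a b _ IHa _ IHb x nx|a b _ IH x nx|b a _ IH x nx].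
- exact: N_rel.
- by move=> x _; rewrite -(subrr 0) free_liftB end_addE end_oppE subrr.
- by rewrite free_liftD end_addE IHa // IHb // addr0.
- by rewrite free_liftM end_mulE IH // end_0.
- by rewrite free_liftM end_mulE IH //; exact: free_act_stable.
Qed.

Local Notation Q := (quotient_algebra R).
Local Notation pi := (quotient_proj R).

(** Acts through a chosen representative on all of V; independence of the choice and
    multiplicativity are asserted on N. *)
Definition quotient_act (u : Q) (x : V) : V := free_lift op (quotient_repr u) x.

Lemma quotient_actE a x : N x -> quotient_act (pi a) x = free_lift op a x.
Proof.
move=> nx; apply/eqP; rewrite /quotient_act -subr_eq0.
rewrite (_ : _ - _ = free_lift op (quotient_repr (pi a) - a) x); last by rewrite free_liftB.
by apply/eqP/ideal_act0 => //; apply/quotient_projP; exact: quotient_proj_repr.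
Qed.

Lemma quotient_act_stable u x : N x -> N (quotient_act u x).
Proof. exact: free_act_stable. Qed.

Lemma quotient_actM u u' x : N x -> quotient_act (u * u') x = quotient_act u (quotient_act u' x).
Proof.
move=> nx; rewrite -[u]quotient_proj_repr -[u']quotient_proj_repr -quotient_projM.
rewrite !quotient_actE // ?free_liftM //; exact: free_act_stable.
Qed.

Lemma quotient_actD u u' x : N x -> quotient_act (u + u') x = quotient_act u x + quotient_act u' x.
Proof.
move=> nx; rewrite -[u]quotient_proj_repr -[u']quotient_proj_repr -quotient_projD.
by rewrite !quotient_actE // free_liftD.
Qed.

Lemma quotient_actC c x : N x -> quotient_act (alg_in Q c) x = c *: x.
Proof. by move=> nx; rewrite [alg_in Q c]/(pi (alg_in _ c)) quotient_actE // free_liftC. Qed.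

Lemma quotient_act1 x : N x -> quotient_act 1 x = x.
Proof. by move=> nx; rewrite -(rmorph1 (alg_in Q)) quotient_actC // scale1r. Qed.

Lemma quotient_act_gen g x : N x -> quotient_act (pi (free_gen K g)) x = op g x.
Proof. by move=> nx; rewrite quotient_actE // free_lift_gen. Qed.

Lemma quotient_actX u n x f : N x -> (forall y, N y -> quotient_act u y = end_fun f y) ->
  (forall y, N y -> N (end_fun f y)) ->
  quotient_act (u ^+ n) x = (f ^+ n : end_car V) x.
Proof.
move=> nx uf Nf; elim: n x nx => [|n IH] x nx; first by rewrite !expr0 quotient_act1.
by rewrite !exprSr quotient_actM // uf // IH //; exact: Nf.
Qed.

Lemma quotient_actZ u a x : quotient_act u (a *: x) = a *: quotient_act u x.
Proof. exact: end_scale. Qed.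

End QuotientAction.

(** * Linear forms and four-dimensional representations *)

Lemma qcommute_power (C : fieldType) (S : algebra C) (k g : S) c n :
  k * g = alg_in S c * (g * k) -> k ^+ n * g = alg_in S (c ^+ n) * (g * k ^+ n).
Proof.
move=> h; elim: n => [|n IH]; first by rewrite !expr0 mul1r mulr1 rmorph1 mul1r.
rewrite exprS -mulrA IH mulrA -alg_inC -mulrA [k * _]mulrA h.
by rewrite -!mulrA mulrA -rmorphM -exprSr.
Qed.

Lemma form_power (C : fieldType) (S : algebra C) (L : S -> C) (k : S) c n x :
  (forall x, L (x * k) = c * L x) -> L (x * k ^+ n) = c ^+ n * L x.
Proof.
move=> h; elim: n => [|n IH]; first by rewrite !expr0 mulr1 mul1r.
by rewrite exprSr mulrA h IH mulrA -exprS.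
Qed.

Section CentralQuotientForm.
Variables (C : fieldType) (S : algebra C) (G : S -> Prop) (L : S -> C).
Local Notation H := (subalgebra G).
Local Notation incl := (@subalgebra_incl C S G).
Variable R : H -> Prop.
Hypotheses (LD : forall x y, L (x + y) = L x + L y)
  (LC : forall c x, L (alg_in S c * x) = c * L x).
Hypothesis R_central : forall y, R y -> exists k, [/\ y = k - 1,
  forall g, G g -> incl k * g = g * incl k & forall x, L (x * incl k) = L x].

Lemma form0 : L 0 = 0.
Proof. by apply: (addrI (L 0)); rewrite -LD !addr0. Qed.
Lemma formB x y : L (x - y) = L x - L y.
Proof. by apply: (addIr (L y)); rewrite -LD !subrK. Qed.

Lemma subalgebra_central (k : S) : (forall g, G g -> k * g = g * k) ->
  forall b : H, k * incl b = incl b * k.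
Proof.
move=> kG -[b hb] /=; have {hb} : in_subalgebra G b by exact/asboolP.
elim=> [g /kG //|c|x y _ IHx _ IHy|x y _ IHx _ IHy].
- by rewrite alg_inC.
- by rewrite mulrDl mulrDr IHx IHy.
- by rewrite mulrA IHx -!mulrA IHy.
Qed.

(** As k is central in H, a (k - 1) b = a b k - a b, and L ignores right multiplication by k. The
    factors [a] and [b] make the statement inductive for two-sided ideals. *)
Lemma ideal_form0 y : in_ideal R y -> forall a b, L (incl (a * y * b)) = 0.
Proof.
elim=> [{}y Ry|a b|x z _ IHx _ IHz a b|c x _ IH a b|x c _ IH a b].
- move=> a b; have [k [-> kG Lk]] := R_central Ry.
  change (L (incl a * (incl k - 1) * incl b) = 0).
  rewrite -mulrA mulrBl mul1r (subalgebra_central kG) mulrBr mulrA formB Lk.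
  exact: subrr.
- by rewrite mulr0 mul0r form0.
- by rewrite mulrDr mulrDl [incl _](raddfD (GRing.RMorphism.clone _ _ val _)) LD IHx IHz addr0.
- by rewrite mulrA; exact: IH.
- by rewrite mulrA -[_ * c * b]mulrA; exact: IH.
Qed.

Definition quotient_form (s : quotient_algebra R) : C := L (incl (quotient_repr s)).

Lemma quotient_formE c : quotient_form (quotient_proj R c) = L (incl c).
Proof.
apply/eqP; rewrite -subr_eq0 -formB; apply/eqP.
have Ic : in_ideal R (quotient_repr (quotient_proj R c) - c).
  exact/quotient_projP/quotient_proj_repr.
by have := ideal_form0 Ic 1 1; rewrite mul1r mulr1.
Qed.

Lemma quotient_formD s t : quotient_form (s + t) = quotient_form s + quotient_form t.
Proof.
rewrite -[s]quotient_proj_repr -[t]quotient_proj_repr -quotient_projD !quotient_formE.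
exact: LD.
Qed.
Lemma quotient_formC c s :
  quotient_form (alg_in (quotient_algebra R) c * s) = c * quotient_form s.
Proof.
rewrite -[s]quotient_proj_repr -quotient_projC -quotient_projM !quotient_formE.
exact: LC.
Qed.
End CentralQuotientForm.

(** * Representations obtained from linear forms on words *)

Section WordRepresentation.
Variables (C : fieldType) (S A : algebra C) (X Y : A) (r : nat) (e : 'I_r -> S).
Variable G : S -> Prop.
Hypothesis GE : forall y, G y -> exists k, y = e k.
Local Notation B := (subalgebra G).
Local Notation incl := (@subalgebra_incl C S G).
Local Notation sc := (alg_in A).

Fixpoint word (w : seq 'I_r) : S := if w is k :: w' then e k * word w' else 1.

Lemma word_cat w w' : word (w ++ w') = word w * word w'.
Proof. by elim: w => [|k w IH] /=; rewrite ?mul1r // IH mulrA. Qed.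

Definition word_span (s : S) : Prop :=
  exists t : seq (C * seq 'I_r), s = \sum_(p <- t) alg_in S p.1 * word p.2.

Lemma word_span_sub (b : B) : word_span (incl b).
Proof.
case: b => b hb /=; have {hb} : in_subalgebra G b by exact/asboolP.
elim=> [g /GE [k ->]|c|x y _ [t ->] _ [t' ->]|x y _ [t ->] _ [t' ->]].
- by exists [:: (1, [:: k])]; rewrite big_seq1 rmorph1 mul1r /= mulr1.
- by exists [:: (c, [::])]; rewrite big_seq1 /= mulr1.
- by exists (t ++ t'); rewrite big_cat.
- exists [seq (p.1 * p'.1, p.2 ++ p'.2) | p <- t, p' <- t'].
  rewrite big_allpairs_dep mulr_suml; apply: eq_bigr => p _.
  rewrite mulr_sumr; apply: eq_bigr => p' _ /=.
  by rewrite word_cat rmorphM -!mulrA; congr (_ * _); rewrite !mulrA alg_inC.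
Qed.

Section Morphism.
Variable (n : nat) (phi : S -> 'M[A]_n) (xx : 'I_r -> 'M[A]_n).
Hypotheses (phiD : forall s t, phi (s + t) = phi s + phi t)
  (phiC : forall c s, phi (alg_in S c * s) = (sc c)%:M *m phi s)
  (phi1 : phi 1 = 1%:M)
  (phiw : forall k w, phi (word (k :: w)) = xx k *m phi (word w)).

Lemma phi0 : phi 0 = 0.
Proof. by apply: (addrI (phi 0)); rewrite -phiD !addr0. Qed.

Lemma phi_sum (I : Type) (t : seq I) (F : I -> S) :
  phi (\sum_(p <- t) F p) = \sum_(p <- t) phi (F p).
Proof.
elim: t => [|p t IH]; first by rewrite !big_nil phi0.
by rewrite !big_cons phiD IH.
Qed.

Lemma phi_wordM w w' : phi (word w * word w') = phi (word w) *m phi (word w').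
Proof.
rewrite -word_cat; elim: w => [|k w IH]; first by rewrite phi1 mul1mx.
by rewrite cat_cons !phiw IH mulmxA.
Qed.

Lemma scalar_mxC (c : C) (M : 'M[A]_n) : M *m (sc c)%:M = (sc c)%:M *m M.
Proof.
apply/matrixP => i j; rewrite !mxE (bigD1 j) //= [RHS](bigD1 i) //= !mxE !eqxx !big1.
- by rewrite !addr0 alg_inC.
- by move=> k /negPf ki; rewrite !mxE eq_sym ki mul0r.
- by move=> k /negPf ki; rewrite !mxE ki mulr0.
Qed.

(** Both sides are bilinear, so words suffice. Linear dependences between words cause no conflict,
    because [phi] is given on all of S. *)
Lemma phiM (b b' : B) : phi (incl b * incl b') = phi (incl b) *m phi (incl b').
Proof.
have [t ->] := word_span_sub b; have [t' ->] := word_span_sub b'.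
rewrite mulr_suml !phi_sum mulmx_suml; apply: eq_bigr => p _.
rewrite mulr_sumr !phi_sum mulmx_sumr; apply: eq_bigr => p' _.
have -> : alg_in S p.1 * word p.2 * (alg_in S p'.1 * word p'.2) =
    alg_in S p.1 * (alg_in S p'.1 * (word p.2 * word p'.2)).
  by rewrite -!mulrA; congr (_ * _); rewrite !mulrA alg_inC.
by rewrite !phiC phi_wordM -!mulmxA; congr (_ *m _); rewrite !mulmxA scalar_mxC.
Qed.

Definition word_rep (b : B) : 'M[A]_n := phi (incl b).

Fact word_rep_zmod : zmod_morphism word_rep.
Proof.
move=> b b'; apply: (addIr (word_rep b')); rewrite subrK -phiD.
by congr phi; change (incl b - incl b' + incl b' = incl b); rewrite subrK.
Qed.
HB.instance Definition _ := GRing.isZmodMorphism.Build _ _ word_rep word_rep_zmod.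
Fact word_rep_monoid : monoid_morphism word_rep.
Proof. by split=> [|b b']; [exact: phi1 | exact: phiM]. Qed.
HB.instance Definition _ := GRing.isMonoidMorphism.Build _ _ word_rep word_rep_monoid.

Definition word_rmorphism : {rmorphism B -> 'M[A]_n} := word_rep.

Lemma word_repC c : word_rep (alg_in B c) = (sc c)%:M.
Proof. by rewrite -[RHS]mulmx1 -phi1 -phiC mulr1. Qed.
End Morphism.

Section FourDim.
Variables (i j : 'I_r) (al be s t : C).
Hypothesis ij : i != j.
Variables f0 fi fj fii fij fjj : S -> C.
Definition linear_form (f : S -> C) := (forall x y, f (x + y) = f x + f y) /\
  (forall c x, f (alg_in S c * x) = c * f x).
Hypotheses (L0 : linear_form f0) (Li : linear_form fi) (Lj : linear_form fj)
  (Lii : linear_form fii) (Lij : linear_form fij) (Ljj : linear_form fjj).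
Hypotheses (f0w : forall w, f0 (word w) = (w == [::])%:R)
  (fiw : forall w, fi (word w) = (w == [:: i])%:R)
  (fjw : forall w, fj (word w) = (w == [:: j])%:R)
  (fiiw : forall w, fii (word w) = (w == [:: i; i])%:R * al)
  (fijw : forall w, fij (word w) = (w == [:: i; j])%:R * s + (w == [:: j; i])%:R * t)
  (fjjw : forall w, fjj (word w) = (w == [:: j; j])%:R * be).

(** The value forced by the generator matrices: words of length 1 determine [x], [y] and with them
    [p], [q], while words of length 2 contribute to the corner, the two mixed ones jointly through
    [fij]. *)
Definition mx4_form (u : S) : 'M[A]_4 :=
  mx4 (sc (f0 u)) (sc (fi u)) (sc (fj u))
      (sc (fi u * al) + sc (fj u * t) * X) (sc (fi u * s) * X + sc (fj u * be) * Y)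
      (sc (fii u) + sc (fij u) * X + sc (fjj u) * Y).
Definition mx4_gen (k : 'I_r) : 'M[A]_4 :=
  if k == i then mx4 0 1 0 (sc al) (sc s * X) 0
  else if k == j then mx4 0 0 1 (sc t * X) (sc be * Y) 0 else 0.

Lemma mx4_gen_left : mx4_gen i = mx4 0 1 0 (sc al) (sc s * X) 0.
Proof. by rewrite /mx4_gen eqxx. Qed.
Lemma mx4_gen_right : mx4_gen j = mx4 0 0 1 (sc t * X) (sc be * Y) 0.
Proof. by rewrite /mx4_gen eq_sym (negPf ij) eqxx. Qed.

Lemma mx4_form_D u v : mx4_form (u + v) = mx4_form u + mx4_form v.
Proof.
rewrite /mx4_form L0.1 Li.1 Lj.1 Lii.1 Lij.1 Ljj.1 mx4D !mulrDl !rmorphD !mulrDl.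
congr mx4; [exact: addrACA|exact: addrACA|].
by rewrite [X in X + _]addrACA; exact: addrACA.
Qed.
Lemma mx4_form_C c u : mx4_form (alg_in S c * u) = (sc c)%:M *m mx4_form u.
Proof.
rewrite /mx4_form L0.2 Li.2 Lj.2 Lii.2 Lij.2 Ljj.2 mx4_scalar mx4M !mul0r !add0r.
by congr mx4; rewrite ?mulrDr ?rmorphM -?mulrA.
Qed.
Lemma mx4_form_1 : mx4_form 1 = 1%:M.
Proof.
have E := (f0w [::], fiw [::], fjw [::], fiiw [::], fijw [::], fjjw [::]).
have -> : mx4_form 1 = mx4_form (word [::]) by [].
rewrite /mx4_form !E !mul0r !addr0 mulr0n mulr1n rmorph1 rmorph0 !mul0r !addr0.
by rewrite mx4_scalar.
Qed.
Lemma mx4_form_word k w : mx4_form (word (k :: w)) = mx4_gen k *m mx4_form (word w).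
Proof.
have E u := (f0w u, fiw u, fjw u, fiiw u, fijw u, fjjw u).
have sc0 : sc 0 = 0 by exact: rmorph0.
have sc1 : sc 1 = 1 by exact: rmorph1.
have ji : j == i = false by rewrite eq_sym; exact: negPf.
have ij' : i == j = false by exact: negPf.
have zero0 : mx4 0 0 0 0 0 0 = 0 :> 'M[A]_4.
  by apply/matrixP => -[[|[|[|[|//]]]] ?] [[|[|[|[|//]]]] ?]; rewrite !mxE.
have simp := (mul0r, mul1r, mulr0, mulr1, addr0, add0r, sc0, sc1, mulr0n, mulr1n).
rewrite /mx4_form !E !eqseq_cons /mx4_gen.
case: w => [|a [|b w]]; rewrite ?eqseq_cons /= ?andbT ?andbF.
- case: (eqVneq k i) => [->|_]; first by rewrite ij' mx4M !simp.
  by case: (eqVneq k j) => _; rewrite ?mx4M ?mul0mx -?zero0 !simp.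
- case: (eqVneq k i) => [->|_].
    rewrite ij' mx4M; case: (eqVneq a i) => [->|_]; first by rewrite ij' !simp.
    by case: (eqVneq a j) => _; rewrite !simp.
  case: (eqVneq k j) => _; last by rewrite mul0mx -zero0 !simp.
  rewrite mx4M; case: (eqVneq a i) => [->|_]; first by rewrite ij' !simp.
  by case: (eqVneq a j) => _; rewrite !simp.
(* For a tail of length at least 2 only the corner [z] can be nonzero, and every generator matrix
   annihilates it. *)
set z := (X in _ = _ *m mx4 _ _ _ _ _ X); clearbody z.
by do 2?case: ifP => _; rewrite ?mul0mx ?mx4M -?zero0 !simp.
Qed.
End FourDim.
End WordRepresentation.

(** * The small half-quantum group *)

Section QuantumGroupAction.
Variables (r : nat) (A : 'M[int]_r) (d : 'I_r -> nat).
Hypotheses (d_gt0 : forall i, (0 < d i)%N)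
  (symA : forall i j, (d i)%:Z * A i j = (d j)%:Z * A j i)
  (diagA : forall i, A i i = 2) (offA : forall i j, i != j -> A i j <= 0).

Local Notation V := (wordfun Qv r).
Local Notation N := (serre_null vQ A d).
Local Notation op := (gen_op vQ A d).
Local Notation U := (quantum_group A d).
Local Notation sc := (alg_in U).
Let v0 := vQ_neq0.
Let vg := vQ_generic.

Lemma qrel_act u x : qrel A d u -> N x -> free_lift op u x = 0.
Proof.
case=> [i|i|i j|i j|i j|i j|i j ij|i j ij] nx.
- rewrite free_lift_inverse_rel.
  by change (opK vQ A d i (opKi vQ A d i x) - x = 0); rewrite opK_opKi // subrr.
- rewrite free_lift_inverse_rel.
  by change (opKi vQ A d i (opK vQ A d i x) - x = 0); rewrite opKi_opK // subrr.
- rewrite free_lift_commutator.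
  change (opK vQ A d i (opK vQ A d j x) - opK vQ A d j (opK vQ A d i x) = 0).
  have -> : opK vQ A d i (opK vQ A d j x) = opK vQ A d j (opK vQ A d i x) by exact: opD_opD.
  exact: subrr.
- rewrite free_lift_conj_rel.
  change (opK vQ A d i (opE vQ A d j (opKi vQ A d i x)) -
    vQ ^ ((d i)%:Z * A i j) *: opE vQ A d j x = 0).
  by rewrite opK_opE // opK_opKi // exprnP exprz_exp subrr.
- rewrite free_lift_conj_rel.
  change (opK vQ A d i (opF Qv j (opKi vQ A d i x)) -
    vQ ^ (- ((d i)%:Z * A i j)) *: opF Qv j x = 0).
  by rewrite opK_opF // opK_opKi // exprnP exprz_exp mulrN subrr.
- have f0 : free_lift op 0 = 0 by exact: raddf0.
  rewrite free_lift_commutator_rel.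
  change (opE vQ A d i (opF Qv j x) - opF Qv j (opE vQ A d i x) -
    free_lift op (if i == j then alg_in _ (v_ d i - (v_ d i)^-1)^-1 *
      (free_gen Qv (gK i) - free_gen Qv (gKinv i)) else 0) x = 0).
  rewrite opE_opF_comm [X in X - _]addrAC subrr add0r.
  case: eqP => _; last by rewrite f0 subrr.
  rewrite free_lift_scaled_diff.
  exact: subrr.
(* The Serre relations of the E's hold on all of V; those of the F's hold on N by its definition at
   the empty word. *)
- by rewrite [free_lift _ _]gen_act_serre (serreE_eq0 _ _ d_gt0).
- by rewrite [free_lift _ _]gen_act_serre; exact: (nx i j ij [::]).
Qed.

Definition qg_act (u : U) (x : V) : V := quotient_act op u x.

Let Nl a x y : N x -> N y -> N (a *: x + y). Proof. exact: serre_null_lin. Qed.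
Let N0 : N 0. Proof. exact: serre_null0. Qed.
Let Nop g x : N x -> N (op g x).
Proof.
case: g => i nx.
- exact: serre_null_opE.
- exact: serre_null_opF.
- exact: serre_null_opD.
- exact: serre_null_opD.
Qed.

Lemma qg_act_stable u x : N x -> N (qg_act u x).
Proof. exact: (quotient_act_stable Nl N0 Nop). Qed.
Lemma qg_actM u u' x : N x -> qg_act (u * u') x = qg_act u (qg_act u' x).
Proof. exact: (quotient_actM Nl N0 Nop qrel_act). Qed.
Lemma qg_actD u u' x : N x -> qg_act (u + u') x = qg_act u x + qg_act u' x.
Proof. exact: (quotient_actD Nl N0 Nop qrel_act). Qed.
Lemma qg_actC c x : N x -> qg_act (sc c) x = c *: x.
Proof. exact: (quotient_actC Nl N0 Nop qrel_act). Qed.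
Lemma qg_act_gen g x : N x -> qg_act (Uv A d g) x = op g x.
Proof. exact: (quotient_act_gen Nl N0 Nop qrel_act). Qed.
Lemma qg_act_genX g n x : N x -> qg_act (Uv A d g ^+ n) x = (op g ^+ n : end_car V) x.
Proof.
move=> nx; apply: (quotient_actX Nl N0 Nop qrel_act) => // y ny; first exact: qg_act_gen.
exact: Nop.
Qed.
Local Notation Lat := (in_lattice vQ d laurent).

Lemma integral_lattice z x : in_integral_form z -> N x -> Lat x -> Lat (qg_act z x).
Proof.
have nX g n y : N y -> N ((op g ^+ n : end_car V) y).
  by move=> ny; rewrite -qg_act_genX //; exact: qg_act_stable.
move=> iz; elim: iz x => [i n|i n|i|i|p n|u w _ IHu _ IHw|u w _ IHu _ IHw] x nx lx.
- rewrite qg_actM // qg_act_genX // qg_actC; last exact: nX.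
  exact: (in_lattice_opEd v0 vg d_gt0 diagA vQ_in vQV_in i n lx).
- rewrite qg_actM // qg_act_genX // qg_actC; last exact: nX.
  exact: in_lattice_opFd.
- by rewrite qg_act_gen //; apply: in_lattice_opK => //; [exact: vQ_in | exact: vQV_in].
- by rewrite qg_act_gen //; apply: in_lattice_opKi => //; [exact: vQ_in | exact: vQV_in].
- by rewrite qg_actC //; apply: in_lattice_scale => //; exact: laurent_in.
- by rewrite qg_actD //; apply: in_latticeD; [exact: IHu | exact: IHw].
- by rewrite qg_actM //; apply: IHu; [exact: qg_act_stable | exact: IHw].
Qed.

Local Notation vac := (@vacuum Qv r).
Let Nvac : N vac. Proof. exact: serre_null_vacuum. Qed.

Definition vacuum_coef (u : U) : Qv := qg_act u vac [::].

Lemma vacuum_coefD u w : vacuum_coef (u + w) = vacuum_coef u + vacuum_coef w.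
Proof. by rewrite /vacuum_coef qg_actD. Qed.
Lemma vacuum_coefC c u : vacuum_coef (sc c * u) = c * vacuum_coef u.
Proof. by rewrite /vacuum_coef qg_actM // qg_actC //; exact: qg_act_stable. Qed.
Lemma vacuum_coef_integral u : in_integral_form u -> vacuum_coef u \in laurent.
Proof.
by move=> iu; have := integral_lattice iu Nvac (in_lattice_vacuum _ _ _) [::]; apply.
Qed.
Lemma vacuum_coefK u i : vacuum_coef (u * Uv A d (gK i)) = v_ d i ^- 2 * vacuum_coef u.
Proof.
rewrite /vacuum_coef qg_actM // qg_act_gen //.
rewrite (_ : op (gK i) vac = v_ d i ^- 2 *: vac); first by rewrite [qg_act _ _]quotient_actZ.
apply/funext => s; change (v_ d i ^ (- wt A i s) * vac s = v_ d i ^- 2 * vac s).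
case: s => [|k s]; last by rewrite /vacuum !mulr0.
by rewrite /wt big_nil subr0.
Qed.

Fixpoint E_word (e : seq 'I_r) : U := if e is k :: e' then Uv A d (gE k) * E_word e' else 1.
(** The order is reversed so that F_w followed by evaluation at the empty word is evaluation at
    [w]. *)
Fixpoint F_word (w : seq 'I_r) : U := if w is k :: w' then F_word w' * Uv A d (gF k) else 1.

Lemma E_word_act e : qg_act (E_word e) vac = foldr (fun k x => opE vQ A d k x) vac e.
Proof.
elim: e => [|k e IH]; first exact: (quotient_act1 Nl N0 Nop qrel_act).
rewrite [E_word _]/(_ * _) qg_actM // IH qg_act_gen //.
by rewrite -IH; exact: qg_act_stable.
Qed.

Lemma vacuum_coef_words w e :
  vacuum_coef (F_word w * E_word e) = foldr (fun k x => opE vQ A d k x) vac e w.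
Proof.
rewrite -E_word_act /vacuum_coef qg_actM //; set x := qg_act (E_word e) vac.
have: N x by exact: qg_act_stable.
elim: w x => [|k w IH] x nx; first by rewrite /= [qg_act _ _](quotient_act1 Nl N0 Nop qrel_act).
rewrite [F_word _]/(_ * _) qg_actM // qg_act_gen // IH //.
exact: (Nop (gF k)).
Qed.

(** * Linear forms on the specialization *)

Section Specialized.
Variables (C : fieldType) (q : C).
Hypothesis q0 : q != 0.
Local Notation Z := (integral_form A d).
Local Notation ev := (laurent_ev q).
Local Notation Y := (Z -> C^o : lmodType C).
Local Notation Sp := (specialization A d q).
Local Notation tens z := (free_gen C (z : Z)).
Local Notation piS := (quotient_proj (@spec_rel r A d C q)).

Lemma integralP (z : Z) : in_integral_form (val z).
Proof. by case: z => z /= h; exact/asboolP. Qed.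

Definition mk_integral (u : U) (iu : in_integral_form u) : Z := exist _ u (asboolT iu).

Definition int_mul (z w : Z) : Z :=
  mk_integral (int_form_mul (integralP z) (integralP w)).
Lemma val_int_mul z w : val (int_mul z w) = val z * val w. Proof. by []. Qed.

(** Right translation turns functions on the integral form into a left module, on which the
    presented algebra can act. *)
Definition right_shift_fun (z : Z) (f : Y) : Y := fun w => f (int_mul w z).
Fact right_shift_linear z : linear (right_shift_fun z). Proof. by []. Qed.
Definition right_shift z : end_algebra Y := mk_end (right_shift_linear z).
Lemma right_shiftE z f w : right_shift z f w = f (int_mul w z). Proof. by []. Qed.

(* The forms that factor through C (x) Z, where v acts on C as q. *)
Definition semilinear_form (f : Y) : Prop :=
  (forall w w1 w2 : Z, val w = val w1 + val w2 -> f w = f w1 + f w2) /\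
  (forall (w w' : Z) p n, val w = sc (laurent_at vQ p n) * val w' ->
     f w = laurent_at q p n * f w').
Local Notation SF := semilinear_form.

Lemma semilinear_lin a f g : SF f -> SF g -> SF (a *: f + g).
Proof.
have E w : (a *: f + g) w = a * f w + g w by [].
move=> [fD fZ] [gD gZ]; split=> [w w1 w2 h|w w' p n h]; rewrite !E.
  by rewrite (fD _ _ _ h) (gD _ _ _ h); ring.
by rewrite (fZ _ _ _ _ h) (gZ _ _ _ _ h); ring.
Qed.

Lemma semilinear0 : SF 0.
Proof.
split=> [w w1 w2 _|w w' p n _].
  by change ((0 : C) = 0 + 0); rewrite addr0.
by change ((0 : C) = laurent_at q p n * 0); rewrite mulr0.
Qed.

Lemma semilinear_shift z f : SF f -> SF (right_shift z f).
Proof.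
move=> [fD fZ]; split=> [w w1 w2 h|w w' p n h]; rewrite !right_shiftE.
  apply: fD; exact: (etrans (congr1 (fun y => y * val z) h) (mulrDl _ _ _)).
by apply: fZ; exact: (etrans (congr1 (fun y => y * val z) h) (esym (mulrA _ _ _))).
Qed.

Lemma spec_rel_act u f : @spec_rel r A d C q u -> SF f -> free_lift right_shift u f = 0.
Proof.
case=> [x y z h|x y z h|z p n h] [fD fZ].
- rewrite free_lift_sum_rel.
  change (right_shift z f - (right_shift x f + right_shift y f) = 0).
  apply/eqP; rewrite subr_eq0; apply/eqP/funext => w; apply: fD.
  exact: (etrans (congr1 ( *%R (val w)) h) (mulrDr _ _ _)).
- rewrite free_lift_prod_rel.
  change (right_shift z f - right_shift x (right_shift y f) = 0).
  apply/eqP; rewrite subr_eq0; apply/eqP/funext => w.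
  change (f (int_mul w z) = f (int_mul (int_mul w x) y)).
  congr f; apply: val_inj.
  exact: (etrans (congr1 ( *%R (val w)) h) (mulrA _ _ _)).
- rewrite free_lift_const_rel.
  change (right_shift z f - laurent_at q p n *: f = 0).
  apply/eqP; rewrite subr_eq0; apply/eqP/funext => w; apply: fZ.
  exact: (etrans (congr1 ( *%R (val w)) h) (esym (alg_inC _ _))).
Qed.

Definition spec_act (s : Sp) (f : Y) : Y := quotient_act right_shift s f.

Lemma spec_act_stable s f : SF f -> SF (spec_act s f).
Proof. exact: (quotient_act_stable semilinear_lin semilinear0 semilinear_shift). Qed.
Lemma spec_actM s t f : SF f -> spec_act (s * t) f = spec_act s (spec_act t f).
Proof. exact: (quotient_actM semilinear_lin semilinear0 semilinear_shift spec_rel_act). Qed.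
Lemma spec_actD s t f : SF f -> spec_act (s + t) f = spec_act s f + spec_act t f.
Proof. exact: (quotient_actD semilinear_lin semilinear0 semilinear_shift spec_rel_act). Qed.
Lemma spec_actC c f : SF f -> spec_act (alg_in Sp c) f = c *: f.
Proof. exact: (quotient_actC semilinear_lin semilinear0 semilinear_shift spec_rel_act). Qed.
Lemma spec_act_gen z f : SF f -> spec_act (piS (tens z)) f = right_shift z f.
Proof. exact: (quotient_act_gen semilinear_lin semilinear0 semilinear_shift spec_rel_act). Qed.

Definition coef_form : Y := fun z => ev (vacuum_coef (val z)).

Lemma coef_form_semilinear : SF coef_form.
Proof.
have vi z : vacuum_coef (val (z : Z)) \in laurent.
  by apply: vacuum_coef_integral; exact: integralP.
split=> [w w1 w2 h|w w' p n h]; rewrite /coef_form h.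
  by rewrite vacuum_coefD laurent_evD.
by rewrite vacuum_coefC laurent_evM ?laurent_in // laurent_evE.
Qed.

Lemma int_one_subproof : in_integral_form (1 : U).
Proof. by rewrite -(rmorph1 sc) -(laurent_at1 vQ); exact: int_form_scalar. Qed.
Definition int_one : Z := mk_integral int_one_subproof.

(** Translating by z and evaluating at 1 returns the value at z. *)
Definition spec_coef (s : Sp) : C := spec_act s coef_form int_one.

Lemma spec_coefD s t : spec_coef (s + t) = spec_coef s + spec_coef t.
Proof. by rewrite /spec_coef spec_actD //; exact: coef_form_semilinear. Qed.
Lemma spec_coefC c s : spec_coef (alg_in Sp c * s) = c * spec_coef s.
Proof.
rewrite /spec_coef spec_actM ?spec_actC //; last exact: coef_form_semilinear.
exact/spec_act_stable/coef_form_semilinear.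
Qed.
Lemma spec_coef_gen z : spec_coef (piS (tens z)) = ev (vacuum_coef (val z)).
Proof.
rewrite /spec_coef spec_act_gen; last exact: coef_form_semilinear.
by rewrite right_shiftE /coef_form val_int_mul mul1r.
Qed.

Lemma spec_tensM (x y z : Z) : val z = val x * val y ->
  piS (tens z) = piS (tens x) * piS (tens y).
Proof. by move=> h; rewrite -quotient_projM; apply/quotient_proj_rel/spec_mul. Qed.

Lemma spec_tens_scalar (x z : Z) p n : val z = sc (laurent_at vQ p n) * val x ->
  piS (tens z) = alg_in Sp (laurent_at q p n) * piS (tens x).
Proof.
move=> h; have ip := int_form_scalar A d p n.
apply: (etrans (@spec_tensM (mk_integral ip) x z h)); congr (_ * _).
by apply/quotient_proj_rel/spec_scalar.
Qed.

(** Uniform in the field: the same [p] and [n] must describe the power of v in U and the power of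
    [q] in the specialization. *)
Lemma laurent_power (m : int) : exists p n, forall (L : fieldType) (x : L), x != 0 ->
  laurent_at x p n = x ^ m.
Proof.
case: m => m.
  by exists 'X^m, 0 => L x x0; rewrite /laurent_at map_polyXn hornerXn divr1.
exists 1, m.+1 => L x x0; rewrite /laurent_at rmorph1 hornerC NegzE -exprnN.
exact: mul1r.
Qed.

Lemma conj_swap (S : pzRingType) (k k' x y : S) : k' * k = 1 -> k * x * k' = y -> k * x = y * k.
Proof. by move=> h <-; rewrite -mulrA h mulr1. Qed.
Lemma inverse_swap (S : pzRingType) (k k' x : S) :
  k' * k = 1 -> k * k' = 1 -> x * k = k * x -> x * k' = k' * x.
Proof. by move=> h h' xk; rewrite -[LHS]mul1r -h -mulrA [k * _]mulrA -xk -mulrA h' mulr1. Qed.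

Lemma Uv_KKi i : Uv A d (gK i) * Uv A d (gKinv i) = 1.
Proof. exact: (etrans (esym (quotient_projM _ _ _)) (quotient_proj_rel (rel_KKi A d i))). Qed.
Lemma Uv_KiK i : Uv A d (gKinv i) * Uv A d (gK i) = 1.
Proof. exact: (etrans (esym (quotient_projM _ _ _)) (quotient_proj_rel (rel_KiK A d i))). Qed.
Lemma Uv_KK i j : Uv A d (gK i) * Uv A d (gK j) = Uv A d (gK j) * Uv A d (gK i).
Proof.
exact: (etrans (esym (quotient_projM _ _ _))
  (etrans (quotient_proj_rel (rel_KK A d i j)) (quotient_projM _ _ _))).
Qed.

Lemma Uv_K_swap i g : exists m : int,
  Uv A d (gK i) * Uv A d g = sc (vQ ^ m) * (Uv A d g * Uv A d (gK i)).
Proof.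
case: g => j.
- exists ((d i)%:Z * A i j); apply: (etrans _ (esym (mulrA _ _ _))).
  apply: (conj_swap (Uv_KiK i)).
  apply: (etrans (congr1 (fun y => y * _) (esym (quotient_projM _ _ _)))).
  exact: (etrans (esym (quotient_projM _ _ _))
    (etrans (quotient_proj_rel (rel_KE A d i j)) (quotient_projM _ _ _))).
- exists (- ((d i)%:Z * A i j)); apply: (etrans _ (esym (mulrA _ _ _))).
  apply: (conj_swap (Uv_KiK i)).
  apply: (etrans (congr1 (fun y => y * _) (esym (quotient_projM _ _ _)))).
  exact: (etrans (esym (quotient_projM _ _ _))
    (etrans (quotient_proj_rel (rel_KF A d i j)) (quotient_projM _ _ _))).
- exists 0; apply: (etrans (Uv_KK i j)); apply: esym.
  exact: (etrans (congr1 (fun y => y * _) (rmorph1 sc)) (mul1r _)).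
- exists 0; apply: (etrans (inverse_swap (Uv_KiK j) (Uv_KKi j) (Uv_KK i j))); apply: esym.
  exact: (etrans (congr1 (fun y => y * _) (rmorph1 sc)) (mul1r _)).
Qed.

Lemma spec_K_swap i (x : qgen r) (k g : Sp) :
  @spec_elt r A d C q (Uv A d (gK i)) k -> @spec_elt r A d C q (Uv A d x) g ->
  exists m : int, k * g = alg_in Sp (q ^ m) * (g * k).
Proof.
case=> zk hk -> [zx hx ->]; have [m hm] := Uv_K_swap i x.
have [p [n hpn]] := laurent_power m; exists m; rewrite -(hpn C q q0).
apply: (etrans (esym (@spec_tensM zk zx (int_mul zk zx) erefl))).
apply: (etrans _ (congr1 ( *%R _) (@spec_tensM zx zk (int_mul zx zk) erefl))).
apply: spec_tens_scalar; rewrite (hpn _ vQ v0).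
apply: (etrans (congr2 *%R hk hx)); apply: (etrans hm).
exact: (congr1 ( *%R _) (esym (congr2 *%R hx hk))).
Qed.

Lemma spec_coef_K i (k x : Sp) : @spec_elt r A d C q (Uv A d (gK i)) k ->
  spec_coef (x * k) = q ^- (d i * 2) * spec_coef x.
Proof.
case=> z hz ->; rewrite /spec_coef spec_actM; last exact: coef_form_semilinear.
rewrite spec_act_gen; last exact: coef_form_semilinear.
have -> : right_shift z coef_form = q ^- (d i * 2) *: coef_form.
  apply/funext => u.
  change (ev (vacuum_coef (val u * val z)) = q ^- (d i * 2) * ev (vacuum_coef (val u))).
  rewrite hz vacuum_coefK /v_ -exprM laurent_evM ?laurent_evV //.
    by rewrite -exprVn rpredX // vQV_in.
  by apply: vacuum_coef_integral; exact: integralP.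
by rewrite [spec_act _ _]quotient_actZ.
Qed.

(** * Linear forms on the small quantum group *)

Section Small.
Variable l : nat.
Hypotheses (ql : q ^+ l = 1).
Local Notation Ch := (chevalley_subalgebra A d q).
Local Notation Sm := (small_quantum_group A d q l).
Local Notation incl := (@subalgebra_incl C Sp (@chevalley_generator r A d C q)).
Local Notation piM := (quotient_proj (@small_rel r A d C q l)).

(** The commutation factors q^m of K_i and its eigenvalue on the form are powers of [q], so their
    l-th powers are 1. *)
Lemma small_rel_central y : @small_rel r A d C q l y -> exists k : Ch, [/\ y = k - 1,
  forall g, chevalley_generator g -> incl k * g = g * incl k &
  forall x, spec_coef (x * incl k) = spec_coef x].
Proof.
case=> i [k [hk ->]]; exists (k ^+ l).
have inclX n : incl (k ^+ n) = incl k ^+ n.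
  by elim: n => // n IH; rewrite !exprS -IH.
split; [exact: erefl|move=> g [x hx]|move=> x].
  rewrite inclX; have [m hm] := spec_K_swap hk hx.
  apply: (etrans (qcommute_power l hm)).
  have -> : (q ^ m) ^+ l = 1 by rewrite !exprnP exprzAC -exprnP ql exp1rz.
  exact: (etrans (congr1 (fun y => y * _) (rmorph1 (alg_in Sp))) (mul1r _)).
rewrite inclX; apply: (etrans (form_power l x (fun x => spec_coef_K x hk))).
have -> : (q ^- (d i * 2)) ^+ l = 1.
  by rewrite -exprVn -exprM mulnC exprM exprVn ql invr1 expr1n.
exact: mul1r.
Qed.

Lemma Uv_E_integral i : in_integral_form (Uv A d (gE i)).
Proof.
suff <- : sc (qfact (v_ d i) 1)^-1 * Uv A d (gE i) ^+ 1 = Uv A d (gE i) by exact: int_form_E.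
rewrite expr1 (_ : qfact _ 1 = 1); last first.
  by rewrite /qfact big_nat1 qint_qz (qz1 (vi0 d v0 i) (vi_generic vg d_gt0 i)).
exact: (etrans (congr1 (fun y => sc y * _) (invr1 _))
  (etrans (congr1 (fun y => y * _) (rmorph1 sc)) (mul1r _))).
Qed.
Lemma Uv_F_integral i : in_integral_form (Uv A d (gF i)).
Proof.
suff <- : sc (qfact (v_ d i) 1)^-1 * Uv A d (gF i) ^+ 1 = Uv A d (gF i) by exact: int_form_F.
rewrite expr1 (_ : qfact _ 1 = 1); last first.
  by rewrite /qfact big_nat1 qint_qz (qz1 (vi0 d v0 i) (vi_generic vg d_gt0 i)).
exact: (etrans (congr1 (fun y => sc y * _) (invr1 _))
  (etrans (congr1 (fun y => y * _) (rmorph1 sc)) (mul1r _))).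
Qed.

Definition int_E i : Z := mk_integral (Uv_E_integral i).
Definition int_F i : Z := mk_integral (Uv_F_integral i).

Fact chev_E_subproof i : piS (tens (int_E i)) \in subalgebra_pred (@chevalley_generator r A d C q).
Proof. by apply/asboolP/in_subalgebra_gen; exists (gE i), (int_E i). Qed.
Fact chev_F_subproof i : piS (tens (int_F i)) \in subalgebra_pred (@chevalley_generator r A d C q).
Proof. by apply/asboolP/in_subalgebra_gen; exists (gF i), (int_F i). Qed.
Definition chev_E i : Ch := SubalgebraElt (chev_E_subproof i).
Definition chev_F i : Ch := SubalgebraElt (chev_F_subproof i).

Definition small_e i : Sm := piM (chev_E i).

Lemma small_E_gen (y : Sm) : small_E y -> exists i, y = small_e i.
Proof.
case=> i [e [[z hz he] ->]]; exists i; congr (quotient_proj _ _); apply: val_inj.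
by apply: (etrans he); congr (quotient_proj _ (free_gen C _)); exact: val_inj.
Qed.

Fixpoint chev_E_word (e : seq 'I_r) : Ch := if e is k :: e' then chev_E k * chev_E_word e' else 1.
Fixpoint chev_F_word (w : seq 'I_r) : Ch := if w is k :: w' then chev_F_word w' * chev_F k else 1.

Lemma small_word e : word small_e e = piM (chev_E_word e).
Proof.
elim: e => [|k e IH] //.
exact: (etrans (congr1 ( *%R _) IH) (esym (quotient_projM _ _ _))).
Qed.

Lemma spec_tens1 : piS (tens int_one) = 1.
Proof.
have h : val int_one = sc (laurent_at vQ 1 0).
  by rewrite laurent_at1; exact: (esym (rmorph1 sc)).
apply: (etrans (quotient_proj_rel (spec_scalar q h))).
by rewrite laurent_at1; exact: (rmorph1 (alg_in Sp)).
Qed.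

Lemma chev_E_word_tens e : exists2 z : Z, val z = E_word e & incl (chev_E_word e) = piS (tens z).
Proof.
elim: e => [|k e [z hz IH]]; first by exists int_one => //; exact: (esym spec_tens1).
exists (int_mul (int_E k) z); first exact: (congr1 ( *%R _) hz).
exact: (etrans (congr1 ( *%R _) IH) (esym (@spec_tensM (int_E k) z (int_mul (int_E k) z) erefl))).
Qed.
Lemma chev_F_word_tens w : exists2 z : Z, val z = F_word w & incl (chev_F_word w) = piS (tens z).
Proof.
elim: w => [|k w [z hz IH]]; first by exists int_one => //; exact: (esym spec_tens1).
exists (int_mul z (int_F k)); first exact: (congr1 (fun y => y * _) hz).
exact: (etrans (congr1 (fun y => y * _) IH) (esym (@spec_tensM z (int_F k) (int_mul z (int_F k)) erefl))).
Qed.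

(** The F's lie outside the half-quantum group, so the forms live on the whole small quantum group
    and are restricted afterwards. *)
Definition small_form (w : seq 'I_r) (s : Sm) : C :=
  @quotient_form C Sp _ spec_coef (@small_rel r A d C q l) (piM (chev_F_word w) * s).

Lemma small_form_linear w : linear_form (small_form w).
Proof.
split=> [x y|c x]; rewrite /small_form.
  rewrite mulrDr; exact: (quotient_formD spec_coefD small_rel_central).
rewrite mulrA -alg_inC -mulrA.
exact: (quotient_formC spec_coefD spec_coefC small_rel_central).
Qed.

Lemma small_form_word w e :
  small_form w (word small_e e) = ev (foldr (fun k x => opE vQ A d k x) vac e w).
Proof.
rewrite /small_form small_word.
apply: (etrans (congr1 _ (esym (quotient_projM _ _ _)))).
apply: (etrans (quotient_formE spec_coefD small_rel_central _)).
have [z hz hE] := chev_E_word_tens e; have [z' hz' hF] := chev_F_word_tens w.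
apply: (etrans (congr1 _ (congr2 *%R hF hE))).
apply: (etrans (congr1 _ (esym (@spec_tensM z' z (int_mul z' z) erefl)))).
apply: (etrans (spec_coef_gen _)); apply: (congr1 ev).
apply: (etrans _ (vacuum_coef_words w e)).
exact: (congr1 vacuum_coef (congr2 *%R hz' hz)).
Qed.

Hypotheses (l_odd : odd l) (two_neq0 : (2 : C) != 0).

Local Notation qz2 i := (qz (v_ d i) 2).

Lemma qz2_in i : qz2 i \in laurent.
Proof. exact: (qz_in v0 vg d_gt0 vQ_in vQV_in). Qed.

(** If q^d + q^(-d) = 0 then q^(2 d) = -1, and raising to the odd power [l] gives 1 = -1. *)
Lemma ev_qz2_neq0 i : ev (qz2 i) != 0.
Proof.
rewrite (qz_two (vi0 d v0 i) (vi_generic vg d_gt0 i)).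
rewrite /v_ laurent_evD ?rpredX ?vQ_in //; last by rewrite -exprVn rpredX ?vQV_in.
rewrite (laurent_evX q0) (laurent_evV q0) addr_eq0; apply/eqP => h.
have : (q ^+ d i * q ^+ d i) ^+ l = 1.
  by rewrite -exprD -exprM mulnC exprM ql expr1n.
rewrite {2}h mulrN mulfV ?expf_neq0 // -signr_odd l_odd expr1 => /eqP.
by rewrite eq_sym -addr_eq0 -[1 + 1]/(2 : C) (negPf two_neq0).
Qed.

Lemma ev_qz2M_neq0 i j : ev (qz2 i * qz2 j) != 0.
Proof. by rewrite laurent_evM ?qz2_in // mulf_neq0 ?ev_qz2_neq0. Qed.

Local Notation vw := (vacuum_word vQ A d).
Local Notation wd := (word small_e).

Lemma small_form_word_size w e : size w != size e -> small_form w (wd e) = 0.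
Proof. by move=> h; rewrite small_form_word [foldr _ _ _ _]vacuum_word_size // (laurent_ev0 q0). Qed.

Lemma small_form_word0 e : small_form [::] (wd e) = (e == [::])%:R.
Proof.
case: e => [|k e]; last by rewrite small_form_word_size.
by rewrite small_form_word; exact: (laurent_ev1 q0).
Qed.

Lemma small_form_word1 i e : small_form [:: i] (wd e) = (e == [:: i])%:R * ev (qz2 i).
Proof.
case: e => [|a [|b e]]; first by rewrite small_form_word_size ?mul0r.
  2: by rewrite small_form_word_size // eqseq_cons andbF mul0r.
rewrite small_form_word [foldr _ _ _ _]vacuum_word1 eqseq_cons andbT [a == i]eq_sym.
by case: eqP => [->|_]; rewrite ?mul1r // !mul0r (laurent_ev0 q0).
Qed.

Lemma small_form_word2 i j e : small_form [:: i; j] (wd e) =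
  (if i == j then (e == [:: i; i])%:R * ev (qz2 i * qz2 i) else
    (e == [:: i; j])%:R * ev (qz (v_ d i) (2 - A i j) * qz2 j) +
    (e == [:: j; i])%:R * ev (qz2 j * qz2 i)).
Proof.
case: e => [|a [|b [|c e]]].
- by rewrite small_form_word_size // !mul0r addr0 if_same.
- by rewrite small_form_word_size // !eqseq_cons !andbF !mul0r addr0 if_same.
2: by rewrite small_form_word_size // !eqseq_cons !andbF !mul0r addr0 if_same.
rewrite small_form_word [foldr _ _ _ _]vacuum_word2 !eqseq_cons !andbT.
rewrite ![_ == i]eq_sym ![_ == j]eq_sym.
case: (eqVneq i j) => [<-|ij].
  case: (eqVneq i a) => [<-|_]; last by rewrite !andbF !mul0r addr0 (laurent_ev0 q0).
  case: (eqVneq i b) => [<-|_]; last by rewrite !mul0r addr0 (laurent_ev0 q0).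
  by rewrite diagA subrr qz0 mul0r mulr0 addr0 !mul1r.
case: (eqVneq i a) => [<-|_].
  have ji : (j == i) = false by rewrite eq_sym (negPf ij).
  rewrite ji andbF !andFb !mul0r add0r addr0 andTb.
  by case: eqP => [<-|_]; rewrite ?mul1r // !mul0r (laurent_ev0 q0).
rewrite !mul0r add0r addr0 andbC.
case: (eqVneq j a) => [<-|_]; last by rewrite !mul0r (laurent_ev0 q0).
by case: (eqVneq i b) => [<-|_]; rewrite ?mul1r // !mul0r (laurent_ev0 q0).
Qed.

Lemma linear_form_scale a f : linear_form f -> linear_form (fun s : Sm => a * f s).
Proof.
by move=> [fD fC]; split=> [x y|c x]; rewrite ?fD ?fC ?mulrDr // mulrCA.
Qed.

Lemma small_half_quantum_group_wild (i j : 'I_r) : i != j -> wild (small_half_quantum_group A d q l).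
Proof.
move=> ij.
have Lf := small_form_linear.
(* F_i E_i has coefficient [2] on the vacuum, so the forms of degree 1 are normalized; the values in
   degree 2 are kept as al, be, s and t. *)
pose fi s := (ev (qz2 i))^-1 * small_form [:: i] s.
pose fj s := (ev (qz2 j))^-1 * small_form [:: j] s.
have Li : linear_form fi by exact: linear_form_scale.
have Lj : linear_form fj by exact: linear_form_scale.
have fiw e : fi (wd e) = (e == [:: i])%:R.
  by rewrite /fi small_form_word1 mulrC mulfK // ev_qz2_neq0.
have fjw e : fj (wd e) = (e == [:: j])%:R.
  by rewrite /fj small_form_word1 mulrC mulfK // ev_qz2_neq0.
have fiiw e : small_form [:: i; i] (wd e) = (e == [:: i; i])%:R * ev (qz2 i * qz2 i).
  by rewrite small_form_word2 eqxx.
have fjjw e : small_form [:: j; j] (wd e) = (e == [:: j; j])%:R * ev (qz2 j * qz2 j).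
  by rewrite small_form_word2 eqxx.
have fijw e : small_form [:: i; j] (wd e) =
    (e == [:: i; j])%:R * ev (qz (v_ d i) (2 - A i j) * qz2 j) +
    (e == [:: j; i])%:R * ev (qz2 j * qz2 i).
  by rewrite small_form_word2 (negPf ij).
pose FA := free_algebra_XY C.
pose X : FA := free_gen C true; pose Y : FA := free_gen C false.
pose phi := mx4_form X Y (ev (qz2 i * qz2 i)) (ev (qz2 j * qz2 j))
  (ev (qz (v_ d i) (2 - A i j) * qz2 j)) (ev (qz2 j * qz2 i))
  (small_form [::]) fi fj (small_form [:: i; i]) (small_form [:: i; j]) (small_form [:: j; j]).
have phiD : forall s t, phi (s + t) = phi s + phi t by exact: mx4_form_D.
have phiC : forall c s, phi (alg_in _ c * s) = (alg_in FA c)%:M *m phi s by exact: mx4_form_C.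
have phi1 : phi 1 = 1%:M.
  exact: (mx4_form_1 X Y small_form_word0 fiw fjw fiiw fijw fjjw).
have phiw k w := mx4_form_word X Y ij small_form_word0 fiw fjw fiiw fijw fjjw k w.
pose rho := word_rmorphism (G := @small_E r A d C q l) small_E_gen phiD phiC phi1 phiw.
have gen_in k : small_e k \in subalgebra_pred (@small_E r A d C q l).
  apply/asboolP/in_subalgebra_gen; exists k, (chev_E k); split=> //.
  by exists (int_E k).
pose b k : small_half_quantum_group A d q l := SubalgebraElt (gen_in k).
have rhob k : rho (b k) = mx4_gen X Y i j (ev (qz2 i * qz2 i)) (ev (qz2 j * qz2 j))
  (ev (qz (v_ d i) (2 - A i j) * qz2 j)) (ev (qz2 j * qz2 i)) k.
  apply: (etrans (congr1 phi (esym (mulr1 (small_e k))))).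
  apply: (etrans (phiw k [::])); apply: (etrans (congr1 (mulmx _) phi1)).
  exact: mulmx1.
apply: (@wild_criterion C _ rho (b i) (b j) (ev (qz2 i * qz2 i)) (ev (qz2 j * qz2 j))
  (ev (qz (v_ d i) (2 - A i j) * qz2 j)) (ev (qz2 j * qz2 i))).
- exact: (word_repC (@small_E r A d C q l) phiC phi1).
- exact: ev_qz2M_neq0.
- exact: ev_qz2M_neq0.
- exact: (ev_qz2M_neq0 j i).
- exact: (etrans (rhob i) (mx4_gen_left X Y i j _ _ _ _)).
- exact: (etrans (rhob j) (mx4_gen_right X Y _ _ _ _ ij)).
Qed.

End Small.
End Specialized.
End QuantumGroupAction.

Local Open Scope complex_scope.

Theorem theorem5p4 (R : realType) (g : vectType R[i]) (br : g -> g -> g)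
    (h : {vspace g}) (r : nat) (alpha : 'I_r -> 'Hom(subvs_of h, R[i]^o))
    (A : 'M[int]_r) (d : 'I_r -> nat) (q : R[i]) (l : nat) :
  lie_bracket br ->
  simple_lie br ->
  cartan_subalgebra br h ->
  is_base br alpha ->
  is_cartan_matrix br alpha A ->
  is_symmetrizer A d ->
  (2 <= r)%N ->
  l.-primitive_root q ->
  (1 < l)%N ->
  odd l ->
  (type_G2 A -> ~~ (3 %| l)%N) ->
  wild (small_half_quantum_group A d q l).
Proof.
move=> brP _ _ baseP cartanP [d_gt0 symA _] r2 q_prim _ l_odd _.
have ql := prim_expr_order q_prim.
have q0 : q != 0.
  apply/eqP => q0; have /eqP := ql; rewrite q0 expr0n.
  rewrite (negPf (lt0n_neq0 (prim_order_gt0 q_prim))).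
  by rewrite eq_sym oner_eq0.
have two0 : (2 : R[i]) != 0 by rewrite pnatr_eq0.
have diagA := cartan_diag cartanP; have offA := cartan_offdiag brP baseP cartanP.
(* Rank at least 2 provides two distinct simple roots, with indices 0 and 1. *)
exact: (@small_half_quantum_group_wild _ _ _ d_gt0 symA diagA offA _ _ q0 _ ql l_odd two0
  (Ordinal (ltnW r2)) (Ordinal r2)).
Qed.
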